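(* Let $\Delta>1$ and let $\lambda$ satisfy $0<\lambda<\lambda_c(\Delta)$, where $\lambda_c(\Delta)=\frac{\Delta^\Delta}{(\Delta-1)^{\Delta+1}}$. Let $\mathcal{G}$ be a family of finite graphs of connective constant at most $\Delta$. Then there is a fully polynomial-time approximation scheme (FPTAS) for the partition function of the hard core model with vertex activity $\lambda$ for all graphs in $\mathcal{G}$: a deterministic algorithm which, given $G\in\mathcal{G}$ with $n$ vertices and $\epsilon\in(0,1]$, outputs $\hat Z$ with $(1-\epsilon)Z_G(\lambda)\le \hat Z\le (1+\epsilon)Z_G(\lambda)$ in time polynomial in $n$ and $1/\epsilon$. Further, even if the family $\mathcal{G}$ also contains locally finite infinite graphs (each of connective constant at most $\Delta$), the hard core model with vertex activity $\lambda$ exhibits strong spatial mixing on all graphs in $\mathcal{G}$.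
   Context: Hard core model: for a graph $G=(V,E)$ and vertex activity $\lambda>0$, each independent set $I$ gets weight $\lambda^{|I|}$; the partition function is $Z_G(\lambda)=\sum_{I}\lambda^{|I|}$ over all independent sets, and the Gibbs distribution is $\mu(I)=\lambda^{|I|}/Z_G(\lambda)$. A boundary condition $\sigma=(S,I_S)$ is a set $S\subseteq V$ with an independent set $I_S\subseteq S$. For a vertex $v$, $p_v(\sigma,G)$ is the probability that $v$ belongs to a random independent set drawn from the Gibbs distribution conditioned on its intersection with $S$ being $I_S$, and the occupation ratio is $R_v(\sigma,G)=p_v(\sigma,G)/(1-p_v(\sigma,G))$ (for infinite graphs this is understood for boundary conditions leaving only finitely many vertices unfixed). Strong spatial mixing on a family $\mathcal{F}$: there is a constant $c\in[0,1)$ such that for every $G\in\mathcal{F}$, every vertex $v$ of $G$, and any two boundary conditions $\sigma,\tau$ on $G$ differing only at vertices at distance at least $\ell$ from $v$, $|R_v(\sigma,G)-R_v(\tau,G)|=O(c^\ell)$. Let $N(v,\ell)$ be the number of self-avoiding walks of length $\ell$ starting at $v$. A family $\mathcal{F}$ of finite graphs has connective constant at most $\Delta$ if there are constants $a,c$ such that for every $G=(V,E)\in\mathcal{F}$, every $v\in V$ and all $\ell\ge a\log|V|$, $\sum_{i=1}^{\ell}N(v,i)\le c\Delta^\ell$. A locally finite infinite graph $G$ has connective constant $\sup_{v}\limsup_{\ell\to\infty}N(v,\ell)^{1/\ell}$.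
   Formalization: In strong spatial mixing the rate c is common to the family, but the constant hidden in O(c^ℓ) may depend on G and v, and is uniform over finite graphs only for ℓ ≥ a log|V| (some a): a fully uniform constant fails, e.g. for the family of all finite trees. *)

(* Defs.v *)
From HB Require Import structures.
From mathcomp Require Import all_boot all_order all_algebra finmap.
From mathcomp Require Import all_classical all_reals all_analysis.

Set Implicit Arguments.
Unset Strict Implicit.
Unset Printing Implicit Defensive.

Import Order.TTheory GRing.Theory Num.Theory.

Local Open Scope classical_set_scope.
Local Open Scope ring_scope.

(** ** Graphs and self-avoiding walks *)

Record graph := Graph {
  vert :> choiceType ;
  adj : rel vert ;
  adj_sym : symmetric adj ;
  adj_irrefl : irreflexive adj
}.

Definition graph_family := graph -> Prop.

Definition finite_graph (G : graph) : Prop := finite_set [set: G].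

Definition locally_finite (G : graph) : Prop :=
  forall v : G, finite_set [set u | adj v u].

(* Both are meaningful for finite graphs only: [fset_set] sends infinite sets
   to [fset0]. *)
Definition vertices (G : graph) : {fset G} := fset_set [set: G].
Definition graph_order (G : graph) : nat := #|` vertices G|.

Definition independent (G : graph) (J : set G) : Prop :=
  forall x y : G, J x -> J y -> ~~ adj x y.

(* [p] lists the vertices visited after the starting vertex [v]. *)
Definition saws (G : graph) (v : G) (l : nat) : set (seq G) :=
  [set p | [/\ size p = l, path (@adj G) v p & uniq (v :: p)]].

Definition nb_saws (G : graph) (v : G) (l : nat) : nat :=
  #|` fset_set (saws v l)|.

(* True in particular when [u] is not reachable from [v]. *)
Definition dist_ge (G : graph) (v u : G) (l : nat) : Prop :=
  forall p : seq G, path (@adj G) v p -> last v p = u -> (l <= size p)%N.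

(** ** Connective constant *)

Definition family_connective_constant_le (R : realType) (F : graph_family)
    (Delta : R) : Prop :=
  exists a c : R, forall G : graph, F G -> forall (v : G) (l : nat),
    a * ln (graph_order G)%:R <= l%:R ->
    (\sum_(1 <= i < l.+1) nb_saws v i)%N%:R <= c * Delta ^+ l.

Definition connective_constant (R : realType) (G : graph) : \bar R :=
  ereal_sup (range (fun v : G =>
    limn_esup (fun l : nat => ((nb_saws v l)%:R `^ (l%:R^-1))%:E))).

(** ** The hard core model *)

Definition lambda_c (R : realType) (Delta : R) : R :=
  Delta `^ Delta / (Delta - 1) `^ (Delta + 1).

Definition partition_function (R : realType) (lambda : R) (G : graph) : R :=
  \sum_(J <- fpowerset (vertices G) | `[< independent [set` J] >])
    lambda ^+ #|` J|.

Definition gibbs (R : realType) (lambda : R) (G : graph) (J : {fset G}) : R :=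
  lambda ^+ #|` J| / partition_function lambda G.

Record boundary_condition (G : graph) := BoundaryCondition {
  bc_fixed : set G ;
  bc_occ : set G ;
  bc_occ_fixed : bc_occ `<=` bc_fixed ;
  bc_occ_independent : independent bc_occ ;
  bc_unfixed_finite : finite_set (~` bc_fixed)
}.

Definition unfixed (G : graph) (s : boundary_condition G) : {fset G} :=
  fset_set (~` bc_fixed s).

(* A configuration agreeing with [s] is determined by the finite set [A] of
   its unfixed occupied vertices. *)
Definition extension (G : graph) (s : boundary_condition G) (A : {fset G}) :
  set G := bc_occ s `|` [set` A].

(* The constant factor [lambda ^+ #|bc_occ s|] of the conditional weights is
   dropped, so that the formula also makes sense for infinite graphs;
   [occ_prob_finite] below shows that, on finite graphs, this is [gibbs]
   conditioned on the intersection with [bc_fixed s] being [bc_occ s]. *)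
Definition occ_prob (R : realType) (lambda : R) (G : graph)
    (s : boundary_condition G) (v : G) : R :=
  (\sum_(A <- fpowerset (unfixed s) |
       `[< independent (extension s A) /\ extension s A v >])
     lambda ^+ #|` A|)
  / (\sum_(A <- fpowerset (unfixed s) | `[< independent (extension s A) >])
       lambda ^+ #|` A|).

(* If [v] is fixed to be occupied, the ratio is infinite; here it is the
   junk value 0. Two boundary conditions that agree at [v] are then treated
   alike. *)
Definition occ_ratio (R : realType) (lambda : R) (G : graph)
    (s : boundary_condition G) (v : G) : R :=
  occ_prob lambda s v / (1 - occ_prob lambda s v).

Lemma gibbs_sum (R : realType) (lambda : R) (G : graph)
    (s : boundary_condition G) (finG : finite_graph G)
    (P : set G -> Prop) :
  \sum_(J <- fpowerset (vertices G) |
       `[< [/\ independent [set` J], [set` J] `&` bc_fixed s = bc_occ s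
             & P [set` J]] >])
    gibbs lambda J =
  (lambda ^+ #|` fset_set (bc_occ s)| / partition_function lambda G) *
  \sum_(A <- fpowerset (unfixed s) |
       `[< independent (extension s A) /\ P (extension s A) >])
    lambda ^+ #|` A|.
Proof.
set O := fset_set _.
have fin (B : set G) : finite_set B by apply: sub_finite_set finG.
have OE : [set` O] = bc_occ s by rewrite fset_setK.
have inU x : (x \in unfixed s) = `[< ~ bc_fixed s x >].
  by rewrite in_fset_set //; apply/asboolP/asboolP.
have extE A : extension s A = [set` (O `|` A)%fset].
  by rewrite set_fsetU OE.
have disj A : (A `<=` unfixed s)%fset -> [disjoint O & A]%fset.
  move=> /fsubsetP sA; apply/fdisjointP => x.
  rewrite in_fset_set // inE => /(@bc_occ_fixed _ s) fx.
  by apply/negP => /sA; rewrite inU => /asboolP.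
pose t := [seq (O `|` A)%fset | A <- fpowerset (unfixed s) &
  `[< independent (extension s A) /\ P (extension s A) >]].
rewrite -big_filter (perm_big t).
  rewrite big_map big_filter big_distrr /= big_seq_cond [RHS]big_seq_cond.
  apply: eq_bigr => A.
  rewrite fpowersetE => /andP[/disj /eqP dOA _]; rewrite /gibbs mulrAC -exprD.
  have -> : #|` (O `|` A)%fset| = (#|` O| + #|` A|)%N.
    by rewrite cardfsU dOA cardfs0 subn0.
  by [].
apply: uniq_perm.
- by rewrite filter_uniq // fset_uniq.
- rewrite map_inj_in_uniq ?filter_uniq ?fset_uniq // => A B.
  rewrite !mem_filter !fpowersetE => /andP[_ /disj dA] /andP[_ /disj dB] e.
  apply/fsetP => x; have /fsetP/(_ x) := e; rewrite !inE.
  have [xO _|//] := boolP (x \in O).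
  by rewrite (negbTE (fdisjointP dA _ xO)) (negbTE (fdisjointP dB _ xO)).
- move=> J; rewrite mem_filter fpowersetE.
  have -> /= : (J `<=` vertices G)%fset.
    by apply/fsubsetP => x _; rewrite in_fset_set // inE.
  rewrite andbT; apply/asboolP/mapP => [[iJ JS PJ]|[A]].
    exists (J `&` unfixed s)%fset; last first.
      apply/fsetP => x; rewrite !inE inU.
      have : ([set` J] `&` bc_fixed s) x <-> [set` O] x by rewrite JS OE.
      rewrite /= => -[h1 h2]; apply/idP/idP => [xJ|].
        have [fx|nfx] := pselect (bc_fixed s x).
          by rewrite h1.
        by rewrite xJ (asboolT nfx) orbT.
      by case/orP=> [/h2[]//|/andP[]].
    rewrite mem_filter fpowersetE fsubsetIr andbT.
    have e : extension s (J `&` unfixed s)%fset = [set` J].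
      rewrite /extension -JS; apply/seteqP; split => x /=.
        by case=> [[]//|]; rewrite inE => /andP[].
      move=> xJ; have [fx|nfx] := pselect (bc_fixed s x); [by left|right].
      by rewrite inE xJ inU asboolT.
    by apply/asboolP; rewrite e.
  rewrite mem_filter fpowersetE => /andP[/asboolP[iA PA] sA] ->.
  rewrite -extE; split=> //; apply/seteqP; split => x.
    case=> -[//|/= xA] fx.
    by move/fsubsetP: sA => /(_ _ xA); rewrite inU => /asboolP.
  by move=> ox; split; [left|exact: bc_occ_fixed].
Qed.

Lemma occ_prob_finite (R : realType) (lambda : R) (G : graph)
    (s : boundary_condition G) (v : G)
    (lambda_gt0 : 0 < lambda) (finG : finite_graph G) :
  occ_prob lambda s v =
  (\sum_(J <- fpowerset (vertices G) |
        `[< [/\ independent [set` J], [set` J] `&` bc_fixed s = bc_occ s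
              & v \in J] >]) gibbs lambda J)
  / (\sum_(J <- fpowerset (vertices G) |
        `[< independent [set` J] /\ [set` J] `&` bc_fixed s = bc_occ s >])
       gibbs lambda J).
Proof.
have Z0 : partition_function lambda G != 0.
  rewrite gt_eqF // /partition_function big_mkcond (big_fsetD1 fset0); last first.
    by rewrite fpowersetE fsub0set.
  rewrite asboolT; last by move=> x y; rewrite /= inE.
  rewrite cardfs0 expr0 ltr_wpDr ?ltr01 // sumr_ge0 // => J _.
  by case: ifP => // _; rewrite exprn_ge0 // ltW.
have K0 : lambda ^+ #|` fset_set (bc_occ s)| / partition_function lambda G != 0.
  by rewrite mulf_neq0 ?invr_eq0 // expf_neq0 // gt_eqF.
rewrite (gibbs_sum _ _ finG (fun B => B v)).
under [X in _ / X]eq_bigl => J.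
  rewrite (_ : `[< _ >] = `[< [/\ independent [set` J],
     [set` J] `&` bc_fixed s = bc_occ s & (fun=> True) [set` J]] >]); last first.
    by apply: asbool_equiv_eq; split=> [[]|[]].
  over.
rewrite (gibbs_sum _ _ finG (fun=> True)) -mulf_div divff // mul1r /occ_prob.
congr (_ / _); apply: eq_bigl => A; apply: asbool_equiv_eq.
by split=> [|[]].
Qed.

(** ** Strong spatial mixing *)

Definition differ_only_from (G : graph) (v : G) (l : nat)
    (s t : boundary_condition G) : Prop :=
  forall u : G,
    ~ ((bc_fixed s u <-> bc_fixed t u) /\ (bc_occ s u <-> bc_occ t u)) ->
    dist_ge v u l.

(* The rate [c] is common to the whole family. The constant hidden in O(c^l)
   depends on the graph and the vertex: neither notion of connective constant
   controls short walks, and no uniform constant exists in general (all finite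
   trees together form a family of connective constant at most Delta for every
   Delta > 1). On the finite members of the family a common constant is
   required in the range l >= a log |V| that the connective constant controls;
   without it the condition would be void for finite graphs. *)
Definition strong_spatial_mixing (R : realType) (lambda : R)
    (F : graph_family) : Prop :=
  exists2 c : R, 0 <= c < 1 &
    (forall G : graph, F G -> forall v : G, exists K : R,
       forall (l : nat) (s t : boundary_condition G),
         differ_only_from v l s t ->
         `|occ_ratio lambda s v - occ_ratio lambda t v| <= K * c ^+ l)
    /\
    (exists a K : R, forall G : graph, F G -> finite_graph G ->
       forall (v : G) (l : nat) (s t : boundary_condition G),
         a * ln (graph_order G)%:R <= l%:R ->
         differ_only_from v l s t ->
         `|occ_ratio lambda s v - occ_ratio lambda t v| <= K * c ^+ l).

(** ** Computation: random access machines with logarithmic cost *)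

(* Structured programs over a memory of natural numbers indexed by natural
   numbers, with indirect addressing. As the activity and the accuracy are
   arbitrary real numbers, programs access them as oracles returning dyadic
   approximations; the requested precision is charged in unary. *)

Inductive expr :=
| EConst of nat
| EMem of expr
| EAdd of expr & expr
| ESub of expr & expr
| EMul of expr & expr
| EDiv of expr & expr
| ELt of expr & expr
| EActivity of expr
| EAccuracy of expr.

Inductive cmd :=
| CSkip
| CStore of expr & expr
| CSeq of cmd & cmd
| CIf of expr & cmd & cmd
| CWhile of expr & cmd.

Definition memory := nat -> nat.

Definition update (m : memory) (a x : nat) : memory :=
  fun b => if b == a then x else m b.

Definition bitlen (n : nat) : nat := (trunc_log 2 n).+1.

Section Semantics.
Local Open Scope nat_scope.
Variables (act acc : nat -> nat).

Fixpoint eval (m : memory) (e : expr) : nat :=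
  match e with
  | EConst n => n
  | EMem e1 => m (eval m e1)
  | EAdd e1 e2 => eval m e1 + eval m e2
  | ESub e1 e2 => eval m e1 - eval m e2
  | EMul e1 e2 => eval m e1 * eval m e2
  | EDiv e1 e2 => eval m e1 %/ eval m e2
  | ELt e1 e2 => eval m e1 < eval m e2
  | EActivity e1 => act (eval m e1)
  | EAccuracy e1 => acc (eval m e1)
  end.

Fixpoint eval_cost (m : memory) (e : expr) : nat :=
  bitlen (eval m e) +
  match e with
  | EConst _ => 0
  | EMem e1 => eval_cost m e1
  | EAdd e1 e2 | ESub e1 e2 | EMul e1 e2 | EDiv e1 e2 | ELt e1 e2 =>
      eval_cost m e1 + eval_cost m e2
  | EActivity e1 | EAccuracy e1 => eval_cost m e1 + eval m e1
  end.

(* [exec c m m' t]: started in memory [m], the program [c] halts in memory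
   [m'] after time [t]. *)
Inductive exec : cmd -> memory -> memory -> nat -> Prop :=
| ExecSkip m : exec CSkip m m 1
| ExecStore e1 e2 m :
    exec (CStore e1 e2) m (update m (eval m e1) (eval m e2))
      (1 + eval_cost m e1 + eval_cost m e2)
| ExecSeq c1 c2 m m1 m2 t1 t2 :
    exec c1 m m1 t1 -> exec c2 m1 m2 t2 -> exec (CSeq c1 c2) m m2 (t1 + t2)
| ExecIfTrue e c1 c2 m m' t :
    eval m e != 0 -> exec c1 m m' t ->
    exec (CIf e c1 c2) m m' (1 + eval_cost m e + t)
| ExecIfFalse e c1 c2 m m' t :
    eval m e = 0 -> exec c2 m m' t ->
    exec (CIf e c1 c2) m m' (1 + eval_cost m e + t)
| ExecWhileTrue e c m m1 m2 t1 t2 :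
    eval m e != 0 -> exec c m m1 t1 -> exec (CWhile e c) m1 m2 t2 ->
    exec (CWhile e c) m m2 (1 + eval_cost m e + t1 + t2)
| ExecWhileFalse e c m :
    eval m e = 0 -> exec (CWhile e c) m m (1 + eval_cost m e).

Lemma exec_deterministic c m m1 t1 m2 t2 :
  exec c m m1 t1 -> exec c m m2 t2 -> m1 = m2 /\ t1 = t2.
Proof.
move=> h; elim: h m2 t2 => {c m m1 t1}.
- by move=> m m2 t2 h; inversion h.
- by move=> e1 e2 m m2 t2 h; inversion h.
- move=> c1 c2 m m1 m2 t1 t2 _ IH1 _ IH2 m' t' h; inversion h; subst.
  have [e1 e2] := IH1 _ _ ltac:(eassumption); subst.
  by have [-> ->] := IH2 _ _ ltac:(eassumption).
- move=> e c1 c2 m m' t ne _ IH m2 t2 h; inversion h; subst.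
    by have [-> ->] := IH _ _ ltac:(eassumption).
  by exfalso; apply/negP: ne; rewrite negbK; apply/eqP.
- move=> e c1 c2 m m' t ne _ IH m2 t2 h; inversion h; subst.
    by exfalso; move/eqP: ne; apply/negP.
  by have [-> ->] := IH _ _ ltac:(eassumption).
- move=> e c m m1 m2 t1 t2 ne _ IH1 _ IH2 m' t' h; inversion h; subst.
    have [e1 e2] := IH1 _ _ ltac:(eassumption); subst.
    by have [-> ->] := IH2 _ _ ltac:(eassumption).
  by exfalso; apply/negP: ne; rewrite negbK; apply/eqP.
- move=> e c m ne m2 t2 h; inversion h; subst => //.
  by exfalso; move/eqP: ne; apply/negP.
Qed.

End Semantics.

Definition approximates (R : realType) (x : R) (phi : nat -> nat) : Prop :=
  forall k : nat, `|(phi k)%:R - x * 2 ^+ k| <= 1.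

(* Cell 0 holds the number of vertices; the adjacency matrix follows, row by
   row; the other cells hold 0. *)
Definition graph_input (n : nat) (e : rel 'I_n) : memory :=
  nth 0%N (n :: [seq nat_of_bool (e i j) | i <- enum 'I_n, j <- enum 'I_n]).

(* The output is the rational number whose numerator and denominator are in
   cells 0 and 1. The bijection [f] is an arbitrary labelling of the vertices
   by 0, .., n - 1, through which the program is given the graph. *)
Definition has_fptas (R : realType) (lambda : R) (F : graph_family) : Prop :=
  exists (P : cmd) (C d : nat),
    forall G : graph, F G ->
    forall (n : nat) (f : 'I_n -> G), bijective f ->
    forall eps : R, 0 < eps <= 1 ->
    forall act acc : nat -> nat,
      approximates lambda act -> approximates eps acc ->
    exists (m : memory) (t : nat),
      [/\ exec act acc P (graph_input (fun i j => adj (f i) (f j))) m t,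
          t%:R <= C%:R * (n%:R + eps^-1) ^+ d,
          (0 < m 1)%N
        & (1 - eps) * partition_function lambda G <= (m 0%N)%:R / (m 1%N)%:R
            <= (1 + eps) * partition_function lambda G].

(* Main.v *)
Require Import Defs.
From mathcomp Require Import all_boot all_order all_algebra finmap.
From mathcomp Require Import all_classical all_reals all_analysis.
From mathcomp Require Import ring lra zify.

Set Implicit Arguments.
Unset Strict Implicit.
Unset Printing Implicit Defensive.

Import Order.TTheory GRing.Theory Num.Theory.
Import numFieldNormedType.Exports.

Local Open Scope classical_set_scope.
Local Open Scope ring_scope.

(* The occupation ratio R_v(S) of the hard core model on the free vertices S
   satisfies R_v(S) = lambda * prod_i 1 / (1 + R_{v_i}(S - v - v_1 - .. - v_{i-1}))
   over the neighbours v_i of v in S, and the tree of this recursion embeds in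
   the tree of self-avoiding walks from v. In the coordinate
   phi(x) = arcsinh (sqrt x), one step of the recursion contracts the sum of the
   q-th powers of the errors by a factor alpha with alpha * Delta < 1: by the
   mean value theorem and Hoelder's inequality this reduces to bounding
   (lambda / (e^U + lambda))^(p/2) * sum_i (1 - e^(- u_i))^(p/2), U = sum_i u_i,
   u_i = ln (1 + x_i), and for the right p the function (1 - e^(- u))^(p/2) / u
   and the factor depending on U are both maximal at the fixed point
   x = 1 / (Delta - 1) of the critical Delta-ary recursion. Truncating the
   recursion at depth l therefore costs O((alpha * Delta)^(l/q)), which gives
   strong spatial mixing. For the approximation scheme l is logarithmic in
   n / eps, so that the truncated tree has polynomial size; it is evaluated
   depth first in exact rational arithmetic at a rational activity near lambda,
   and Z is the telescoping product of the 1 + R_v. *)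

(** * The contraction *)

(** Degrees are unbounded, so a step of the recursion must be controlled uniformly in the number of
    children, and errors are summed over walks instead of being maximised and multiplied by a
    degree. The coordinate arcsinh (sqrt x) makes the gradient of a step split into a parent factor
    sqrt (lambda / (e^U + lambda)) and a sum of child factors tanh = sqrt (1 - e^(-u_i)). The
    exponent is p = 2 r with r = 1 / ((Delta - 1) ln (Delta / (Delta - 1))), for which both
    one-variable functions peak at the critical fixed point. The product of the maxima is Delta^(1 -
    p), so alpha * Delta would be exactly 1 at lambda_c: all contraction comes from the strict gain
    lambda < lambda_c. The constants are uniform over activities up to some lam' in (lambda,
    lambda_c), because the algorithm works with a rounded activity that may exceed lambda. Unreduced
    fractions could grow fast during the evaluation; the product of numerator + denominator over the
    stack serves as a potential that keeps bit lengths linear in the number of steps. *)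

Section Analysis.
Variable R : realType.
Implicit Types (x y u : R).

Lemma is_derive_continuous (f : R -> R) x d :
  is_derive x 1 f d -> {for x, continuous f}.
Proof.
by move=> [df _]; apply: differentiable_continuous; apply/derivable1_diffP.
Qed.

Lemma is_derive_fB (f g : R -> R) x df dg :
  is_derive x 1 f df -> is_derive x 1 g dg ->
  is_derive x 1 (fun z => f z - g z) (df - dg).
Proof. by move=> ? ?; exact: is_deriveB. Qed.

Lemma is_derive_fD (f g : R -> R) x df dg :
  is_derive x 1 f df -> is_derive x 1 g dg ->
  is_derive x 1 (fun z => f z + g z) (df + dg).
Proof. by move=> ? ?; exact: is_deriveD. Qed.

Lemma is_derive_fZ (f : R -> R) k x df :
  is_derive x 1 f df -> is_derive x 1 (fun z => k * f z) (k * df).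
Proof. by move=> ?; exact: is_deriveZ. Qed.

Lemma is_derive_fcst (k : R) x : is_derive x 1 (fun=> k) 0.
Proof. exact: is_derive_cst. Qed.

Lemma is_derive_fcomp (f g : R -> R) x df dg :
  is_derive (g x) 1 f df -> is_derive x 1 g dg ->
  is_derive x 1 (fun z => f (g z)) (df * dg).
Proof. by move=> ? ?; exact: is_derive1_comp. Qed.

Lemma mvt_le (f df : R -> R) a b : a <= b ->
  (forall x, a <= x <= b -> is_derive x 1 f (df x)) ->
  exists2 c, a <= c <= b & f b - f a = df c * (b - a).
Proof.
move=> ab dfP.
have [] := @MVT_segment R f df a b ab.
- by move=> x /[!in_itv]/= /andP[? ?]; apply: dfP; rewrite !ltW.
- apply: continuous_in_subspaceT => x; rewrite inE/= in_itv/= => xab.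
  exact: is_derive_continuous (dfP _ xab).
- by move=> c /[!in_itv]/= cab e; exists c.
Qed.

Lemma mvt_ge0 (g dg : R -> R) (a b : R) : 0 < a -> 0 < b ->
  (forall x, 0 < x -> is_derive x 1 g (dg x)) ->
  (forall x, a <= x -> 0 <= dg x) ->
  (forall x, 0 < x -> x <= a -> dg x <= 0) ->
  g a <= g b.
Proof.
move=> a0 b0 dgP pos neg; have [ab|/ltW ba] := leP a b.
- have [|c /andP[ac _] e] := @mvt_le g dg a b ab.
    by move=> x /andP[ax _]; apply: dgP; apply: lt_le_trans ax.
  by rewrite -subr_ge0 e mulr_ge0 ?subr_ge0 ?pos.
- have [|c /andP[bc ca] e] := @mvt_le g dg b a ba.
    by move=> x /andP[ax _]; apply: dgP; apply: lt_le_trans ax.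
  by rewrite -subr_le0 e mulr_le0_ge0 ?subr_ge0 ?neg // (lt_le_trans b0).
Qed.

(* [(e^u - 1)/u] is nondecreasing, with the divisions cleared. *)
Lemma expR_slope_mono u v : 0 < u -> u <= v ->
  (expR u - 1) * v <= (expR v - 1) * u.
Proof.
move=> u0 uv; have v0 : 0 < v by apply: lt_le_trans uv.
have h1 : expR u * (1 + (v - u)) <= expR v.
  have -> : v = u + (v - u) by ring.
  rewrite [in leRHS]expRD addrAC subrr add0r ler_pM2l ?expR_gt0//.
  exact: expR_ge1Dx.
have h2 := expR_ge1Dx (- u).
have h3 : expR (- u) * expR u = 1 by rewrite expRN mulVf// gt_eqF ?expR_gt0.
have h4 := expR_gt0 u.
have h5 : expR u * (1 - u) <= 1 by nra.
nra.
Qed.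

(** As a function of ln u, ln (1 - e^(-u)) has slope u / (e^u - 1), which decreases; it is concave
    and lies below its tangent at u0. The prefactor is the reciprocal of that slope. *)
Lemma ln_1mexpR_tangent u0 u : 0 < u0 -> 0 < u ->
  (expR u0 - 1) / u0 * (ln (1 - expR (- u)) - ln (1 - expR (- u0))) <=
  ln u - ln u0.
Proof.
move=> u00 uu0; set r := _ / _.
pose g x := ln x - r * ln (1 - expR (- x)).
pose dg x := x^-1 - r * (expR x - 1)^-1.
have e1 x : 0 < x -> 0 < expR x - 1 by move=> x0; rewrite subr_gt0 expR_gt1.
have e2 x : 0 < x -> 0 < 1 - expR (- x).
  by move=> x0; rewrite subr_gt0 expR_lt1 oppr_lt0.
suff : g u0 <= g u by rewrite /g; lra.
apply: (@mvt_ge0 g dg) => // x.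
- move=> x0; have h := e2 _ x0; have h' := e1 _ x0.
  rewrite /g /dg.
  apply: is_derive_fB; first exact: is_derive1_ln.
  apply: is_derive_fZ; apply: is_derive_eq.
    apply: is_derive_fcomp; first exact: is_derive1_ln.
  rewrite expRN; field.
  by rewrite !gt_eqF ?expR_gt0.
- move=> ux; have x0 := lt_le_trans u00 ux.
  rewrite /dg /r subr_ge0 ler_pdivrMr ?e1// [leRHS]mulrC.
  by rewrite ler_pdivlMr// mulrAC ler_pdivrMr//; exact: expR_slope_mono.
- move=> x0 xu; rewrite /dg /r subr_le0.
  rewrite ler_pdivlMr ?e1// mulrC ler_pdivrMr// mulrAC ler_pdivlMr//.
  exact: expR_slope_mono.
Qed.


Lemma ln_le_subr1 x : 0 < x -> ln x <= x - 1.
Proof.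
by move=> x0; have := @le_ln1Dx R (x - 1); rewrite subrKC; apply; lra.
Qed.

(** Convexity of U -> ln (e^U + L), in the form of the weighted inequality e^(w y) <= w e^y + 1 - w
    with y = U - U0. *)
Lemma ln_expRD_tangent (U0 U L : R) : 0 < L ->
  expR U0 / (expR U0 + L) * (U - U0) <= ln (expR U + L) - ln (expR U0 + L).
Proof.
move=> L0; set w := _ / _.
have a0 : 0 < expR U0 + L by rewrite addr_gt0 ?expR_gt0.
have b0 : 0 < expR U + L by rewrite addr_gt0 ?expR_gt0.
have e1 : expR U + L =
    (expR U0 + L) * (w * expR (U - U0) + (1 - w)).
  rewrite /w expRB; field; rewrite !gt_eqF ?expR_gt0//.
have w0 : 0 < w by rewrite divr_gt0 ?expR_gt0.
have w1 : w < 1 by rewrite ltr_pdivrMr// mul1r ltrDl.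
have c0 : 0 < w * expR (U - U0) + (1 - w).
  have := mulr_gt0 w0 (expR_gt0 (U - U0)); lra.
rewrite e1 lnM ?posrE// [in leRHS]addrAC subrr add0r.
rewrite -ler_expR lnK ?posrE//.
set y := U - U0.
have h1 : 1 + (1 - w) * y <= expR ((1 - w) * y) by exact: expR_ge1Dx.
have h2 : 1 - w * y <= expR (- (w * y)) by have := expR_ge1Dx (- (w * y)).
have e2 : expR y = expR (w * y) * expR ((1 - w) * y).
  by rewrite -expRD; congr expR; ring.
have e3 : expR (w * y) * expR (- (w * y)) = 1.
  by rewrite expRN divff// gt_eqF ?expR_gt0.
have h3 := expR_gt0 (w * y).
(* The linear terms of [h1] and [h2], taken with weights w and 1 - w, cancel. *)
have : 1 <= w * expR ((1 - w) * y) + (1 - w) * expR (- (w * y)) by nra.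
move=> /(ler_wpM2l (ltW h3)); rewrite mulr1 [in leRHS]mulrDr.
by rewrite [X in _ <= X + _]mulrCA -e2 [X in _ <= _ + X]mulrCA e3 mulr1.
Qed.

(** After replacing lam by lam', the quotient of the two sides depends on e through (e + L) / (e +
    lam'), which decreases in e since lam' < L; the constant is its value at the worst case e =
    1. *)
Lemma activity_ratio_scale (lam lam' L e : R) :
  0 < lam <= lam' -> lam' < L -> 1 <= e ->
  lam / (e + lam) <= lam' / L * ((1 + L) / (1 + lam')) * (L / (e + L)).
Proof.
move=> /andP[m0 ml] lL e1.
have l0 : 0 < lam' by lra.
have L0 : 0 < L by lra.
have a1 : 0 < e + lam by lra.
have a2 : 0 < e + lam' by lra.
have a3 : 0 < e + L by lra.
have a4 : 0 < 1 + lam' by lra.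
apply: (@le_trans _ _ (lam' / (e + lam'))).
  rewrite ler_pdivrMr// mulrAC ler_pdivlMr//; nra.
have -> : lam' / L * ((1 + L) / (1 + lam')) * (L / (e + L)) =
    lam' * (1 + L) / ((1 + lam') * (e + L)).
  by field; rewrite !gt_eqF.
rewrite ler_pdivrMr// mulrAC ler_pdivlMr ?mulr_gt0//.
by rewrite -!mulrA ler_pM2l//; nra.
Qed.

(** * Extremal inequalities at the critical activity *)

Section Critical.
Variable D : R.
Hypothesis D1 : 1 < D.
Let u0 := ln (D / (D - 1)).
(** Half of the exponent p. It equals (e^u0 - 1) / u0, the value that makes (1 - e^(-u))^r / u
    stationary at u0 = ln (1 + 1 / (D - 1)). *)
Let r := ((D - 1) * u0)^-1.
Let L := lambda_c D.

Let DB : 0 < D - 1. Proof. by rewrite subr_gt0. Qed.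
Let D0 : 0 < D. Proof. by rewrite (lt_trans _ D1). Qed.
Let DD : 0 < D / (D - 1). Proof. exact: divr_gt0. Qed.
Let u0_gt0 : 0 < u0.
Proof. by rewrite ln_gt0// ltr_pdivlMr// mul1r ltrBlDr ltrDl. Qed.
Let r_gt0 : 0 < r. Proof. by rewrite invr_gt0 mulr_gt0. Qed.
Let expu0 : expR u0 = D / (D - 1). Proof. by rewrite lnK. Qed.
Let r_ge1 : 1 <= r.
Proof.
rewrite invf_ge1 ?mulr_gt0//.
have : u0 <= D / (D - 1) - 1 by exact: ln_le_subr1.
move=> h; apply: (@le_trans _ _ ((D - 1) * (D / (D - 1) - 1))).
  by rewrite ler_pM2l.
by rewrite mulrBr mulrCA divff ?gt_eqF// mulr1 mulr1 opprB addrC subrK.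
Qed.
Let L_gt0 : 0 < L. Proof. by rewrite divr_gt0 ?powR_gt0. Qed.
Let r_slope : (expR u0 - 1) / u0 = r.
Proof. rewrite expu0 /r; field; rewrite !gt_eqF//. Qed.
Let expNu0 : 1 - expR (- u0) = D^-1.
Proof. rewrite expRN expu0; field; rewrite !gt_eqF//. Qed.

(** The tangent inequality says that (1 - e^(-u))^r / u is largest at u0, where 1 - e^(-u0) = 1 /
    D. *)
Lemma critical_vertex_bound u : 0 <= u ->
  (1 - expR (- u)) `^ r <= u * (D `^ (- r) / u0).
Proof.
rewrite le_eqVlt => /predU1P[<-|u_gt0].
  by rewrite oppr0 expR0 subrr powR0 ?gt_eqF// mul0r.
have e2 : 0 < 1 - expR (- u) by rewrite subr_gt0 expR_lt1 oppr_lt0.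
have := ln_1mexpR_tangent u0_gt0 u_gt0; rewrite r_slope expNu0 lnV ?posrE//.
move=> h; rewrite -ler_ln ?posrE ?powR_gt0 ?mulr_gt0 ?invr_gt0 ?powR_gt0//.
rewrite !lnM ?posrE ?powR_gt0 ?mulr_gt0 ?invr_gt0 ?powR_gt0//.
rewrite lnV ?posrE// !ln_powR; lra.
Qed.

Let U0 := D * u0.
(** The fixed point equation x = L / (1 + x)^D at x = 1 / (D - 1). Apart from positivity, the
    formula for [lambda_c] is used only here. *)
Let L_U0 : expR U0 = (D - 1) * L.
Proof.
rewrite /U0 mulrC expRM expu0 /L /lambda_c powRD; last by rewrite (gt_eqF DB) implybT.
rewrite powRr1 ?ltW// powRM ?invr_ge0 ?ltW//.
rewrite -powR_inv1 ?ltW// -powRrM mulN1r powRN.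
by field; rewrite !gt_eqF ?powR_gt0.
Qed.

(** In ln U - r ln (e^U + L), the first term is concave and the second convex; both are replaced by
    their tangents at U0, whose linear parts cancel. *)
Lemma critical_parent_bound U : 0 <= U ->
  (L / (expR U + L)) `^ r * U <= D `^ (- r) * (D * u0).
Proof.
rewrite le_eqVlt => /predU1P[<-|U_gt0].
  by rewrite mulr0 !mulr_ge0 ?powR_ge0 ?ltW.
have U00 : 0 < U0 by rewrite mulr_gt0.
have a0 V : 0 < expR V + L by rewrite addr_gt0 ?expR_gt0.
have := ln_expRD_tangent U0 U L_gt0.
have -> : expR U0 + L = D * L by rewrite L_U0; ring.
have -> : expR U0 / (D * L) = (D - 1) / D.
  by rewrite L_U0; field; rewrite !gt_eqF.
have h2 : ln U <= ln U0 + (U / U0 - 1).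
  have e : U = U0 * (U / U0) by rewrite mulrCA divff ?mulr1// gt_eqF.
  by rewrite [in leLHS]e lnM ?posrE ?divr_gt0// lerD2l ln_le_subr1 ?divr_gt0.
(* The two slopes agree: 1 / U0 = r (D - 1) / D by the choice of r. *)
have h3 : U / U0 - 1 = r * ((D - 1) / D * (U - U0)).
  by rewrite /U0 /r; field; rewrite !gt_eqF.
rewrite h3 in h2; set X := _ / D * _ in h2 *.
rewrite lnM ?posrE// => h4.
have q0 := divr_gt0 L_gt0 (a0 U).
rewrite -ler_ln ?posrE ?mulr_gt0 ?(powR_gt0 _ q0) ?(powR_gt0 _ D0)//.
rewrite !lnM ?posrE ?mulr_gt0 ?(powR_gt0 _ q0) ?(powR_gt0 _ D0)//.
rewrite !ln_powR ln_div ?posrE//.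
have e5 : ln U0 = ln D + ln u0 by rewrite /U0 lnM ?posrE.
rewrite -e5.
have : r * X <= r * (ln (expR U + L) - (ln D + ln L)) by rewrite ler_pM2l.
lra.
Qed.

(** The bound for a child is linear in u, so the sum over the children depends only on U and their
    number disappears. *)
Lemma critical_weight_bound (us : seq R) : all (>= 0) us ->
  (L / (expR (\sum_(u <- us) u) + L)) `^ r *
    \sum_(u <- us) (1 - expR (- u)) `^ r <= D `^ (1 - r * 2).
Proof.
move=> us0; set U := \sum_(u <- us) u.
have U0' : 0 <= U by rewrite /U big_seq sumr_ge0// => u /(allP us0).
have h1 : \sum_(u <- us) (1 - expR (- u)) `^ r <= U * (D `^ (- r) / u0).
  rewrite /U mulr_suml big_seq [leRHS]big_seq; apply: ler_sum => u /(allP us0).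
  exact: critical_vertex_bound.
apply: (@le_trans _ _ ((L / (expR U + L)) `^ r * (U * (D `^ (- r) / u0)))).
  by rewrite ler_wpM2l ?powR_ge0.
rewrite mulrA.
apply: (@le_trans _ _ (D `^ (- r) * (D * u0) * (D `^ (- r) / u0))).
  rewrite ler_wpM2r ?critical_parent_bound// divr_ge0 ?powR_ge0// ltW//.
have -> : 1 - r * 2 = 1 + (- r + - r) by ring.
rewrite !powRD ?(gt_eqF D0) ?implybT// powRr1 ?(ltW D0)//.
by rewrite le_eqVlt; apply/orP; left; apply/eqP; field; rewrite gt_eqF.
Qed.

(** With the critical bound D^(1 - p) as beta, beta^(1/(p - 1)) D would equal 1. The factor kappa <
    1 from [activity_ratio_scale] makes it strictly smaller, uniformly in lam <= lam'. *)
Lemma subcritical_weight_bound (lam' : R) : 0 < lam' < L ->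
  exists p beta : R, [/\ 2 <= p, 0 < beta, beta `^ (p - 1)^-1 * D < 1 &
    forall (lam : R) (us : seq R), 0 < lam <= lam' -> all (>= 0) us ->
    (lam / (expR (\sum_(u <- us) u) + lam)) `^ (p / 2) *
    \sum_(u <- us) (1 - expR (- u)) `^ (p / 2) <= beta].
Proof.
move=> /andP[l0 lL]; pose kappa := lam' / L * ((1 + L) / (1 + lam')).
have k0 : 0 < kappa by rewrite !mulr_gt0 ?invr_gt0//; lra.
have k1 : kappa < 1.
  rewrite /kappa mulrACA -invfM ltr_pdivrMr; last by rewrite mulr_gt0//; lra.
  rewrite mul1r; lra.
have p1 : 0 < r * 2 - 1 by have := r_ge1; lra.
exists (r * 2), (kappa `^ r * D `^ (1 - r * 2)); split.
- by have := r_ge1; lra.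
- by rewrite mulr_gt0 ?powR_gt0.
- rewrite powRM ?powR_ge0// -!powRrM.
  have -> : (1 - r * 2) / (r * 2 - 1) = -1 by field; rewrite gt_eqF.
  rewrite powR_inv1 ?(ltW D0)// divfK ?gt_eqF//.
  rewrite -[ltRHS](powRr0 kappa) /powR gt_eqF// ltr_expR mul0r.
  by rewrite pmulr_rlt0 ?divr_gt0// ln_lt0 ?k0.
- move=> lam us /andP[m0 ml] us0; rewrite mulfK ?pnatr_eq0//.
  set U := \sum_(u <- us) u.
  have U0' : 0 <= U by rewrite /U big_seq sumr_ge0// => u /(allP us0).
  have eU : 1 <= expR U by rewrite -expR0 ler_expR.
  have q0 : 0 < L / (expR U + L) by rewrite (divr_gt0 L_gt0)// addr_gt0 ?expR_gt0.
  have h : lam / (expR U + lam) <= kappa * (L / (expR U + L)).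
    by apply: activity_ratio_scale; rewrite ?m0 ?lL.
  apply: (@le_trans _ _ ((kappa * (L / (expR U + L))) `^ r *
     \sum_(u <- us) (1 - expR (- u)) `^ r)).
    apply: ler_wpM2r; first by rewrite sumr_ge0// => *; rewrite powR_ge0.
    apply: ge0_ler_powR; rewrite ?nnegrE ?(ltW r_gt0)//.
      by rewrite divr_ge0 ?addr_ge0 ?expR_ge0 ?ltW.
    by rewrite mulr_ge0 ?(ltW k0) ?(ltW q0).
  rewrite powRM ?(ltW k0)//; last exact: ltW q0.
  by rewrite -mulrA ler_wpM2l ?powR_ge0// critical_weight_bound.
Qed.
End Critical.

Lemma sumr_hoelder (I : Type) (s : seq I) (a b : I -> R) (p q beta : R) :
  (forall i, 0 <= a i) -> (forall i, 0 <= b i) ->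
  0 < p -> 0 < q -> p^-1 + q^-1 = 1 -> 0 < beta ->
  \sum_(i <- s) a i `^ p <= beta ->
  (\sum_(i <- s) a i * b i) `^ q <= beta `^ (q / p) * \sum_(i <- s) b i `^ q.
Proof.
move=> a0 b0 p0 q0 pq be0 ab.
have : 0 <= \sum_(i <- s) b i `^ q by rewrite sumr_ge0// => i _; exact: powR_ge0.
rewrite le_eqVlt => /predU1P[/esym D0|].
  suff -> : \sum_(i <- s) a i * b i = 0 by rewrite D0 mulr0 powR0// gt_eqF.
  elim: s D0 {ab} => [|i s IH]; rewrite ?big_nil// !big_cons => /eqP.
  rewrite paddr_eq0 ?powR_ge0//; last first.
    by rewrite sumr_ge0// => j _; exact: powR_ge0.
  move=> /andP[/eqP/powR_eq0_eq0 -> /eqP/IH ->].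
  by rewrite mulr0 addr0.
set D := \sum_(i <- s) b i `^ q => D0.
have [y y0 De] : exists2 y : R, 0 < y & D = beta * y.
  by exists (D / beta); rewrite ?divr_gt0// mulrCA divff ?mulr1// gt_eqF.
(* This rescaling balances Young's inequality: the two sums contribute at most beta y^(1/q) with
   weights 1/p and 1/q. *)
pose c := y `^ ((p * q)^-1).
have c0 : 0 < c by exact: powR_gt0.
have h i : a i * b i <=
    a i `^ p * (y `^ q^-1 / p) + b i `^ q * (y `^ (- p^-1) / q).
  have -> : a i * b i = (c * a i) * (c^-1 * b i).
    by rewrite mulrACA divff ?mul1r// gt_eqF.
  apply: le_trans (conjugate_powR _ _ p0 q0 pq) _.
  - by rewrite mulr_ge0 ?a0 ?ltW.
  - by rewrite mulr_ge0 ?b0 ?invr_ge0 ?ltW.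
  rewrite !powRM ?a0 ?b0 ?invr_ge0 ?(ltW c0)//.
  rewrite -powR_inv1 ?(ltW c0)// /c -!powRrM.
  have -> : (p * q)^-1 * p = q^-1 by field; rewrite !gt_eqF.
  have -> : (p * q)^-1 * (-1 * q) = - p^-1 by field; rewrite !gt_eqF.
  by rewrite [y `^ _ * _]mulrC [y `^ (- _) * _]mulrC !mulrA.
have h2 : \sum_(i <- s) a i * b i <= beta * y `^ q^-1.
  apply: (@le_trans _ _ (beta * (y `^ q^-1 / p) + D * (y `^ (- p^-1) / q))).
    apply: le_trans (ler_sum _ (fun i _ => h i)) _.
    rewrite big_split/= -!mulr_suml lerD2r ler_wpM2r//.
    by rewrite divr_ge0 ?powR_ge0 ?ltW.
  rewrite De.
  have e : y * y `^ (- p^-1) = y `^ q^-1.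
    rewrite -[X in X * _]powRr1 ?(ltW y0)// -powRD ?(gt_eqF y0) ?implybT//.
    by congr (_ `^ _); rewrite -pq; ring.
  have -> : beta * (y `^ q^-1 / p) + beta * y * (y `^ (- p^-1) / q) =
     beta * (y `^ q^-1 * p^-1 + y * y `^ (- p^-1) * q^-1) by ring.
  by rewrite e -mulrDr pq mulr1.
apply: (@le_trans _ _ ((beta * y `^ q^-1) `^ q)).
  apply: ge0_ler_powR; rewrite ?nnegrE ?(ltW q0)//.
    by rewrite sumr_ge0// => i _; rewrite mulr_ge0.
  by rewrite mulr_ge0 ?powR_ge0 ?ltW.
rewrite powRM ?powR_ge0 ?(ltW be0)// -powRrM mulVf ?gt_eqF// powRr1 ?(ltW y0)//.
have -> : q / p = q - 1.
  have -> : p^-1 = 1 - q^-1 by rewrite -pq; ring.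
  by rewrite mulrBr mulr1 divff ?gt_eqF.
rewrite powRB ?(gt_eqF be0) ?implybT// powRr1 ?(ltW be0)//.
by rewrite De mulrA divfK// gt_eqF.
Qed.

(** * The message coordinate and the contraction of one step *)

Definition message (x : R) := ln (Num.sqrt (1 + x) + Num.sqrt x).
(** 2 ln (cosh m), which is ln (1 + x) at m = arcsinh (sqrt x). *)
Definition message_log (m : R) := 2 * ln ((expR m + expR (- m)) / 2).

Lemma sqrt_sum_gt0 x : 0 <= x -> 0 < Num.sqrt (1 + x) + Num.sqrt x.
Proof. by move=> x0; rewrite ltr_wpDr ?sqrtr_ge0// sqrtr_gt0 ltr_wpDr. Qed.

Lemma message_homo x y : 0 <= x -> x <= y -> message x <= message y.
Proof.
move=> x0 xy; have y0 : 0 <= y by apply: le_trans xy.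
rewrite ler_ln ?posrE ?sqrt_sum_gt0// lerD// ler_sqrt//.
  by rewrite lerD2l.
by rewrite addr_ge0.
Qed.

Lemma message_ge0 x : 0 <= x -> 0 <= message x.
Proof.
move=> x0; apply: le_trans (message_homo (lexx 0) x0).
by rewrite /message addr0 sqrtr1 sqrtr0 addr0 ln1.
Qed.

Lemma message_logK x : 0 <= x -> expR (message_log (message x)) = 1 + x.
Proof.
move=> x0; rewrite /message_log /message; set t := Num.sqrt (1 + x) + _.
have t0 : 0 < t by exact: sqrt_sum_gt0.
have x1 : 0 < 1 + x by rewrite ltr_wpDr.
have e : expR (- ln t) = Num.sqrt (1 + x) - Num.sqrt x.
  rewrite expRN lnK ?posrE//; apply: (@mulfI _ t); rewrite ?gt_eqF//.
  rewrite divff ?gt_eqF// /t mulrC -subr_sqr !sqr_sqrtr ?(ltW x1)//; lra.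
rewrite e lnK ?posrE// /t.
have -> : (Num.sqrt (1 + x) + Num.sqrt x + (Num.sqrt (1 + x) - Num.sqrt x)) / 2
   = Num.sqrt (1 + x) by field.
rewrite mulrC expRM lnK ?posrE ?sqrtr_gt0// -[2]/(2%:R) powR_mulrn ?sqrtr_ge0//.
by rewrite sqr_sqrtr// ltW.
Qed.

(** tanh m, half of the derivative of [message_log]. *)
Definition message_slope (m : R) := (expR m - expR (- m)) / (expR m + expR (- m)).

Let cosh_gt0 (m : R) : 0 < expR m + expR (- m).
Proof. by rewrite addr_gt0 ?expR_gt0. Qed.

Lemma message_log_ge0 m : 0 <= message_log m.
Proof.
rewrite mulr_ge0// ln_ge0// ler_pdivlMr// mul1r.
have := expR_gt0 m; have e : expR m * expR (- m) = 1.
  by rewrite expRN divff// gt_eqF ?expR_gt0.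
have := expR_gt0 (- m); move: e; move: (expR m) (expR (- m)) => a b ab b0 a0.
have := sqr_ge0 (a - b); rewrite expr2 => h.
by rewrite -(@ler_pXn2r _ 2) ?nnegrE ?addr_ge0 ?(ltW a0) ?(ltW b0)// !expr2; nra.
Qed.

(** tanh^2 = 1 - 1 / cosh^2. This turns the factor of a child into (1 - e^(-u))^(1/2), the function
    estimated in the critical bounds. *)
Lemma message_slope_sqr m :
  message_slope m ^+ 2 = 1 - expR (- message_log m).
Proof.
have c0 : 0 < (expR m + expR (- m)) / 2 by rewrite divr_gt0.
rewrite expRN /message_log mulrC expRM lnK ?posrE//.
rewrite -[in X in _ `^ X]/(2%:R) powR_mulrn ?(ltW c0)//.
have e : expR m * expR (- m) = 1.
  by rewrite expRN divff// gt_eqF ?expR_gt0.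
rewrite /message_slope; have := cosh_gt0 m.
move: e; move: (expR m) (expR (- m)) => a b ab s0.
rewrite !expr_div_n; apply: (@mulIf _ ((a + b) ^+ 2)).
  by rewrite expf_neq0// gt_eqF.
rewrite divfK ?expf_neq0 ?gt_eqF// mulrBl mul1r invfM invrK mulrAC mulVf ?mul1r.
  have -> : (2 : R) ^+ 2 = 4 * (a * b) by rewrite ab; ring.
  by ring.
by rewrite expf_neq0// gt_eqF.
Qed.

Lemma is_derive_message_log (m : R) :
  is_derive m 1 message_log (2 * message_slope m).
Proof.
have c0 : 0 < (expR m + expR (- m)) / 2 by rewrite divr_gt0.
apply: is_derive_fZ.
have d1 : is_derive m 1 (fun m => (expR m + expR (- m)) / 2)
    ((expR m - expR (- m)) / 2).
  have d2 : is_derive m 1 (fun z : R => expR (- z)) (expR (- m) * -1).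
    exact: is_derive_fcomp.
  have d3 := @is_derive_fZ _ 2^-1 _ _ (is_derive_fD (is_derive_expR m) d2).
  rewrite mulrC -[- expR _](mulrN1).
  rewrite (_ : (fun m : R => _) = fun z => 2^-1 * (expR z + expR (- z)))//.
  by apply/funext => z; rewrite mulrC.
apply: is_derive_eq (@is_derive_fcomp (@ln R) (fun m => (expR m + expR (- m)) / 2)
  _ _ _ (is_derive1_ln c0) d1) _.
by rewrite /message_slope; field; rewrite gt_eqF.
Qed.

(** The derivative of arcsinh (sqrt x) is 1 / (2 sqrt (x (1 + x))) and that of x = lam e^(-U) is -x,
    so the product depends on x / (1 + x) alone. *)
Lemma is_derive_message_expR (lam U : R) : 0 < lam ->
  is_derive U 1 (fun V => message (lam * expR (- V)))
    (- (Num.sqrt (lam / (expR U + lam)) / 2)).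
Proof.
move=> l0; set F := lam * expR (- U).
have F0 : 0 < F by rewrite mulr_gt0 ?expR_gt0.
have F1 : 0 < 1 + F by rewrite addr_gt0.
have d2 : is_derive U 1 (fun z : R => lam * expR (- z)) (lam * (expR (- U) * -1)).
  by apply: is_derive_fZ; exact: is_derive_fcomp.
have d3 : is_derive F 1 (fun x => 1 + x) (0 + 1).
  by apply: is_derive_fD; exact: is_derive_fcst.
have d4 : is_derive F 1 (fun x => Num.sqrt (1 + x) + Num.sqrt x)
    ((2 * Num.sqrt (1 + F))^-1 * (0 + 1) + (2 * Num.sqrt F)^-1).
  apply: is_derive_fD; last exact: is_derive1_sqrt.
  exact: (is_derive_fcomp (is_derive1_sqrt F1) d3).
have d5 := @is_derive_fcomp (@ln R) (fun x => Num.sqrt (1 + x) + Num.sqrt x)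
  _ _ _ (is_derive1_ln (sqrt_sum_gt0 (ltW F0))) d4.
apply: is_derive_eq (@is_derive_fcomp message (fun z => lam * expR (- z)) _ _ _ d5 d2) _.
have -> : lam / (expR U + lam) = F / (1 + F).
  rewrite /F expRN; field; rewrite !gt_eqF ?addr_gt0 ?expR_gt0//.
have -> : lam * (expR (- U) * -1) = - (Num.sqrt F ^+ 2).
  by rewrite sqr_sqrtr ?(ltW F0)// mulrN1 mulrN.
have -> : Num.sqrt (F / (1 + F)) = Num.sqrt F / Num.sqrt (1 + F).
  by rewrite sqrtrM ?(ltW F0)// sqrtrV ?(ltW F1).
have a0 : 0 < Num.sqrt F by rewrite sqrtr_gt0.
have b0 : 0 < Num.sqrt (1 + F) by rewrite sqrtr_gt0.
move: (Num.sqrt F) (Num.sqrt (1 + F)) a0 b0 => a b a0 b0.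
field; rewrite !gt_eqF ?addr_gt0//.
Qed.

Lemma is_derive_sum_seq (I : Type) (s : seq I) (h dh : I -> R -> R) x :
  (forall i, is_derive x 1 (h i) (dh i x)) ->
  is_derive x 1 (fun z => \sum_(i <- s) h i z) (\sum_(i <- s) dh i x).
Proof.
move=> hP; elim: s => [|i s IH].
  rewrite big_nil (_ : (fun z => _) = fun=> 0); last first.
    by apply/funext => z; rewrite big_nil.
  exact: is_derive_fcst.
rewrite big_cons (_ : (fun z => _) = fun z => h i z + \sum_(j <- s) h j z).
  exact: is_derive_fD.
by apply/funext => z; rewrite big_cons.
Qed.

(** All children move together along a segment in the message coordinate, which leaves one variable
    t for the mean value theorem. The segment needs no domain check, since [message_log] is
    nonnegative on the whole line. Hoelder's inequality then separates the gradient, whose p-th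
    powers sum to at most beta, from the errors. *)
Lemma message_contraction (D lam' : R) : 1 < D -> 0 < lam' < lambda_c D ->
  exists q alpha : R, [/\ 0 < q, 0 < alpha, alpha * D < 1 &
    forall (lam : R) (s : seq (R * R)), 0 < lam <= lam' ->
      (forall z, z \in s -> 0 <= z.1 /\ 0 <= z.2) ->
    `|message (lam * \prod_(z <- s) (1 + z.1)^-1) -
      message (lam * \prod_(z <- s) (1 + z.2)^-1)| `^ q <=
    alpha * \sum_(z <- s) `|message z.1 - message z.2| `^ q].
Proof.
move=> D1 /(subcritical_weight_bound D1)[p [beta [p2 be0 beD bound]]].
have p0 : 0 < p by lra.
have p1 : 0 < p - 1 by lra.
pose q := p / (p - 1); have q0 : 0 < q by rewrite divr_gt0.
have pq : p^-1 + q^-1 = 1 by rewrite /q; field; rewrite !gt_eqF.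
have qp : q / p = (p - 1)^-1 by rewrite /q; field; rewrite !gt_eqF.
exists q, (beta `^ (q / p)); rewrite qp; split=> //; first exact: powR_gt0.
rewrite -qp => lam s ll s0.
have l0 : 0 < lam by case/andP: ll.
pose pt (z : R * R) t := message z.1 + t * (message z.2 - message z.1).
pose H t := message (lam * expR (- \sum_(z <- s) message_log (pt z t))).
have He t f : (forall z, z \in s -> pt z t = message (f z) /\ 0 <= f z) ->
    H t = message (lam * \prod_(z <- s) (1 + f z)^-1).
  move=> fP; congr (message (lam * _)); rewrite -sumrN expR_sum.
  rewrite big_seq [RHS]big_seq; apply: eq_bigr => z /fP[-> fz].
  by rewrite expRN message_logK.
have H1 := He 1 snd; have H0 := He 0 fst.
rewrite -H1; last by move=> z /s0[_ ?]; rewrite /pt; split=> //; ring.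
rewrite -H0; last by move=> z /s0[? _]; rewrite /pt; split=> //; ring.
pose dH t := - (Num.sqrt (lam /
    (expR (\sum_(z <- s) message_log (pt z t)) + lam)) / 2) *
  \sum_(z <- s) (2 * message_slope (pt z t)) * (message z.2 - message z.1).
have [|t /andP[t0 t1]] := @mvt_le H dH 0 1 ler01.
  move=> t _; apply: (is_derive_fcomp (is_derive_message_expR _ l0)).
  apply: (@is_derive_sum_seq _ s (fun z u => message_log (pt z u)) (fun z u =>
    2 * message_slope (pt z u) * (message z.2 - message z.1))) => z.
  apply: (is_derive_fcomp (is_derive_message_log _)).
  have := is_derive_fD (is_derive_fcst (message z.1) t)
    (@is_derive_fZ id (message z.2 - message z.1) t 1 _).
  rewrite add0r mulr1 => h; rewrite (_ : pt z = fun z0 => message z.1 +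
    (message z.2 - message z.1) * id z0); first exact: h.
  by apply/funext => ?; rewrite /pt mulrC.
rewrite subr0 mulr1 distrC => ->.
set U := \sum_(z <- s) message_log (pt z t).
pose S := Num.sqrt (lam / (expR U + lam)).
pose del (z : R * R) := `|message z.1 - message z.2|.
pose a (z : R * R) := S * `|message_slope (pt z t)|.
have S0 : 0 <= S by exact: sqrtr_ge0.
have h1 : `|dH t| <= \sum_(z <- s) a z * del z.
  have S2 : `|S / 2| = S / 2 by rewrite ger0_norm// divr_ge0.
  rewrite /dH -/U -/S normrM normrN S2 mulrAC -mulrA.
  apply: (@le_trans _ _ (S * ((\sum_(z <- s) 2 * `|message_slope (pt z t)| * del z) / 2))).
    apply: ler_wpM2l => //; apply: ler_wpM2r; first by rewrite invr_ge0.
    apply: le_trans (ler_norm_sum _ _ _) _; apply: ler_sum => z _.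
    by rewrite /del !normrM (distrC (message z.1)) (ger0_norm (ler0n R 2)).
  rewrite mulr_suml mulr_sumr; apply: ler_sum => z _.
  by rewrite /a le_eqVlt; apply/orP; left; apply/eqP; field.
(* Since S^2 = lam / (e^U + lam) and the squared slope is 1 - e^(-u), these p-th powers are the
   summands of [subcritical_weight_bound]. *)
have h2 : \sum_(z <- s) a z `^ p <= beta.
  have nn z : 0 <= a z by rewrite mulr_ge0.
  have us0 : all (>= 0) [seq message_log (pt z t) | z <- s].
    by apply/allP => _ /mapP[z _ ->]; exact: message_log_ge0.
  have := bound lam _ ll us0; rewrite !big_map -/U; apply: le_trans; rewrite mulr_sumr; apply: ler_sum => z _.
  rewrite /a (powRM _ S0 (normr_ge0 _)) -message_slope_sqr -[message_slope _ ^+ 2](real_normK (num_real _)).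
  have e x : 0 <= x -> x `^ p = (x ^+ 2) `^ (p / 2).
    by move=> x0; rewrite -powR_mulrn// -powRrM mulrCA divff ?mulr1// pnatr_eq0.
  rewrite (e _ (normr_ge0 _)) (e _ S0) sqr_sqrtr//.
  by rewrite divr_ge0 ?addr_ge0 ?expR_ge0 ?ltW.
apply: le_trans (sumr_hoelder _ _ p0 q0 pq be0 h2).
- apply: ge0_ler_powR; rewrite ?nnegrE ?(ltW q0)//.
  by rewrite sumr_ge0// => z _; rewrite !mulr_ge0.
- by move=> z; rewrite mulr_ge0.
- by move=> z; exact: normr_ge0.
Qed.

(** As sqrt is not differentiable at 0, the mean value theorem is avoided: with t and u the
    exponentials of the messages, x - y <= 2 t (t - u), t - u <= t (ln t - ln u) and t^2 <= 4 (1 +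
    Lam). *)
Lemma message_expanding (Lam x y : R) : 0 <= x <= Lam -> 0 <= y <= Lam ->
  `|x - y| <= 8 * (1 + Lam) * `|message x - message y|.
Proof.
wlog yx : x y / y <= x.
  move=> h hx hy; case: (leP y x) => [/h|/ltW/h]; first exact.
  by move=> /(_ hy hx); rewrite distrC (distrC (message y)).
move=> /andP[x0 xL] /andP[y0 yL].
rewrite !ger0_norm ?subr_ge0// ?message_homo//.
rewrite /message; set t := Num.sqrt (1 + x) + _; set u := Num.sqrt (1 + y) + _.
have t0 : 0 < t by exact: sqrt_sum_gt0.
have u0 : 0 < u by exact: sqrt_sum_gt0.
have h : (t - u) / t <= ln t - ln u.
  have : ln (u / t) <= u / t - 1 by apply: ln_le_subr1; rewrite divr_gt0.
  rewrite ln_div ?posrE// mulrBl divff ?gt_eqF//; lra.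
have ht : t - u <= t * (ln t - ln u) by move: h; rewrite ler_pdivrMr// mulrC.
have sq : Num.sqrt (1 + y) <= Num.sqrt (1 + x).
  by rewrite ler_sqrt ?lerD2l// addr_ge0.
have sx : Num.sqrt y <= Num.sqrt x by rewrite ler_sqrt.
have sxx : Num.sqrt x <= Num.sqrt (1 + x) by rewrite ler_sqrt ?ler_wpDl// addr_ge0.
have ex : Num.sqrt x ^+ 2 = x by rewrite sqr_sqrtr.
have ey : Num.sqrt y ^+ 2 = y by rewrite sqr_sqrtr.
have e1 : Num.sqrt (1 + x) ^+ 2 = 1 + x by rewrite sqr_sqrtr// ltW// ltr_wpDr.
have g0 := sqrtr_ge0 y; have g1 := sqrtr_ge0 x.
have k1 : x - y <= 2 * t * (t - u).
  rewrite -[in leLHS]ex -[in leLHS]ey subr_sqr.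
  rewrite /t /u; move: (Num.sqrt x) (Num.sqrt y) (Num.sqrt (1 + x)) (Num.sqrt (1 + y)) sq sx sxx g0 g1.
  clear; move=> a b c d h1 h2 h3 h4 h5; nra.
have k2 : t ^+ 2 <= 4 * (1 + Lam).
  rewrite /t; move: (Num.sqrt x) (Num.sqrt (1 + x)) sxx g1 e1 => a c h1 h2 h3.
  nra.
have d0 : 0 <= ln t - ln u by rewrite subr_ge0 ler_ln ?posrE// lerD.
move: (ln t - ln u) d0 ht k1 k2 t0 => d d0 ht k1 k2 t0.
apply: (le_trans k1); apply: (@le_trans _ _ (2 * t * (t * d))).
  by rewrite ler_pM2l// mulr_gt0.
have -> : 2 * t * (t * d) = t ^+ 2 * (2 * d) by ring.
apply: (@le_trans _ _ (4 * (1 + Lam) * (2 * d))); last lra.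
by rewrite ler_wpM2r// mulr_ge0.
Qed.
End Analysis.

(** * The recursion on self-avoiding walks *)

Section HardCore.
Variables (R : realType) (G : graph) (lam : R).
Hypothesis lam_gt0 : 0 < lam.
Implicit Types (v x : G) (S T : {fset G}).

(** The recursion only deletes vertices, so everything is stated for subsets of one graph;
    [partition_function] is by definition the case [S = vertices G]. *)
Definition hc_sum S : R :=
  \sum_(J <- fpowerset S | `[< independent [set` J] >]) lam ^+ #|` J|.

Lemma big_fpowersetD1 (F : {fset G} -> R) v S : v \in S ->
  \sum_(J <- fpowerset S) F J =
  \sum_(J <- fpowerset (S `\ v)%fset) F J +
  \sum_(J <- fpowerset (S `\ v)%fset) F (v |` J)%fset.
Proof.
move=> vS; rewrite -(big_map (fun J => v |` J)%fset xpredT F) -big_cat /=.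
apply: perm_big; apply: uniq_perm; first exact: fset_uniq.
  rewrite cat_uniq fset_uniq/= map_inj_in_uniq ?fset_uniq ?andbT.
    apply/hasPn => _ /mapP[J _ ->]; apply/negP; rewrite fpowersetE.
    by move=> /fsubsetP/(_ v); rewrite !inE eqxx => /(_ isT).
  move=> A B; rewrite !fpowersetE => /fsubsetP sA /fsubsetP sB e.
  apply/fsetP => x; have /fsetP/(_ x) := e; rewrite !inE.
  have [-> _|//] := eqVneq x v.
  by apply/idP/idP => [/sA|/sB]; rewrite !inE eqxx.
move=> J; rewrite mem_cat fpowersetE; apply/idP/idP => [sJ|/orP[]].
- have [vJ|vJ] := boolP (v \in J).
    apply/orP; right; apply/mapP; exists (J `\ v)%fset; last by rewrite fsetD1K.
    by rewrite fpowersetE fsetSD.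
  by apply/orP; left; rewrite fpowersetE fsubsetD1 sJ.
- by rewrite fpowersetE => /fsubset_trans; apply; exact: fsubD1set.
- move=> /mapP[A]; rewrite fpowersetE => sA ->.
  rewrite fsubUset fsub1set vS /=; apply: fsubset_trans sA _.
  exact: fsubD1set.
Qed.

Lemma big_fpowerset_sub (P : pred {fset G}) (F : {fset G} -> R) S T :
  (T `<=` S)%fset ->
  \sum_(J <- fpowerset S | (J `<=` T)%fset && P J) F J =
  \sum_(J <- fpowerset T | P J) F J.
Proof.
move=> TS; rewrite -big_filter -[RHS]big_filter; apply: perm_big.
apply: uniq_perm; rewrite ?filter_uniq ?fset_uniq// => J.
rewrite !mem_filter !fpowersetE -andbA.
by case JT : (J `<=` T)%fset; rewrite ?andbF//= (fsubset_trans JT TS) andbT.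
Qed.

Definition non_nbrs v S : {fset G} := [fset x in S | ~~ adj v x]%fset.

Lemma independent_fsetU1 v (J : {fset G}) :
  independent [set` (v |` J)%fset] <->
  independent [set` J] /\ (forall x, x \in J -> ~~ adj v x).
Proof.
split=> [h|[h1 h2] x y /=].
  split=> [x y /= xJ yJ|x xJ]; apply: h => /=; rewrite !inE ?eqxx ?xJ ?yJ ?orbT//.
rewrite !inE => /orP[/eqP->|xJ] /orP[/eqP->|yJ].
- by rewrite adj_irrefl.
- exact: h2.
- by rewrite adj_sym h2.
- exact: h1.
Qed.

Lemma hc_sumD1 v S : v \in S ->
  hc_sum S = hc_sum (S `\ v)%fset + lam * hc_sum (non_nbrs v (S `\ v)%fset).
Proof.
move=> vS; rewrite /hc_sum big_mkcond (big_fpowersetD1 _ vS) -big_mkcond/=.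
congr (_ + _).
rewrite -(@big_fpowerset_sub _ _ (S `\ v)%fset (non_nbrs v (S `\ v)%fset)); last first.
  by apply/fsubsetP => x; rewrite !inE => /andP[].
rewrite mulr_sumr [RHS]big_mkcond; apply: eq_big_seq => J.
rewrite fpowersetE => /fsubsetP sJ.
have vJ : v \notin J by apply/negP => /sJ; rewrite !inE eqxx.
rewrite cardfsU1 vJ exprD expr1.
congr (if _ then _ else _); apply/asboolP/andP => [/independent_fsetU1[h1 h2]|].
  split; last exact/asboolP.
  by apply/fsubsetP => x xJ; rewrite /non_nbrs !inE/= h2// andbT; have := sJ _ xJ; rewrite !inE.
move=> [/fsubsetP h2 /asboolP h1]; apply/independent_fsetU1; split=> // x /h2.
by rewrite !inE => /andP[].
Qed.

Lemma hc_sum_gt0 S : 0 < hc_sum S.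
Proof.
rewrite /hc_sum big_mkcond (big_fsetD1 fset0) ?fpowersetE ?fsub0set//=.
rewrite asboolT; last by move=> x y; rewrite /= inE.
rewrite expr0 ltr_wpDr// sumr_ge0 // => J _.
by case: ifP => // _; rewrite exprn_ge0 // ltW.
Qed.

Definition hc_ratio v S : R :=
  lam * hc_sum (non_nbrs v (S `\ v)%fset) / hc_sum (S `\ v)%fset.

Lemma hc_ratio_ge0 v S : 0 <= hc_ratio v S.
Proof. by rewrite divr_ge0 ?mulr_ge0 ?ltW ?hc_sum_gt0. Qed.

Lemma hc_sum_ratio v S : v \in S ->
  hc_sum S = hc_sum (S `\ v)%fset * (1 + hc_ratio v S).
Proof.
move=> vS; rewrite (hc_sumD1 vS) mulrDr mulr1 /hc_ratio mulrCA divff ?mulr1//.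
by rewrite gt_eqF ?hc_sum_gt0.
Qed.

(* The children of a node of the tree of self-avoiding walks: each neighbour
   comes with the set of vertices still available when it is visited. *)
Fixpoint kids (l : seq G) S : seq (G * {fset G}) :=
  if l is x :: l' then
    if x \in S then (x, S) :: kids l' (S `\ x)%fset else kids l' S
  else [::].

Lemma kidsP (l : seq G) S c : c \in kids l S ->
  [/\ c.1 \in l, c.1 \in c.2, c.1 \in S & (c.2 `<=` S)%fset].
Proof.
elim: l S => [//|x l IH] S /=; case: ifP => xS.
  rewrite inE => /orP[/eqP->/=|/IH[h1 h2 h3 h4]]; first by rewrite mem_head xS fsubset_refl.
  split=> //; first by rewrite inE h1 orbT.
    by move: h3; rewrite !inE => /andP[].
  by apply: fsubset_trans h4 _; exact: fsubD1set.
by move=> /IH[h1 h2 h3 h4]; rewrite inE h1 orbT.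
Qed.

Lemma kids_uniq (l : seq G) S : uniq [seq c.1 | c <- kids l S].
Proof.
elim: l S => [//|x l IH] S /=; case: ifP => xS //=.
rewrite IH andbT; apply/mapP => -[c /kidsP[_ _ + _]] e.
by rewrite -e !inE eqxx.
Qed.

(** Each factor is Z(S - x) / Z(S), so the product telescopes. With the neighbours of v as l this
    gives the recursion for R_v; with all vertices it gives the formula for Z. *)
Lemma prod_kids_ratio (l : seq G) S :
  \prod_(c <- kids l S) (1 + hc_ratio c.1 c.2)^-1 =
  hc_sum [fset x in S | x \notin l]%fset / hc_sum S.
Proof.
elim: l S => [|x l IH] S /=.
  rewrite big_nil (_ : [fset x in S | _]%fset = S) ?divff ?gt_eqF ?hc_sum_gt0//.
  by apply/fsetP => x; rewrite !inE andbT.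
case: ifP => xS.
  rewrite big_cons IH (hc_sum_ratio xS) /= invfM.
  rewrite (_ : [fset x0 in (S `\ x)%fset | x0 \notin l]%fset =
      [fset x0 in S | x0 \notin x :: l]%fset); first by ring.
  by apply/fsetP => y; rewrite !inE /= negb_or; case: (y == x) (y \in S) => [] [].
rewrite IH; congr (hc_sum _ / _); apply/fsetP => y; rewrite !inE negb_or.
by have [->|] := eqVneq y x; rewrite ?xS.
Qed.

(** * Truncated recursion and the tree of self-avoiding walks *)

Section SawTree.
(** The order of the neighbours is left open: mixing uses an arbitrary enumeration, the algorithm
    the order of the labels. *)
Variable nb : G -> seq G.
Hypothesis nbP : forall v x, (x \in nb v) = adj v x.

Local Notation children v S := (kids (nb v) (S `\ v)%fset).

Lemma hc_ratio_rec v S :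
  hc_ratio v S = lam * \prod_(c <- children v S) (1 + hc_ratio c.1 c.2)^-1.
Proof.
rewrite prod_kids_ratio /hc_ratio mulrA; congr (_ * hc_sum _ / _).
by apply/fsetP => x; rewrite !inE nbP.
Qed.

(** Cutting at the value 0 keeps all truncated ratios in [0, lam], where messages and ratios are
    comparable. *)
Fixpoint trunc_ratio (l : nat) v S : R :=
  if l is l'.+1 then
    lam * \prod_(c <- children v S) (1 + trunc_ratio l' c.1 c.2)^-1
  else 0.

Lemma trunc_ratio_ge0 l v S : 0 <= trunc_ratio l v S.
Proof.
elim: l v S => [//|l IH] v S /=; rewrite mulr_ge0 ?(ltW lam_gt0)//.
by apply: prodr_ge0 => c _; rewrite invr_ge0 addr_ge0.
Qed.

Lemma prod_inv1D_le1 (I : Type) (s : seq I) (f : I -> R) :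
  (forall i, 0 <= f i) -> \prod_(i <- s) (1 + f i)^-1 <= 1.
Proof.
move=> f0; elim: s => [|i s IH]; first by rewrite big_nil.
rewrite big_cons mulr_ile1 ?invr_ge0 ?addr_ge0 ?prodr_ge0//.
  by move=> j _; rewrite invr_ge0 addr_ge0.
by rewrite invf_le1 ?lerDl// ltr_wpDr.
Qed.

Lemma hc_ratio_le v S : hc_ratio v S <= lam.
Proof.
rewrite hc_ratio_rec ger_pMr//; apply: prod_inv1D_le1 => c.
exact: hc_ratio_ge0.
Qed.

Lemma trunc_ratio_le l v S : trunc_ratio l v S <= lam.
Proof.
case: l => [|l] /=; first exact: ltW.
by rewrite ger_pMr//; apply: prod_inv1D_le1 => c; exact: trunc_ratio_ge0.
Qed.

(** Deleting earlier siblings prunes walks, so a level lists only some of the self-avoiding walks of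
    its length, and [nb_saws] is an upper bound for its size. *)
Fixpoint saw_tree_level (l : nat) v S : seq (seq G) :=
  if l is l'.+1 then
    flatten [seq map (cons c.1) (saw_tree_level l' c.1 c.2) | c <- children v S]
  else [:: [::]].

Lemma saw_tree_levelP l v S p : p \in saw_tree_level l v S ->
  [/\ saws v l p & {subset p <= S}].
Proof.
rewrite /saws/=; elim: l v S p => [|l IH] v S p /=.
  by rewrite inE => /eqP->.
move=> /flatten_mapP[c /kidsP[]]; rewrite nbP => vc c2 cS c2S /mapP[p' + ->].
have c2S' x : x \in c.2 -> x \in S /\ x != v.
  by move=> /(fsubsetP c2S); rewrite !inE => /andP[].
move=> /IH[[sz pth un] sub]; rewrite /= sz vc pth; split; last first.
  by move=> x; rewrite inE => /orP[/eqP->|/sub]; [move: c2|] => /c2S'[].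
split=> //; rewrite inE negb_or eq_sym (c2S' _ c2).2/= un andbT.
apply/negP => /sub/c2S'[_]; by rewrite eqxx.
Qed.

Lemma saw_tree_level_uniq l v S : uniq (saw_tree_level l v S).
Proof.
elim: l v S => [//|l IH] v S /=.
have := kids_uniq (nb v) (S `\ v)%fset; elim: (kids _ _) => [//|c cs IHc] /=.
move=> /andP[cn un]; rewrite cat_uniq IHc// andbT map_inj_uniq ?IH//=; last first.
  by move=> ? ? [].
apply/hasPn => p /flatten_mapP[d ds /mapP[p' _ ->]]; apply/negP => /mapP[p'' _ []] e _.
by move/negP: cn; apply; rewrite -e; apply: map_f.
Qed.

Lemma size_saw_tree_level l v S :
  size (saw_tree_level l.+1 v S) =
  (\sum_(c <- children v S) size (saw_tree_level l c.1 c.2))%N.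
Proof.
rewrite /= size_flatten /shape sumnE !big_map.
by apply: eq_bigr => c _; rewrite size_map.
Qed.

Lemma size_saw_tree_level_le l v S :
  finite_set (saws v l) -> (size (saw_tree_level l v S) <= nb_saws v l)%N.
Proof.
move=> fin; apply: uniq_leq_size; first exact: saw_tree_level_uniq.
by move=> p /saw_tree_levelP[h _]; rewrite in_fset_set// inE.
Qed.

(** Both recursions delete the same vertices, so agreement of the sets along short walks survives
    each step. This is what hides distant differences between boundary conditions. *)
Lemma trunc_ratio_local l v S1 S2 :
  (forall p, path (@adj G) v p -> (size p <= l)%N ->
     (last v p \in S1) = (last v p \in S2)) ->
  trunc_ratio l v S1 = trunc_ratio l v S2.
Proof.
elim: l v S1 S2 => [//|l IH] v S1 S2 H /=; congr (_ * _).
have {H} : forall p, path (@adj G) v p -> (size p <= l.+1)%N ->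
    (last v p \in S1 `\ v)%fset = (last v p \in S2 `\ v)%fset.
  by move=> p pp sp; rewrite !inE H.
have : {subset nb v <= nb v} by [].
move: {1 3 4}(nb v) => l0; move: (_ `\ v)%fset (_ `\ v)%fset.
elim: l0 => [|x l0 IHl] T2 T1 sub H /=; first by rewrite !big_nil.
have vx : adj v x by rewrite -nbP sub ?mem_head.
have eq1 : (x \in T1) = (x \in T2) by have := H [:: x]; rewrite /= vx; apply.
have sub' : {subset l0 <= nb v} by move=> y yl; apply: sub; rewrite inE yl orbT.
rewrite eq1; case: ifP => xT; last exact: IHl.
rewrite !big_cons /=; congr (_^-1 * _).
  congr (_ + _); apply: IH => p pp sp.
  by have := H (x :: p); rewrite /= vx pp; apply.
by apply: IHl => // p pp sp; rewrite !inE H.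
Qed.

(** The q-th power of the error at a node is at most alpha times the sum of those of its children,
    so the bound iterates: alpha per level, and a plain count of the nodes at depth l. *)
Lemma trunc_ratio_error (q alpha lam' : R) l v S :
  0 < q -> 0 < alpha -> lam <= lam' ->
  (forall s : seq (R * R), (forall z, z \in s -> 0 <= z.1 /\ 0 <= z.2) ->
    `|message (lam * \prod_(z <- s) (1 + z.1)^-1) -
      message (lam * \prod_(z <- s) (1 + z.2)^-1)| `^ q <=
    alpha * \sum_(z <- s) `|message z.1 - message z.2| `^ q) ->
  `|message (hc_ratio v S) - message (trunc_ratio l v S)| `^ q <=
  message lam' `^ q * alpha ^+ l * (size (saw_tree_level l v S))%:R.
Proof.
move=> q0 a0 ll ctr; elim: l v S => [|l IH] v S.
  rewrite /= expr0 !mulr1; apply: ge0_ler_powR; rewrite ?nnegrE ?(ltW q0)//.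
    by rewrite message_ge0// (le_trans _ ll)// ltW.
  have -> : message (0 : R) = 0 by rewrite /message addr0 sqrtr1 sqrtr0 addr0 ln1.
  rewrite subr0 ger0_norm ?message_ge0 ?hc_ratio_ge0//.
  by rewrite message_homo ?hc_ratio_ge0// (le_trans (hc_ratio_le _ _)).
rewrite hc_ratio_rec [trunc_ratio _ _ _]/= size_saw_tree_level.
have := ctr [seq (hc_ratio c.1 c.2, trunc_ratio l c.1 c.2) | c <- children v S].
rewrite !big_map => h; apply: le_trans (h _) _.
  by move=> _ /mapP[c _ ->] /=; rewrite hc_ratio_ge0 trunc_ratio_ge0.
rewrite natr_sum exprS mulrCA -mulrA ler_pM2l// mulr_sumr /=.
by apply: ler_sum => c _; exact: IH.
Qed.
End SawTree.
End HardCore.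

(** * Strong spatial mixing *)

Section FreeVertices.
Variables (R : realType) (G : graph) (lam : R).
Hypothesis lam_gt0 : 0 < lam.

(** An occupied boundary vertex forces its neighbours out, so conditioning on s leaves the hard core
    model on these vertices. *)
Definition free_vertices (s : boundary_condition G) : {fset G} :=
  [fset x in unfixed s | `[< forall y, bc_occ s y -> ~~ adj x y >]]%fset.

Lemma mem_free (s : boundary_condition G) x :
  (x \in free_vertices s) <->
  (~ bc_fixed s x /\ forall y, bc_occ s y -> ~~ adj x y).
Proof.
rewrite !inE/= /unfixed in_fset_set; last exact: bc_unfixed_finite.
split=> [/andP[/set_mem h1 /asboolP h2]//|[h1 h2]].
by apply/andP; split; [apply/mem_set|apply/asboolP].
Qed.

Lemma independent_extension (s : boundary_condition G) (A : {fset G}) :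
  (A `<=` unfixed s)%fset ->
  `[< independent (extension s A) >] =
  (A `<=` free_vertices s)%fset && `[< independent [set` A] >].
Proof.
move=> /fsubsetP sA; apply/asboolP/andP => [h|[/fsubsetP h1 /asboolP h2]].
  split.
    apply/fsubsetP => x xA; rewrite !inE/= sA//=; apply/asboolP => y oy.
    by apply: h; [right|left].
  by apply/asboolP => x y xA yA; apply: h; right.
move=> x y [ox|xA] [oy|yA].
- exact: (@bc_occ_independent _ s).
- by rewrite adj_sym; have /mem_free[_] := h1 _ yA; apply.
- by have /mem_free[_] := h1 _ xA; apply.
- exact: h2.
Qed.

Let free_sub s : (free_vertices s `<=` unfixed s)%fset.
Proof. by apply/fsubsetP => x; rewrite !inE => /andP[]. Qed.

Lemma occ_ratio_free (s : boundary_condition G) v :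
  occ_ratio lam s v =
  if v \in free_vertices s then hc_ratio lam v (free_vertices s) else 0.
Proof.
have den : \sum_(A <- fpowerset (unfixed s) | `[< independent (extension s A) >])
    lam ^+ #|` A| = hc_sum lam (free_vertices s).
  rewrite /hc_sum -(big_fpowerset_sub _ _ (free_sub s)).
  rewrite big_seq_cond [RHS]big_seq_cond; apply: eq_bigl => A.
  rewrite fpowersetE; case: (boolP (A `<=` unfixed s)%fset) => //= h.
  by rewrite independent_extension.
rewrite /occ_ratio /occ_prob den; have Z0 := hc_sum_gt0 lam_gt0 (free_vertices s).
case: ifPn => vf; last first.
  (* If v is occupied, the probability is 1 and the ratio 1 / 0 takes the junk value 0; otherwise no
     term of the numerator survives. *)
  have [ov|ov] := pselect (bc_occ s v).
    rewrite (_ : \sum_(A <- _ | _) _ = hc_sum lam (free_vertices s)).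
      by rewrite divff ?gt_eqF// subrr invr0 mulr0.
    rewrite -den; apply: eq_bigl => A; apply: asbool_equiv_eq.
    by split=> [[]//|h]; split=> //; left.
  rewrite big1_seq ?mul0r// => A /andP[/asboolP[iA [//|vA]]].
  rewrite fpowersetE => sA; have := independent_extension sA.
  by rewrite asboolT// => /esym/andP[/fsubsetP/(_ _ vA)]; rewrite (negbTE vf).
have [nfv _] := (mem_free s v).1 vf.
have num : \sum_(A <- fpowerset (unfixed s) |
       `[< independent (extension s A) /\ extension s A v >]) lam ^+ #|` A| =
    hc_sum lam (free_vertices s) - hc_sum lam (free_vertices s `\ v)%fset.
  apply/eqP; rewrite eq_sym subr_eq eq_sym -den; apply/eqP.
  rewrite [RHS](bigID (fun A : {fset G} => v \in A)) /=; congr (_ + _).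
    apply: eq_bigl => A; apply/asboolP/andP => [[h1 [/(@bc_occ_fixed _ s)//|vA]]|].
      by split=> //; apply/asboolP.
    by move=> [/asboolP h1 vA]; split=> //; right.
  have sub : (free_vertices s `\ v `<=` unfixed s)%fset.
    by apply: fsubset_trans (free_sub s); exact: fsubD1set.
  rewrite /hc_sum -(big_fpowerset_sub _ _ sub).
  rewrite big_seq_cond [RHS]big_seq_cond; apply: eq_bigl => A.
  rewrite fpowersetE; case: (boolP (A `<=` unfixed s)%fset) => //= h.
  by rewrite independent_extension// fsubsetD1 andbAC.
rewrite num; have W0 := hc_sum_gt0 lam_gt0 (free_vertices s `\ v)%fset.
have := hc_sum_ratio lam_gt0 vf; move: W0 Z0.
move: (hc_sum lam (free_vertices s)) (hc_sum lam (free_vertices s `\ v)%fset).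
move=> z w w0 z0 zw; apply: (@mulfI _ w); rewrite ?gt_eqF//.
have -> : hc_ratio lam v (free_vertices s) = z / w - 1.
  by rewrite zw; field; rewrite gt_eqF.
have -> : (z - w) / z / (1 - (z - w) / z) = (z - w) / w.
  by field; rewrite !gt_eqF.
by field; rewrite gt_eqF.
Qed.

(** Whether a vertex is free depends on its neighbours as well, so the boundary conditions must
    agree up to distance l + 1. *)
Lemma free_vertices_local v l (s t : boundary_condition G) (p : seq G) :
  differ_only_from v l.+2 s t -> path (@adj G) v p -> (size p <= l)%N ->
  (last v p \in free_vertices s) = (last v p \in free_vertices t).
Proof.
move=> dif pp sp.
have agree p' : path (@adj G) v p' -> (size p' <= l.+1)%N ->
   (bc_fixed s (last v p') <-> bc_fixed t (last v p')) /\
   (bc_occ s (last v p') <-> bc_occ t (last v p')).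
  move=> pp' sp'; apply: contrapT => /dif/(_ _ pp' erefl).
  by rewrite ltnNge sp'.
have agN y : adj (last v p) y -> (bc_occ s y <-> bc_occ t y).
  move=> ay; have := agree (rcons p y).
  by rewrite rcons_path pp ay size_rcons last_rcons => /(_ isT sp) [].
have [agf _] := agree p pp (leqW sp).
apply/idP/idP => /mem_free[h1 h2]; apply/mem_free; split.
- by move/agf.
- by move=> y oy; apply/negP => ay; move: (h2 y); rewrite ay => /(_ ((agN _ ay).2 oy)).
- by move/agf.
- by move=> y oy; apply/negP => ay; move: (h2 y); rewrite ay => /(_ ((agN _ ay).1 oy)).
Qed.
End FreeVertices.

Lemma locally_finite_saws (G : graph) (v : G) l :
  locally_finite G -> finite_set (saws v l).
Proof.
move=> lf; apply: (@sub_finite_set _ _ [set p | size p = l /\ path (@adj G) v p]).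
  by move=> p [].
elim: l v => [|l IH] v.
  by apply: (@sub_finite_set _ _ [set [::]]) => // p [/size0nil -> _].
apply: (@sub_finite_set _ _ (\bigcup_(x in [set u | adj v u])
   (cons x @` [set p | size p = l /\ path (@adj G) x p]))).
  by move=> [[]//|x p] [] /= [sp] /andP[vx pp]; exists x => //; exists p.
by apply: bigcup_finite => // x _; exact: finite_image.
Qed.

Definition neighbours (G : graph) (v : G) : seq G := fset_set [set u | adj v u].

Lemma mem_neighbours (G : graph) (v x : G) :
  locally_finite G -> (x \in neighbours v) = adj v x.
Proof. by move=> lf; rewrite /neighbours in_fset_set// mem_setE. Qed.

(** The constants come before the activity and the graph: mixing needs them for all graphs at once,
    the algorithm for rounded activities. Walk counts of order D'^l with D' > D are allowed, because
    a limsup bounded by D gives no more. *)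
Lemma trunc_ratio_decay (R : realType) (D lam' : R) : 1 < D -> 0 < lam' < lambda_c D ->
  exists D' theta K q : R, [/\ D < D', 0 < theta < 1, 0 <= K &
    forall (lam : R) (G : graph) (nb : G -> seq G) (v : G) (S : {fset G})
      (l : nat) (c : R), 0 < lam <= lam' ->
    (forall v x, (x \in nb v) = adj v x) ->
    (size (saw_tree_level nb l v S))%:R <= c * D' ^+ l ->
    `|hc_ratio lam v S - trunc_ratio lam nb l v S| <=
      K * c `^ q * theta ^+ l].
Proof.
move=> D1 /[dup] /andP[l'0 _] /(message_contraction D1)[q [alpha [q0 a0 aD ctr]]].
pose D' := (D + alpha^-1) / 2.
have DD' : D < D'.
  have : D < alpha^-1 by rewrite -div1r ltr_pdivlMr// mulrC.
  by rewrite /D'; lra.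
have D'0 : 0 < D' by rewrite (lt_trans _ DD')// (lt_trans _ D1).
have aD' : alpha * D' < 1.
  rewrite /D' mulrA ltr_pdivrMr// mulrDr divff ?gt_eqF//; lra.
have aD'0 : 0 < alpha * D' by rewrite mulr_gt0.
pose theta := (alpha * D') `^ q^-1.
(* The factor 8 (1 + lam') is the price of leaving the message coordinate, and [message lam'] bounds
   the error at depth 0. The exponent returned is 1 / q, as the contraction concerns q-th powers. *)
exists D', theta, (8 * (1 + lam') * message lam'), q^-1; split=> //.
- rewrite powR_gt0//= /theta /powR gt_eqF// -[ltRHS]expR0 ltr_expR.
  by rewrite pmulr_rlt0 ?invr_gt0// ln_lt0 ?aD'0.
- by rewrite !mulr_ge0 ?message_ge0 ?addr_ge0 ?ltW.
move=> lam G nb v S l c ll nbP cnt; have [l0 lle] := andP ll.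
have l'ge := ltW l'0.
apply: (le_trans (@message_expanding _ lam' _ _ _ _)).
- by rewrite hc_ratio_ge0// (le_trans (hc_ratio_le l0 nbP _ _)).
- by rewrite trunc_ratio_ge0// (le_trans (trunc_ratio_le l0 _ _ _ _)).
rewrite -!mulrA ler_pM2l// ler_pM2l; last by rewrite ltr_wpDr.
have c0 : 0 <= c.
  by rewrite -(@pmulr_lge0 _ (D' ^+ l)) ?exprn_gt0// (le_trans _ cnt).
have := @trunc_ratio_error R G lam l0 nb nbP q alpha lam' l v S q0 a0 lle
  (fun s => ctr lam s ll).
set X := `|_| => h.
have X0 : 0 <= X by exact: normr_ge0.
have -> : X = (X `^ q) `^ q^-1 by rewrite -powRrM divff ?gt_eqF// powRr1.
have m0 : 0 <= message lam' by exact: message_ge0.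
have a0' := ltW a0; have D'0' := ltW D'0.
have e : message lam' * (c `^ q^-1 * theta ^+ l) =
   (message lam' `^ q * (alpha ^+ l * (c * D' ^+ l))) `^ q^-1.
  rewrite powRM ?powR_ge0 ?mulr_ge0 ?exprn_ge0//.
  rewrite -powRrM divff ?gt_eqF// powRr1//; congr (_ * _).
  rewrite mulrCA -exprMn [RHS]powRM ?exprn_ge0 ?(ltW aD'0)//; congr (_ * _).
  by rewrite -(powR_mulrn _ (powR_ge0 _ _)) -(powR_mulrn _ (ltW aD'0)) /theta powRAC.
rewrite e; apply: ge0_ler_powR; rewrite ?nnegrE ?invr_ge0 ?(ltW q0) ?powR_ge0//.
  by rewrite !mulr_ge0 ?powR_ge0 ?exprn_ge0.
apply: le_trans h _; rewrite -!mulrA ler_wpM2l ?powR_ge0//.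
by rewrite ler_wpM2l// exprn_ge0.
Qed.

Lemma limn_esup_lt_near (R : realType) (u : nat -> \bar R) (b : \bar R) :
  (limn_esup u < b)%E -> exists N, forall l, (N <= l)%N -> (u l < b)%E.
Proof.
rewrite limn_esup_lim (cvg_lim _ (@cvg_esups_inf _ u))// => h.
have [_ [N _ <-] hN] := ereal_inf_lt h.
exists N => l Nl; apply: le_lt_trans hN.
by apply: ereal_sup_ubound; exists l.
Qed.

Lemma nb_saws_le_connective (R : realType) (G : graph) (D D' : R) (v : G) :
  0 <= D' -> D < D' -> (connective_constant R G <= D%:E)%E ->
  exists N, forall l, (N <= l)%N -> (nb_saws v l)%:R <= D' ^+ l.
Proof.
move=> D'0 DD' cc.
have [|N hN] := @limn_esup_lt_near R
  (fun l : nat => ((nb_saws v l)%:R `^ (l%:R^-1))%:E) D'%:E.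
  apply: le_lt_trans (_ : (D%:E < D'%:E)%E); last by rewrite lte_fin.
  apply: le_trans cc; apply: ereal_sup_ubound; exists v => //.
(* Starting at [N.+1] excludes l = 0, where the l-th root carries no information. *)
exists N.+1 => l Nl; have := hN l (ltnW Nl); rewrite lte_fin => /ltW h.
have l0 : 0 < l%:R :> R by rewrite ltr0n (leq_trans _ Nl).
rewrite -powR_mulrn//.
have -> : (nb_saws v l)%:R = ((nb_saws v l)%:R `^ l%:R^-1) `^ l%:R :> R.
  by rewrite -powRrM mulVf ?gt_eqF// powRr1.
by apply: ge0_ler_powR; rewrite ?nnegrE ?powR_ge0 ?(ltW l0).
Qed.

(** Both ratios are compared with one truncated ratio, which sees only the region where the boundary
    conditions agree. Lengths not covered by a walk count are absorbed into the constant, since the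
    difference never exceeds lambda. *)
Lemma strong_spatial_mixing_of_cc (R : realType) (Delta lambda : R)
    (F F_inf : graph_family) :
  1 < Delta -> 0 < lambda -> lambda < lambda_c Delta ->
  (forall G : graph, F G -> finite_graph G) ->
  family_connective_constant_le F Delta ->
  (forall G : graph, F_inf G ->
     [/\ ~ finite_graph G, locally_finite G &
         (connective_constant R G <= Delta%:E)%E]) ->
  strong_spatial_mixing lambda (fun G => F G \/ F_inf G).
Proof.
move=> D1 l0 lc Ffin [a [c0 Fcc]] Finf.
have lc' : 0 < lambda < lambda_c Delta by rewrite l0.
have [D' [th [K [q [DD' /andP[th0 th1] K0 dec]]]]] := trunc_ratio_decay D1 lc'.
have D0 : 0 < Delta by rewrite (lt_trans _ D1).
have D'0 : 0 < D' by rewrite (lt_trans _ DD').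
have lf G : finite_graph G -> locally_finite G.
  by move=> fG v; apply: sub_finite_set fG.
have step (G : graph) (v : G) l s t c : locally_finite G ->
    (nb_saws v l)%:R <= c * D' ^+ l -> differ_only_from v l.+2 s t ->
    `|occ_ratio lambda s v - occ_ratio lambda t v| <= 2 * K * c `^ q * th ^+ l.
  move=> lG cnt dif; rewrite !occ_ratio_free//.
  have := @free_vertices_local _ v l s t [::] dif isT (leq0n l); rewrite /= => ->.
  have B0 : 0 <= 2 * K * c `^ q * th ^+ l.
    by rewrite !mulr_ge0 ?powR_ge0 ?exprn_ge0// ltW.
  case: ifP => _; last by rewrite subrr normr0.
  have nbP (u x : G) : (x \in neighbours u) = adj u x by exact: mem_neighbours.
  have h S : `|hc_ratio lambda v S - trunc_ratio lambda (@neighbours G) l v S| <=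
      K * c `^ q * th ^+ l.
    apply: dec => //; first by rewrite l0 /=.
    apply: le_trans cnt; rewrite ler_nat.
    by apply: size_saw_tree_level_le => //; exact: locally_finite_saws.
  have e : trunc_ratio lambda (@neighbours G) l v (free_vertices s) =
      trunc_ratio lambda (@neighbours G) l v (free_vertices t).
    by apply: trunc_ratio_local => // p pp sp; exact: free_vertices_local dif pp sp.
  have hs := h (free_vertices s); have ht := h (free_vertices t).
  move: ht; rewrite -e => ht.
  rewrite -[X in X - _](subrK (trunc_ratio lambda (@neighbours G) l v (free_vertices s))).
  rewrite -addrA; apply: le_trans (ler_normD _ _) _.
  rewrite distrC in ht.
  have -> : 2 * K * c `^ q * th ^+ l = K * c `^ q * th ^+ l + K * c `^ q * th ^+ l.
    by ring.
  exact: lerD.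
have triv (G : graph) (v : G) s t : locally_finite G ->
    `|occ_ratio lambda s v - occ_ratio lambda t v| <= lambda.
  move=> lG; have b s' : 0 <= occ_ratio lambda s' v <= lambda.
    rewrite occ_ratio_free//; case: ifP => _; last by rewrite lexx ltW.
    rewrite hc_ratio_ge0//=; apply: (@hc_ratio_le _ _ _ _ (@neighbours G)) => // u x.
    exact: mem_neighbours.
  by have := b s; have := b t; rewrite ler_norml; lra.
have small (l N : nat) : (l <= N)%N -> lambda <= lambda / th ^+ N * th ^+ l.
  move=> lN; rewrite -mulrA ler_peMr ?(ltW l0)//.
  rewrite mulrC ler_pdivlMr ?exprn_gt0// mul1r.
  by rewrite ler_wiXn2l// ltW.
have cancel2 (x : R) l : x / th ^+ 2 * th ^+ l.+2 = x * th ^+ l.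
  by rewrite -[l.+2]/(2 + l)%N exprD mulrA divfK// expf_neq0// gt_eqF.
have th_ge0 := ltW th0; have l_ge0 := ltW l0.
exists th; first by rewrite th1 ltW.
split.
- move=> G FG v.
  have lG : locally_finite G by case: FG => [/Ffin/lf//|/Finf[]].
  have [N [c [c_ge0 hN]]] : exists N c, 0 <= c /\ forall l, (N <= l)%N ->
      (nb_saws v l)%:R <= c * D' ^+ l.
    case: FG => [FG|/Finf[_ _ cc]]; last first.
      have [N hN] := nb_saws_le_connective v (ltW D'0) DD' cc.
      by exists N, 1; split=> // l /hN; rewrite mul1r.
    pose x := a * ln (graph_order G)%:R.
    exists (Num.bound `|x|).+1, `|c0|; split=> // l Nl.
    have xl : x <= l%:R.
      apply: le_trans (ler_norm _) _; apply: ltW.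
      apply: lt_le_trans (archi_boundP (normr_ge0 _)) _.
      by rewrite ler_nat ltnW.
    apply: (@le_trans _ _ (\sum_(1 <= i < l.+1) nb_saws v i)%N%:R).
      by rewrite ler_nat big_nat_recr/= ?leq_addl// (leq_trans _ Nl).
    apply: le_trans (Fcc G FG v l xl) _.
    apply: (@le_trans _ _ (`|c0| * Delta ^+ l)).
      by rewrite ler_wpM2r ?ler_norm// exprn_ge0 ?ltW.
    by rewrite ler_wpM2l// lerXn2r ?nnegrE ?ltW.
  exists (2 * K * c `^ q / th ^+ 2 + lambda / th ^+ N.+2) => l s t dif.
  rewrite mulrDl; have [lN|lN] := leqP l N.+2.
    apply: le_trans (triv _ v s t lG) _; apply: le_trans (small _ _ lN) _.
    by rewrite lerDr !mulr_ge0 ?powR_ge0 ?invr_ge0 ?exprn_ge0.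
  case: l dif lN => [|[|l2]] dif lN //; apply: le_trans (step _ v l2 s t c lG _ dif) _.
    by apply: hN; exact: ltnW.
  rewrite cancel2 lerDl.
  exact: (mulr_ge0 (divr_ge0 l_ge0 (exprn_ge0 _ th_ge0)) (exprn_ge0 _ th_ge0)).
- exists a, (2 * K * (`|c0| * Delta ^+ 2) `^ q / th ^+ 2 + lambda / th ^+ 2).
  move=> G FG fG v l s t al dif.
  have lG := lf _ fG.
  have {}FG : F G by case: FG => // /Finf[/(_ fG)].
  rewrite mulrDl; have [lN|lN] := leqP l 2.
    apply: le_trans (triv _ v s t lG) _; apply: le_trans (small _ _ lN) _.
    by rewrite lerDr !mulr_ge0 ?powR_ge0 ?invr_ge0 ?exprn_ge0.
  (* [step] works at level l - 2, while the walk count is assumed at l. As l - 2 >= 1, that level is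
     one term of the sum up to l; the factor [Delta ^+ 2] pays for the shift. *)
  case: l al dif lN => [|[|[|l2]]] al dif lN //; apply: le_trans (step _ v l2.+1 s t (`|c0| * Delta ^+ 2) lG _ dif) _.
    apply: (@le_trans _ _ (c0 * Delta ^+ l2.+3)).
      apply: le_trans (Fcc G FG v _ al); rewrite ler_nat.
      by rewrite 3?big_nat_recr//= -!addnA addnCA leq_addr.
    apply: (@le_trans _ _ (`|c0| * Delta ^+ l2.+3)).
      by rewrite ler_wpM2r ?ler_norm// exprn_ge0 ?ltW.
    rewrite -mulrA ler_wpM2l// -[l2.+3]/(2 + l2.+1)%N exprD.
    by rewrite ler_wpM2l ?exprn_ge0 ?(ltW D0)// lerXn2r ?nnegrE ?ltW.
  rewrite cancel2 lerDl.
  exact: (mulr_ge0 (divr_ge0 l_ge0 (exprn_ge0 _ th_ge0)) (exprn_ge0 _ th_ge0)).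
Qed.

(** * The approximation algorithm *)

Section Estimates.
Variable R : realType.

Lemma exprn_1D_le (x : R) (n : nat) : 0 <= x -> 2 * n%:R * x <= 1 ->
  (1 + x) ^+ n <= 1 + 2 * n%:R * x.
Proof.
move=> x0; elim: n => [|n IH]; first by rewrite expr0 mulr0 mul0r addr0.
have e : n.+1%:R = n%:R + 1 :> R by rewrite -natr1.
rewrite e exprSr => h.
have n0 : 0 <= n%:R :> R by [].
have h1 : (1 + x) ^+ n <= 1 + 2 * n%:R * x by apply: IH; nra.
apply: (@le_trans _ _ ((1 + 2 * n%:R * x) * (1 + x))).
  by rewrite ler_wpM2r// addr_ge0.
have : 2 * n%:R * x <= 1 by nra.
move: (n%:R) n0 h => m m0 h h2; nra.
Qed.

Lemma exprn_1B_ge (x : R) (n : nat) : 0 <= x <= 1 -> 1 - n%:R * x <= (1 - x) ^+ n.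
Proof.
move=> /andP[x0 x1]; elim: n => [|n IH]; first by rewrite expr0 mul0r subr0.
have e : n.+1%:R = n%:R + 1 :> R by rewrite -natr1.
rewrite exprSr e; have n0 : 0 <= n%:R :> R by [].
apply: (@le_trans _ _ ((1 - n%:R * x) * (1 - x))); first by nra.
by rewrite ler_wpM2r// subr_ge0.
Qed.

(** Since 1 + r >= 1, an additive error d in r is at most a relative error d in 1 + r. *)
Lemma prodr_ratio_bounds (I : eqType) (s : seq I) (r t : I -> R) (d : R) :
  0 <= d <= 1 -> (forall i, i \in s -> 0 <= r i /\ `|r i - t i| <= d) ->
  (1 - d) ^+ size s * \prod_(i <- s) (1 + r i) <= \prod_(i <- s) (1 + t i) <=
  (1 + d) ^+ size s * \prod_(i <- s) (1 + r i).
Proof.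
move=> /andP[d0 d1]; elim: s => [|i s IH] h; first by rewrite !big_nil !mulr1 lexx.
rewrite !big_cons /= !exprS.
have [|h1 h2] := andP (IH _); first by move=> j js; apply: h; rewrite inE js orbT.
have [r0 /ler_normlP[h3 h4]] := h i (mem_head _ _).
rewrite !(mulrACA _ (_ ^+ _)); apply/andP; split; apply: ler_pM => //.
- by rewrite mulr_ge0 ?subr_ge0 ?addr_ge0.
- rewrite big_seq mulr_ge0 ?exprn_ge0 ?subr_ge0// prodr_ge0// => j js.
  by rewrite addr_ge0// (h j _).1// inE js orbT.
- nra.
- nra.
- rewrite big_seq prodr_ge0// => j js.
  have [|rj /ler_normlP[_ h6]] := h j _; first by rewrite inE js orbT.
  lra.
- nra.
Qed.

Lemma hc_sum_activity (G : graph) (lam mu eta : R) (S : {fset G}) (n : nat) :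
  0 < lam -> 0 <= eta <= 1 -> lam * (1 - eta) <= mu <= lam * (1 + eta) ->
  (#|` S| <= n)%N ->
  (1 - eta) ^+ n * hc_sum lam S <= hc_sum mu S <= (1 + eta) ^+ n * hc_sum lam S.
Proof.
move=> l0 /andP[e0 e1] /andP[h1 h2] Sn.
have m0 : 0 <= lam * (1 - eta) by rewrite mulr_ge0 ?subr_ge0 ?(ltW l0).
have key (J : {fset G}) : J \in fpowerset S ->
    (1 - eta) ^+ n * lam ^+ #|` J| <= mu ^+ #|` J| <=
    (1 + eta) ^+ n * lam ^+ #|` J|.
  rewrite fpowersetE => /fsubset_leq_card JS.
  have Jn := leq_trans JS Sn; apply/andP; split.
    apply: (@le_trans _ _ ((lam * (1 - eta)) ^+ #|` J|)).
      rewrite exprMn mulrC ler_wpM2l ?exprn_ge0 ?(ltW l0)//.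
      by rewrite ler_wiXn2l ?subr_ge0// lerBlDr lerDl.
    by rewrite lerXn2r ?nnegrE// (le_trans m0).
  apply: (@le_trans _ _ ((lam * (1 + eta)) ^+ #|` J|)).
    by rewrite lerXn2r ?nnegrE ?(le_trans m0 h1)// (le_trans m0)// (le_trans h1).
  rewrite exprMn mulrC ler_wpM2r ?exprn_ge0 ?(ltW l0)//.
  by rewrite ler_weXn2l// lerDl.
rewrite /hc_sum !mulr_sumr; apply/andP; split.
  by rewrite big_seq_cond [leRHS]big_seq_cond; apply: ler_sum => J /andP[/key/andP[]].
by rewrite big_seq_cond [leRHS]big_seq_cond; apply: ler_sum => J /andP[/key/andP[]].
Qed.

(** Telescoping ends at the empty set, whose sum is 1. The product has the shape of a tree node with
    all of vs as neighbours, which is why the machine starts from a virtual root. *)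
Lemma hc_sum_prod_kids (G : graph) (lam : R) (vs : seq G) (S : {fset G}) :
  0 < lam -> {subset S <= vs} ->
  hc_sum lam S = \prod_(c <- kids vs S) (1 + hc_ratio lam c.1 c.2).
Proof.
move=> l0 sub; have := prod_kids_ratio l0 vs S.
rewrite (_ : [fset x in S | _]%fset = fset0); last first.
  by apply/fsetP => x; rewrite !inE /=; apply/negP => /andP[/sub ->].
have -> : hc_sum lam (fset0 : {fset G}) = 1.
  rewrite /hc_sum fpowerset0 big_mkcond big_seq_fset1 asboolT ?cardfs0 ?expr0//.
rewrite prodfV div1r => /(congr1 GRing.inv); rewrite !invrK => ->//.
Qed.

Lemma size_kids (G : graph) (vs : seq G) (S : {fset G}) :
  (size (kids vs S) <= size vs)%N.
Proof.
by elim: vs S => [//|x vs IH] S /=; case: ifP => _ /=; rewrite ?ltnS ?IH// leqW.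
Qed.

(** For z the exact Z, z1 its value at the rounded activity and z2 the output. The factor 8 keeps
    each of the two upper errors within 1 + eps / 4, and (1 + eps / 4)^2 <= 1 + eps. *)
Lemma two_step_approximation (eps d z z1 z2 : R) (n m : nat) :
  0 < eps <= 1 -> 0 <= d -> 8 * (n.+1)%:R * d <= eps -> (m <= n)%N -> 0 <= z ->
  (1 - d) ^+ n * z <= z1 <= (1 + d) ^+ n * z ->
  (1 - d) ^+ m * z1 <= z2 <= (1 + d) ^+ m * z1 ->
  (1 - eps) * z <= z2 <= (1 + eps) * z.
Proof.
move=> /andP[e0 e1] d0 de mn z0 /andP[a1 a2] /andP[b1 b2].
have nd k : (k <= n)%N -> k%:R * d <= eps / 8.
  move=> kn; rewrite ler_pdivlMr//; apply: le_trans de.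
  rewrite [leRHS]mulrAC [leRHS]mulrC -[leLHS]mulrA [d * 8]mulrC.
  by rewrite ler_wpM2r ?mulr_ge0// ler_nat leqW.
have d1 : d <= 1 by have := nd _ mn; have := ler0n R n; nra.
have dd : 0 <= d <= 1 by rewrite d0.
have up k : (k <= n)%N -> (1 + d) ^+ k <= 1 + eps / 4.
  move=> kn; have h := nd _ kn.
  apply: (le_trans (exprn_1D_le d0 _)); rewrite -mulrA; lra.
have dn k : (k <= n)%N -> 1 - eps / 8 <= (1 - d) ^+ k.
  by move=> kn; apply: le_trans (exprn_1B_ge k dd); have := nd _ kn; lra.
have z10 : (1 - eps / 8) * z <= z1.
  by apply: le_trans a1; rewrite ler_wpM2r ?dn.
have z11 : z1 <= (1 + eps / 4) * z.
  by apply: le_trans a2 _; rewrite ler_wpM2r ?up.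
have z1p : 0 <= z1 by apply: le_trans z10; rewrite mulr_ge0//; lra.
apply/andP; split.
  apply: le_trans b1; apply: (@le_trans _ _ ((1 - eps / 8) * z1)); last first.
    by rewrite ler_wpM2r ?dn.
  apply: (@le_trans _ _ ((1 - eps / 8) * ((1 - eps / 8) * z))); last first.
    by rewrite ler_wpM2l//; lra.
  by rewrite mulrA ler_wpM2r//; nra.
apply: (le_trans b2); apply: (@le_trans _ _ ((1 + eps / 4) * z1)).
  by rewrite ler_wpM2r ?up.
apply: (@le_trans _ _ ((1 + eps / 4) * ((1 + eps / 4) * z))).
  by rewrite ler_wpM2l//; lra.
by rewrite mulrA ler_wpM2r//; nra.
Qed.
End Estimates.

(** * Vertex sets as binary numbers *)

Section Bits.
Local Open Scope nat_scope.

Definition nat_bit (S x : nat) : bool := odd (S %/ 2 ^ x).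

(** Adding 2^x when bit x is clear causes no carry. *)
Lemma nat_bit_add S x y : ~~ nat_bit S x ->
  nat_bit (S + 2 ^ x) y = nat_bit S y || (y == x).
Proof.
rewrite /nat_bit => nx; case: (ltngtP y x) => [yx|xy|->].
- rewrite orbF -(subnK (ltnW yx)) expnD divnDMl ?expn_gt0// oddD oddX.
  by rewrite -[x - y == 0]negbK -lt0n subn_gt0 yx addbF.
- rewrite orbF -(subnK (ltnW xy)) expnD [2 ^ (y - x) * _]mulnC !divnMA.
  rewrite -[X in S + X]mul1n divnDMl ?expn_gt0//.
  have : 0 < y - x by rewrite subn_gt0.
  case: (y - x) => [//|k] _; rewrite expnS !divnMA; congr (odd (_ %/ _)).
  have := odd_double_half (S %/ 2 ^ x); rewrite (negbTE nx) add0n => <-.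
  by rewrite -muln2 addnC divnDMl// mulnK.
- by rewrite orbT -[X in S + X]mul1n divnDMl ?expn_gt0// oddD (negbTE nx).
Qed.
End Bits.

Section TreeSize.
Variables (G : graph) (nb : G -> seq G).

Fixpoint saw_tree_size (r : nat) (v : G) (S : {fset G}) : nat :=
  if r is r'.+1 then
    (\sum_(c <- kids (nb v) (S `\ v)%fset) saw_tree_size r' c.1 c.2).+1
  else 0.

Lemma saw_tree_sizeE r v S :
  saw_tree_size r v S = (\sum_(i < r) size (saw_tree_level nb i v S))%N.
Proof.
elim: r v S => [|r IH] v S; first by rewrite big_ord0.
rewrite big_ord_recl /= -add1n; congr addn.
under [RHS]eq_bigr do rewrite /bump /= size_saw_tree_level.
by rewrite exchange_big /=; apply: eq_bigr => c _; rewrite IH.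
Qed.
End TreeSize.

Record frame := Frame {
  fr_vertex : nat ; fr_removed : nat ; fr_next : nat ; fr_num : nat ; fr_den : nat
}.

(* Depth-first evaluation of the truncated recursion, as an abstract machine
   whose configurations are stacks of frames, topmost first. The bottom frame
   stands for a virtual vertex adjacent to all others; the vertex sets are
   given by the bits of their complements. The activity is [a / P]. *)
Section Machine.
Local Open Scope nat_scope.
Variables (n l a P : nat) (E : nat -> nat -> bool).

Definition pushes (f : frame) (d : nat) : bool :=
  [&& d < l, ~~ nat_bit (fr_removed f) (fr_next f) &
      (d == 0) || E (fr_vertex f) (fr_next f)].

(** A push removes x both for the child, whose recursion excludes itself, and for the later
    siblings. A pop multiplies the parent by 1 / (1 + p / q) = q / (p + q); fractions are never
    reduced. *)
Definition mstep (c : seq frame) : seq frame :=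
  if c is f :: fs then
    let: Frame v s x p q := f in
    if x < n then
      if pushes f (size fs) then
        Frame x (s + 2 ^ x) 0 a P :: Frame v (s + 2 ^ x) x.+1 p q :: fs
      else Frame v s x.+1 p q :: fs
    else if fs is Frame v' s' x' p' q' :: fs' then
      Frame v' s' x' (p' * q) (q' * (p + q)) :: fs'
    else c
  else c.

(** The bound on the removed set is crude: a step adds at most 2^n. The vertex must be below n only
    while candidates remain, because for n = 0 the virtual root still has vertex 0. *)
Definition frame_ok (i : nat) (f : frame) : bool :=
  [&& 0 < fr_num f, 0 < fr_den f, fr_next f <= n,
      (fr_next f < n) ==> (fr_vertex f < n), fr_vertex f <= n &
      fr_removed f <= i * 2 ^ n].

Definition weight (c : seq frame) : nat := \prod_(f <- c) (fr_num f + fr_den f).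

Definition config_ok (i : nat) (c : seq frame) : bool :=
  [&& 0 < size c, size c <= l.+1, all (frame_ok i) c & weight c <= 2 * (a + P) ^ i].

Hypotheses (a_gt0 : 0 < a) (P_gt0 : 0 < P).

(* A pop does not increase the product of the [num + den], a push multiplies
   it by [a + P]. *)
Lemma config_ok_step i c : config_ok i c -> config_ok i.+1 (mstep c).
Proof.
case: c => [//|[v s x p q] fs] /and4P[_ sz /= /andP[ok oks] w].
have aP : 0 < a + P by rewrite addn_gt0 a_gt0.
have weak f : frame_ok i f -> frame_ok i.+1 f.
  case/and5P=> h1 h2 h3 h4 /andP[h5 h6]; rewrite /frame_ok h1 h2 h3 h4 h5 /=.
  by rewrite (leq_trans h6)// leq_mul2r leqnSn orbT.
have oks' : all (frame_ok i.+1) fs by apply: sub_all oks.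
have wle c' : weight c' <= weight (Frame v s x p q :: fs) * (a + P) ->
    weight c' <= 2 * (a + P) ^ i.+1.
  by move=> h; rewrite expnSr mulnA (leq_trans h)// leq_mul2r w orbT.
have wle1 c' : weight c' <= weight (Frame v s x p q :: fs) ->
    weight c' <= 2 * (a + P) ^ i.+1.
  by move=> h; apply: wle; rewrite (leq_trans h)// leq_pmulr.
case/and5P: (ok) => /= p0 q0 xn /implyP xv /andP[vn si].
have adv s' : s' <= i.+1 * 2 ^ n -> x < n -> frame_ok i.+1 (Frame v s' x.+1 p q).
  move=> s'i xn'; rewrite /frame_ok /= p0 q0 xn' vn s'i /= andbT.
  by apply/implyP => _; exact: xv.
have s1 : s <= i.+1 * 2 ^ n by rewrite (leq_trans si)// leq_mul2r leqnSn orbT.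
case: ifP => xn'; last first.
  case: fs sz oks oks' w wle wle1 => [|[v' s' x' p' q'] fs] /=.
    move=> sz _ _ w wle wle1; rewrite /config_ok /= weak//.
    by apply: wle1.
  move=> sz _ /andP[ok' oks'] w wle wle1; rewrite /config_ok /= (ltnW sz) oks' /= andbT.
  case/and5P: ok' => /= p'0 q'0 h3 h4 h5; rewrite /frame_ok /= !muln_gt0 p'0 q'0 q0 h3 h4 h5.
  rewrite addn_gt0 p0 /=; apply: wle1; rewrite /weight !big_cons /= mulnA leq_mul2r.
  by apply/orP; right; nia.
case: ifP => pu; last first.
  by rewrite /config_ok /= sz adv//= oks' /=; apply: wle1; rewrite /weight !big_cons.
have sn : s + 2 ^ x <= i.+1 * 2 ^ n.
  by rewrite mulSn addnC leq_add// leq_exp2l// ltnW.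
rewrite /config_ok /= adv//= oks' /=; case/and3P: pu => dl _ _; rewrite ltnS dl /=.
rewrite {1}/frame_ok /= a_gt0 P_gt0 xn' (ltnW xn') sn implybT /=.
by apply: wle; rewrite /weight !big_cons /= mulnC.
Qed.

Lemma config_ok_weight i f fs : config_ok i (f :: fs) ->
  fr_num f + fr_den f <= 2 * (a + P) ^ i.
Proof.
case/and4P=> _ _ /= /andP[_ oks] w; apply: leq_trans w.
rewrite /weight big_cons leq_pmulr//.
elim: fs oks => [|h fs IH] /=; first by rewrite big_nil.
by move=> /andP[/and5P[h1 _ _ _ _] /IH]; rewrite big_cons muln_gt0 addn_gt0 h1.
Qed.
End Machine.

(** * Correctness and step count of the abstract machine *)

Section DepthFirst.
Variables (R : realType) (G : graph) (n : nat) (f : 'I_n -> G) (g : G -> 'I_n).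
Hypotheses (fK : cancel f g) (gK : cancel g f) (finG : finite_graph G).
Variables (l a P : nat).
Hypotheses (a_gt0 : (0 < a)%N) (P_gt0 : (0 < P)%N).
Let lam : R := a%:R / P%:R.

Definition label_adj (v x : nat) : bool :=
  if (insub v, insub x) is (Some i, Some j) then adj (f i) (f j) else false.

Lemma label_adjE (i j : 'I_n) : label_adj i j = adj (f i) (f j).
Proof. by rewrite /label_adj !valK. Qed.

Definition label_nbs (v : G) : seq G := [seq f i | i <- enum 'I_n & adj v (f i)].

Lemma mem_label_nbs v x : (x \in label_nbs v) = adj v x.
Proof.
apply/mapP/idP => [[i]|vx]; first by rewrite mem_filter => /andP[vi _] ->.
exists (g x); last by rewrite gK.
by rewrite mem_filter gK vx mem_enum.
Qed.

Definition later_vertices (p : pred G) (x : nat) : seq G :=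
  [seq f i | i <- drop x (enum 'I_n) & p (f i)].

Lemma later_verticesS p (i : 'I_n) : later_vertices p i =
  if p (f i) then f i :: later_vertices p i.+1 else later_vertices p i.+1.
Proof.
rewrite /later_vertices (drop_nth i) ?size_enum_ord// nth_ord_enum /=.
by case: ifP.
Qed.

Lemma later_vertices_end p : later_vertices p n = [::].
Proof. by rewrite /later_vertices drop_oversize// size_enum_ord. Qed.

Definition remaining (s : nat) : {fset G} :=
  [fset u in vertices G | ~~ nat_bit s (g u)]%fset.

Lemma mem_remaining s u : (u \in remaining s) = ~~ nat_bit s (g u).
Proof. by rewrite !inE /= in_fset_set// in_setT. Qed.

Lemma remaining_add s (i : 'I_n) : ~~ nat_bit s i ->
  remaining (s + 2 ^ i) = (remaining s `\ f i)%fset.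
Proof.
move=> si; apply/fsetP => u; rewrite in_fsetD1 !mem_remaining nat_bit_add//.
rewrite negb_or andbC; congr (~~ _ && _); apply/eqP/eqP => [e|->]; last by rewrite fK.
by rewrite -[u]gK; congr f; apply: val_inj.
Qed.

Local Notation step := (mstep n l a P label_adj).

(** Nested induction on the remaining depth r and on the number n - x of candidates left; [adjp]
    treats the virtual root and ordinary frames alike. A tree node costs n + 1 steps: its n
    candidates and its pop. *)
Lemma depth_first (r v s x p q : nat) (fs : seq frame) (adjp : pred G) :
  (size fs + r = l)%N ->
  (forall i : 'I_n, (size fs == 0)%N || label_adj v i = adjp (f i)) ->
  (x <= n)%N -> (0 < p)%N -> (0 < q)%N ->
  exists K s' p' q', [/\ iter K step (Frame v s x p q :: fs) = Frame v s' n p' q' :: fs,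
    (0 < p')%N, (0 < q')%N,
    p'%:R / q'%:R = p%:R / q%:R *
      \prod_(c <- kids (later_vertices adjp x) (remaining s))
        (1 + trunc_ratio lam label_nbs r c.1 c.2)^-1 :> R &
    (K <= n - x + n.+1 * \sum_(c <- kids (later_vertices adjp x) (remaining s))
                           saw_tree_size label_nbs r c.1 c.2)%N].
Proof.
elim: r v s x p q fs adjp => [|r IH] v s x p q fs adjp sz adjE xn p0 q0.
  have -> : \prod_(c <- kids (later_vertices adjp x) (remaining s))
      (1 + trunc_ratio lam label_nbs 0 c.1 c.2)^-1 = 1 :> R.
    by rewrite big1// => c _; rewrite /= addr0 invr1.
  rewrite mulr1 big1// muln0 addn0.
  suff : forall k x, (n - x = k)%N -> (x <= n)%N ->
    iter k step (Frame v s x p q :: fs) = Frame v s n p q :: fs.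
    by move=> /(_ _ _ erefl xn) h; exists (n - x)%N, s, p, q.
  have nl : (size fs < l)%N = false by rewrite -sz addn0 ltnn.
  elim=> [|k IHk] y.
    by move=> /eqP; rewrite subn_eq0 => h1 h2; rewrite (@anti_leq y n)//= h1 h2.
  move=> h yn; have yn' : (y < n)%N by rewrite -subn_gt0 h.
  rewrite iterSr /= yn' /pushes nl /=; apply: IHk => //.
  by rewrite subnS h.
have [k] := ubnP (n - x); elim: k x s p q xn p0 q0 => [//|k IHk] x s p q xn p0 q0 kn.
move: xn; rewrite leq_eqVlt => /predU1P[->|xn].
  exists 0%N, s, p, q; rewrite later_vertices_end /= !big_nil mulr1.
  by split.
pose i := Ordinal xn; have nx : (n - x = (n - x.+1).+1)%N by rewrite subnS prednK ?subn_gt0.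
have [pu|npu] := boolP (pushes l label_adj (Frame v s x p q) (size fs)); last first.
  have [|K [s' [p' [q' [e p'0 q'0 val bnd]]]]] := IHk x.+1 s p q xn p0 q0.
    by move: kn; rewrite nx ltnS.
  exists K.+1, s', p', q'.
  have same : kids (later_vertices adjp x) (remaining s) =
      kids (later_vertices adjp x.+1) (remaining s).
    rewrite (later_verticesS _ i) /=; case: ifP => // ai /=.
    rewrite mem_remaining fK /=; case: ifP => // nb.
    move/negP: npu; case; rewrite /pushes /= nb -sz -addSnnS leq_addr /=.
    by rewrite (adjE i) ai.
  split=> //; last 2 first.
  - by rewrite same.
  - by rewrite same nx addSn ltnS.
  by rewrite iterSr /= xn (negbTE npu).
have [_ nb ai] := and3P pu; rewrite /= in nb ai.
rewrite (adjE i) in ai.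
have rem := remaining_add (i := i) nb.
have [||//|//|//|K1 [s1 [p1 [q1 [e1 p10 q10 val1 bnd1]]]]] :=
  IH x (s + 2 ^ x)%N 0%N a P (Frame v (s + 2 ^ x) x.+1 p q :: fs) (adj (f i)).
- by rewrite /= addSnnS.
- by move=> j /=; rewrite (label_adjE i j).
have p20 : (0 < p * q1)%N by rewrite muln_gt0 p0.
have q20 : (0 < q * (p1 + q1))%N by rewrite muln_gt0 q0 addn_gt0 p10.
have [|K2 [s2 [p2 [q2 [e2 p2g q2g val2 bnd2]]]]] :=
  IHk x.+1 (s + 2 ^ x)%N (p * q1)%N (q * (p1 + q1))%N xn p20 q20.
  by move: kn; rewrite nx ltnS.
(* Read from right to left: the push, the run of the child, its pop, the remaining candidates. *)
exists (K2 + (1 + (K1 + 1)))%N, s2, p2, q2.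
have kE : kids (later_vertices adjp x) (remaining s) =
    (f i, remaining s) :: kids (later_vertices adjp x.+1) (remaining (s + 2 ^ x)).
  by rewrite (later_verticesS _ i) ai /= mem_remaining fK nb rem.
have lv0 : later_vertices (adj (f i)) 0 = label_nbs (f i).
  by rewrite /later_vertices drop0.
have v1 : p1%:R / q1%:R = trunc_ratio lam label_nbs r.+1 (f i) (remaining s) :> R.
  by rewrite val1 lv0 rem.
split=> //.
- by rewrite !iterD /= xn pu e1 /= ltnn e2.
- rewrite val2 kE big_cons [(f i, _).1]/= [(f i, _).2]/= -v1 mulrA; congr (_ * _).
  rewrite !natrM natrD; field.
  by rewrite -!natrD !pnatr_eq0 -!lt0n addn_gt0 q10 q0.
- rewrite kE big_cons [(f i, _).1]/= [(f i, _).2]/= [saw_tree_size _ r.+1 _ _]/=.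
  rewrite -rem -lv0; move: bnd1 bnd2; rewrite nx subn0.
  set A := (\sum_(c <- _) _)%N; set B := (\sum_(c <- _) _)%N.
  by move=> h1 h2; rewrite mulnDr mulnS; lia.
Qed.
End DepthFirst.

(** * Cost of loop-free commands and of loops *)

Section StraightLine.
Local Open Scope nat_scope.
Implicit Types act acc : nat -> nat.

Fixpoint oracle_free (e : expr) : bool :=
  match e with
  | EConst _ => true
  | EMem e1 => oracle_free e1
  | EAdd e1 e2 | ESub e1 e2 | EMul e1 e2 | EDiv e1 e2 | ELt e1 e2 =>
      oracle_free e1 && oracle_free e2
  | EActivity _ | EAccuracy _ => false
  end.

Fixpoint straight (c : cmd) : bool :=
  match c with
  | CSkip => true
  | CStore e1 e2 => oracle_free e1 && oracle_free e2
  | CSeq c1 c2 => straight c1 && straight c2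
  | CIf e c1 c2 => [&& oracle_free e, straight c1 & straight c2]
  | CWhile _ _ => false
  end.

(* Only meaningful on [straight] commands: loops are skipped. *)
Fixpoint crun act acc (c : cmd) (m : memory) : memory :=
  match c with
  | CSkip => m
  | CStore e1 e2 => update m (Defs.eval act acc m e1) (Defs.eval act acc m e2)
  | CSeq c1 c2 => crun act acc c2 (crun act acc c1 m)
  | CIf e c1 c2 => if Defs.eval act acc m e != 0 then crun act acc c1 m else crun act acc c2 m
  | CWhile _ _ => m
  end.

Lemma bitlen_le x k : 0 < k -> x < 2 ^ k -> bitlen x <= k.
Proof.
move=> k0 xk; rewrite /bitlen; case: x xk => [|x] xk; first by rewrite trunc_log0.
by rewrite -(@ltn_exp2l 2)// (leq_ltn_trans (trunc_logP _ _)).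
Qed.

Definition mem_lt (M : nat) (m : memory) : Prop := forall b, m b < M.

Lemma update_lt M m b x : mem_lt M m -> x < M -> mem_lt M (update m b x).
Proof. by move=> mM xM b'; rewrite /update; case: ifP. Qed.

(** B bounds the bit length of every cell. A fixed expression performs boundedly many operations,
    each at most adding bit lengths up to a constant, so value length and cost are linear in B. *)
Definition eval_within (K : nat) (e : expr) : Prop :=
  forall act acc m B, 0 < B -> mem_lt (2 ^ B) m ->
    Defs.eval act acc m e < 2 ^ (K * B) /\ eval_cost act acc m e <= K * B.

Lemma eval_bound e : oracle_free e -> exists2 K, 0 < K & eval_within K e.
Proof.
have mono K K' B : K <= K' -> 2 ^ (K * B) <= 2 ^ (K' * B).
  by move=> h; rewrite leq_exp2l// leq_mul2r h orbT.
(* The bound x y + x + y + 1 on the value serves all five binary operations at once. *)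
have bin op e1 e2 :
    (forall act acc m, Defs.eval act acc m (op e1 e2) <=
      Defs.eval act acc m e1 * Defs.eval act acc m e2 +
      Defs.eval act acc m e1 + Defs.eval act acc m e2 + 1) ->
    (forall act acc m, eval_cost act acc m (op e1 e2) =
      bitlen (Defs.eval act acc m (op e1 e2)) +
      (eval_cost act acc m e1 + eval_cost act acc m e2)) ->
    (exists2 K, 0 < K & eval_within K e1) ->
    (exists2 K, 0 < K & eval_within K e2) ->
    exists2 K, 0 < K & eval_within K (op e1 e2).
  move=> hv hc [K1 K10 h1] [K2 K20 h2]; exists ((K1 + K2 + 1) + (K1 + K2)); first by lia.
  move=> act acc m B B0 mB; have [v1 c1] := h1 act acc m B B0 mB; have [v2 c2] := h2 act acc m B B0 mB.
  have v : Defs.eval act acc m (op e1 e2) < 2 ^ ((K1 + K2 + 1) * B).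
    apply: (@leq_trans (2 ^ (K1 * B + K2 * B + 1))); last first.
      by rewrite leq_exp2l// !mulnDl mul1n leq_add2l.
    rewrite !expnD; move: v1 v2 (hv act acc m).
    set x := Defs.eval act acc m e1; set y := Defs.eval act acc m e2; set X := 2 ^ _; set Y := 2 ^ _.
    by move: (Defs.eval act acc m (op e1 e2)) x y X Y; clear; nia.
  split; first by rewrite (leq_trans v)// mono// leq_addr.
  rewrite hc mulnDl leq_add//; first by apply: bitlen_le => //; rewrite muln_gt0 B0; lia.
  by rewrite mulnDl leq_add.
elim: e => [k|e1 IH1|e1 IH1 e2 IH2|e1 IH1 e2 IH2|e1 IH1 e2 IH2|e1 IH1 e2 IH2
  |e1 IH1 e2 IH2|e1 IH1|e1 IH1] //=.
- move=> _; exists k.+1 => // act acc m B B0 mB.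
  have h : k < 2 ^ (k.+1 * B).
    apply: leq_trans (ltn_expl k (isT : 1 < 2)) _.
    by rewrite leq_exp2l// (leq_trans (leqnSn k))// leq_pmulr.
  by split=> //=; rewrite addn0; apply: bitlen_le => //; rewrite muln_gt0.
- move=> /IH1[K K0 h]; exists K.+1 => // act acc m B B0 mB; have [v c] := h act acc m B B0 mB.
  split; first by rewrite /= (leq_trans (mB _))// leq_exp2l// mulSn leq_addr.
  by rewrite /= mulSn leq_add// bitlen_le.
- by move=> /andP[/IH1 h1 /IH2 h2]; apply: (bin EAdd) => //= act acc m; lia.
- by move=> /andP[/IH1 h1 /IH2 h2]; apply: (bin ESub) => //= act acc m; lia.
- by move=> /andP[/IH1 h1 /IH2 h2]; apply: (bin EMul) => //= act acc m; lia.
- move=> /andP[/IH1 h1 /IH2 h2]; apply: (bin EDiv) => //= act acc m.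
  by have := leq_div (Defs.eval act acc m e1) (Defs.eval act acc m e2); lia.
- by move=> /andP[/IH1 h1 /IH2 h2]; apply: (bin ELt) => //= act acc m; case: (_ < _); lia.
Qed.

(** Constants multiply under sequencing, which is harmless for a fixed command. The memory bound
    does not iterate, however, so loops need an invariant with B fixed. *)
Lemma exec_straight c : straight c -> exists2 K, 0 < K & forall act acc m B, 0 < B ->
  mem_lt (2 ^ B) m -> mem_lt (2 ^ (K * B)) (crun act acc c m) /\
  exists2 t, t <= K * B & exec act acc c m (crun act acc c m) t.
Proof.
have monom K K' B m : K <= K' -> mem_lt (2 ^ (K * B)) m -> mem_lt (2 ^ (K' * B)) m.
  by move=> h mK b; rewrite (leq_trans (mK b))// leq_exp2l// leq_mul2r h orbT.
elim: c => [|e1 e2|c1 IH1 c2 IH2|e c1 IH1 c2 IH2|e c IH] //=.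
- move=> _; exists 1 => // act acc m B B0 mB; rewrite mul1n; split=> //.
  by exists 1 => //; constructor.
- move=> /andP[/eval_bound[K1 K10 h1] /eval_bound[K2 K20 h2]].
  exists (1 + K1 + K2) => // act acc m B B0 mB; have [v1 c1] := h1 act acc m B B0 mB.
  have [v2 c2] := h2 act acc m B B0 mB; split.
    apply: update_lt; first by apply: (@monom 1); rewrite ?mul1n// -addnA leq_addr.
    by rewrite (leq_trans v2)// leq_exp2l// leq_mul2r leq_addl orbT.
  exists (1 + eval_cost act acc m e1 + eval_cost act acc m e2); last exact: ExecStore.
  by rewrite !mulnDl !leq_add// mul1n.
- move=> /andP[/IH1[K1 K10 h1] /IH2[K2 K20 h2]]; exists (K1 + K2 * K1); first by lia.
  move=> act acc m B B0 mB; have [m1 [t1 t1K e1]] := h1 act acc m B B0 mB.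
  have B10 : 0 < K1 * B by rewrite muln_gt0 K10.
  have [m2 [t2 t2K e2]] := h2 act acc _ _ B10 m1; split.
    by move: m2; rewrite mulnA; apply: monom; rewrite leq_addl.
  exists (t1 + t2); last exact: ExecSeq e1 e2.
  by rewrite mulnDl leq_add// -mulnA.
- move=> /and3P[/eval_bound[K0 K00 h0] /IH1[K1 K10 h1] /IH2[K2 K20 h2]].
  exists (1 + K0 + K1 + K2) => // act acc m B B0 mB; have [v0 c0] := h0 act acc m B B0 mB.
  have [m1 [t1 t1K e1]] := h1 act acc m B B0 mB; have [m2 [t2 t2K e2]] := h2 act acc m B B0 mB.
  case: ifPn => ne.
    split; first by apply: monom m1; lia.
    exists (1 + eval_cost act acc m e + t1); last exact: ExecIfTrue.
    rewrite !mulnDl mul1n; lia.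
  split; first by apply: monom m2; lia.
  exists (1 + eval_cost act acc m e + t2); last by apply: ExecIfFalse => //; apply/eqP; rewrite -[_ == _]negbK.
  rewrite !mulnDl mul1n; lia.
Qed.

Lemma exec_while act acc (I : nat -> memory -> Prop) (K T : nat) e c m :
  (forall i m, i < K -> I i m -> Defs.eval act acc m e != 0 /\ exists m' t,
     [/\ exec act acc c m m' t, 1 + eval_cost act acc m e + t <= T & I i.+1 m']) ->
  (forall m, I K m -> Defs.eval act acc m e = 0 /\ 1 + eval_cost act acc m e <= T) ->
  I 0 m -> exists m' t, [/\ exec act acc (CWhile e c) m m' t, t <= K.+1 * T & I K m'].
Proof.
move=> step fin I0.
suff h : forall k i m, i + k = K -> I i m -> exists m' t,
    [/\ exec act acc (CWhile e c) m m' t, t <= k.+1 * T & I K m'].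
  exact: (h K 0 m).
elim=> [|k IH] i m1 ik I1.
  rewrite addn0 in ik; subst i; have [e0 tT] := fin _ I1.
  by exists m1, (1 + eval_cost act acc m1 e); split; [exact: ExecWhileFalse|rewrite mul1n|].
have iK : i < K by lia.
have [ne [m2 [t2 [ex2 t2T I2]]]] := step i m1 iK I1.
have [|m3 [t3 [ex3 t3T I3]]] := IH i.+1 m2 _ I2; first by lia.
exists m3, (1 + eval_cost act acc m1 e + t2 + t3); split=> //; first exact: ExecWhileTrue ex2 ex3.
by rewrite mulSn leq_add.
Qed.
End StraightLine.

(** * The program and its simulation of the machine *)

Section Program.
Local Open Scope nat_scope.
Local Arguments Defs.eval : simpl never.
Local Arguments eval_cost : simpl never.
Local Arguments crun : simpl never.
Local Arguments update : simpl never.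

Definition eN := EMem (EConst 0).
(** The input fills cells 0 to n n, so working memory starts right after it; its base is recomputed
    from cell 0 at each access. *)
Definition eadr i := EAdd (EMul eN eN) (EConst i).
Definition ereg i := EMem (eadr i).
Definition efr i := EAdd (eadr i) (EMul (EConst 8) (ereg 2)).
Definition eF i := EMem (efr i).
Definition cseq := foldr CSeq CSkip.

(* Register 2 holds the depth [d], registers 3, 4, 5 hold the truncation level
   and the numerator and denominator of the activity. The six fields of the
   frame of depth [d] are at offsets [16 + 8 d], ..., [21 + 8 d] from [n * n]:
   vertex, removed set, next candidate [x], [2 ^ x], numerator, denominator. *)
Definition bit_expr :=
  let q := EDiv (eF 17) (eF 19) in ESub q (EMul (EConst 2) (EDiv q (EConst 2))).

Definition push_expr :=
  EMul (EMul (ELt (ereg 2) (ereg 3)) (ELt bit_expr (EConst 1)))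
    (EAdd (ELt (ereg 2) (EConst 1))
       (EMem (EAdd (EAdd (EConst 1) (EMul (eF 16) eN)) (eF 18)))).

(** Fields 24 to 29 are fields 16 to 21 of the next frame. The depth is raised last, since all
    addresses are relative to it. *)
Definition push_cmd := cseq
  [:: CStore (efr 24) (eF 18);
      CStore (efr 25) (EAdd (eF 17) (eF 19));
      CStore (efr 26) (EConst 0);
      CStore (efr 27) (EConst 1);
      CStore (efr 28) (ereg 4);
      CStore (efr 29) (ereg 5);
      CStore (efr 17) (EAdd (eF 17) (eF 19));
      CStore (efr 19) (EMul (EConst 2) (eF 19));
      CStore (efr 18) (EAdd (eF 18) (EConst 1));
      CStore (eadr 2) (EAdd (ereg 2) (EConst 1))].

Definition advance_cmd := cseq
  [:: CStore (efr 19) (EMul (EConst 2) (eF 19));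
      CStore (efr 18) (EAdd (eF 18) (EConst 1))].

(** Fields 12 and 13 are the numerator and denominator of the frame below. *)
Definition pop_cmd := cseq
  [:: CStore (efr 12) (EMul (eF 12) (eF 21));
      CStore (efr 13) (EMul (eF 13) (EAdd (eF 20) (eF 21)));
      CStore (eadr 2) (ESub (ereg 2) (EConst 1))].

Definition body_cmd :=
  CIf (ELt (eF 18) eN) (CIf push_expr push_cmd advance_cmd) pop_cmd.

(** By truncated subtraction, zero exactly when the bottom frame is on top and has no candidate
    left. *)
Definition guard_expr := EAdd (ereg 2) (ESub eN (eF 18)).

Definition scale_expr (A0 : nat) :=
  EMul (EConst A0) (EMul (EAdd eN (EConst 1)) (ereg 7)).

Fixpoint epow e k := if k is k'.+1 then EMul e (epow e k') else EConst 1.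

(** Finds the first k with acc k >= 2, so that 2^k is 1 / eps up to a constant; registers 6 and 7
    hold k and 2^k. *)
Definition accuracy_loop :=
  CWhile (ELt (EAccuracy (ereg 6)) (EConst 2))
    (cseq [:: CStore (eadr 6) (EAdd (ereg 6) (EConst 1));
              CStore (eadr 7) (EMul (EConst 2) (ereg 7))]).

(** Finds the least l with 2^l at least register 8; l is both the truncation level and the precision
    of the activity. *)
Definition level_loop :=
  CWhile (ELt (ereg 5) (ereg 8))
    (cseq [:: CStore (eadr 5) (EMul (EConst 2) (ereg 5));
              CStore (eadr 3) (EAdd (ereg 3) (EConst 1))]).

(** The root accumulates the inverses 1 / (1 + R), so its denominator, at offset 21, becomes the
    numerator of the output. Cell 0 is overwritten last because addresses are computed from it. *)
Definition fptas_program (A0 A : nat) := cseq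
  [:: CStore (eadr 7) (EConst 1);
      accuracy_loop;
      cseq [:: CStore (eadr 8) (epow (scale_expr A0) A); CStore (eadr 5) (EConst 1)];
      level_loop;
      CStore (eadr 4) (EActivity (ereg 3));
      cseq [:: CStore (eadr 19) (EConst 1); CStore (eadr 20) (EConst 1);
               CStore (eadr 21) (EConst 1)];
      CWhile guard_expr body_cmd;
      cseq [:: CStore (EConst 1) (ereg 20); CStore (EConst 0) (ereg 21)]].

Section Layout.
Variables (act acc : nat -> nat) (n : nat) (inp : memory).
Hypothesis inp0 : inp 0 = n.
Local Notation ev := (Defs.eval act acc).
Local Notation run := (crun act acc).

Definition lay (g : memory) : memory :=
  fun b => if b <= n * n then inp b else g (b - n * n).

Lemma lay_off g o : 0 < o -> lay g (n * n + o) = g o.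
Proof. by move=> o0; rewrite /lay -{2}[n * n]addn0 leq_add2l leqNgt o0 addKn. Qed.

Lemma lay_store g o x : 0 < o -> update (lay g) (n * n + o) x = lay (update g o x).
Proof.
move=> o0; apply/funext => b; rewrite /update /lay.
case: eqP => [->|ne].
  by rewrite addKn eqxx -{2}[n * n]addn0 leq_add2l leqNgt o0.
case: leqP => // nb; case: eqP => // e; case: ne; rewrite -e; lia.
Qed.

Lemma ev_N g : ev (lay g) eN = n. Proof. by rewrite -[LHS]/(lay g 0) /lay inp0. Qed.

Lemma ev_adr g i : ev (lay g) (eadr i) = n * n + i.
Proof. by rewrite /eadr -[LHS]/(ev (lay g) eN * ev (lay g) eN + i) ev_N. Qed.

Lemma ev_reg g i : 0 < i -> ev (lay g) (ereg i) = g i.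
Proof.
by move=> i0; rewrite /ereg -[LHS]/(lay g (ev (lay g) (eadr i))) ev_adr lay_off.
Qed.

Definition fget i (g : memory) := g (i + 8 * g 2).
Definition fput i x (g : memory) := update g (i + 8 * g 2) x.

Lemma ev_efr g i : ev (lay g) (efr i) = n * n + (i + 8 * g 2).
Proof.
rewrite /efr -[LHS]/(ev (lay g) (eadr i) + 8 * ev (lay g) (ereg 2)).
by rewrite ev_adr ev_reg// addnA.
Qed.

Lemma ev_eF g i : 0 < i -> ev (lay g) (eF i) = fget i g.
Proof.
move=> i0; rewrite /eF -[LHS]/(lay g (ev (lay g) (efr i))) ev_efr lay_off//.
by rewrite addn_gt0 i0.
Qed.

Lemma run_fr g i e : 0 < i ->
  run (CStore (efr i) e) (lay g) = lay (fput i (ev (lay g) e) g).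
Proof.
move=> i0; rewrite -[LHS]/(update (lay g) (ev (lay g) (efr i)) (ev (lay g) e)).
by rewrite ev_efr lay_store// addn_gt0 i0.
Qed.

Lemma run_reg g i e : 0 < i ->
  run (CStore (eadr i) e) (lay g) = lay (update g i (ev (lay g) e)).
Proof.
move=> i0; rewrite -[LHS]/(update (lay g) (ev (lay g) (eadr i)) (ev (lay g) e)).
by rewrite ev_adr lay_store.
Qed.

Lemma run_cons c cs m : run (cseq (c :: cs)) m = run (cseq cs) (run c m).
Proof. by []. Qed.

Lemma run_nil m : run (cseq [::]) m = m.
Proof. by []. Qed.

Lemma fget_put i j x g : 2 < j ->
  fget i (fput j x g) = if i == j then x else fget i g.
Proof.
move=> j2; rewrite /fget /fput /update.
have -> : (2 == j + 8 * g 2) = false by apply/eqP; lia.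
by rewrite eqn_add2r.
Qed.

Lemma fput_other j x g o : o != j + 8 * g 2 -> fput j x g o = g o.
Proof. by rewrite /fput /update => /negbTE ->. Qed.

Lemma fput_reg j x g o : o < j -> fput j x g o = g o.
Proof. by move=> oj; apply: fput_other; apply/eqP; lia. Qed.

Lemma fput_lt M j x g : mem_lt M g -> x < M -> mem_lt M (fput j x g).
Proof. by move=> gM xM; exact: update_lt. Qed.

Section Simulation.
Variables (l a P : nat) (E : nat -> nat -> bool).
Hypotheses (a_gt0 : 0 < a) (P_gt0 : 0 < P).
Hypothesis inpE : forall v x, v < n -> x < n -> inp (1 + v * n + x) = E v x.

(** [2 ^ fr_next f] is kept in a cell because the language has no exponentiation; the removed set is
    tested and updated through it. *)
Definition has_frame (g : memory) (k : nat) (f : frame) : Prop :=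
  [/\ g (16 + 8 * k) = fr_vertex f, g (17 + 8 * k) = fr_removed f,
      g (18 + 8 * k) = fr_next f, g (19 + 8 * k) = 2 ^ fr_next f
    & g (20 + 8 * k) = fr_num f /\ g (21 + 8 * k) = fr_den f].

Fixpoint has_stack (g : memory) (c : seq frame) : Prop :=
  if c is f :: fs then has_frame g (size fs) f /\ has_stack g fs else True.

Definition represents (c : seq frame) (g : memory) : Prop :=
  [/\ g 2 = (size c).-1, g 3 = l, g 4 = a, g 5 = P & has_stack g c].

Lemma has_stack_ext g g' c :
  (forall o, 16 <= o < 16 + 8 * size c -> g' o = g o) ->
  has_stack g c -> has_stack g' c.
Proof.
elim: c => [//|f fs IH] /= ext [[h1 h2 h3 h4 [h5 h6]] hs]; split.
  by split; rewrite ?ext//; lia.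
by apply: IH => // o h; apply: ext; lia.
Qed.

Lemma ev_bit g : ev (lay g) bit_expr = odd (fget 17 g %/ fget 19 g).
Proof.
rewrite /bit_expr; set q := EDiv _ _.
rewrite -[LHS]/(ev (lay g) q - 2 * (ev (lay g) q %/ 2)).
have -> : ev (lay g) q = fget 17 g %/ fget 19 g.
  by rewrite -[LHS]/(ev (lay g) (eF 17) %/ ev (lay g) (eF 19)) !ev_eF.
by rewrite -modn2 {1}(divn_eq (_ %/ _) 2) mulnC addKn.
Qed.

Lemma ev_push g f fs i : represents (f :: fs) g -> frame_ok n i f -> fr_next f < n ->
  (ev (lay g) push_expr != 0) = pushes l E f (size fs).
Proof.
move=> [/= g2 g3 _ _ [[h1 h2 h3 h4 _] _]] ok xn.
have vn : fr_vertex f < n by case/and5P: ok => _ _ _ /implyP/(_ xn).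
pose eA := EMem (EAdd (EAdd (EConst 1) (EMul (eF 16) eN)) (eF 18)).
rewrite -[ev _ push_expr]/((ev (lay g) (ereg 2) < ev (lay g) (ereg 3)) *
  (ev (lay g) bit_expr < 1) * ((ev (lay g) (ereg 2) < 1) + ev (lay g) eA)).
rewrite !ev_reg// ev_bit /fget g2 g3 h2 h4 /pushes.
have -> : ev (lay g) eA = E (fr_vertex f) (fr_next f).
  rewrite -[LHS]/(lay g (1 + ev (lay g) (eF 16) * ev (lay g) eN + ev (lay g) (eF 18))).
  rewrite !ev_eF// ev_N /fget g2 h1 h3 /lay -inpE//.
  have -> // : 1 + fr_vertex f * n + fr_next f <= n * n.
  by move: vn xn; clear; nia.
rewrite /nat_bit; case: (size fs < l); case: (odd _) => //=.
by case: (size fs) => [|k] //=; case: (E _ _).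
Qed.

(** The bound M is the same before and after, because sizes are read off the machine invariant at
    step i + 1 and not off the command. This supplies the fixed bit length that the loop needs. *)
Lemma body_step i c g M :
  represents c g -> config_ok n l a P i c -> config_ok n l a P i.+1 (mstep n l a P E c) ->
  mem_lt M g -> l.+2 < M -> i.+1 * 2 ^ n < M -> 2 * (a + P) ^ i.+1 < M ->
  ev (lay g) guard_expr != 0 ->
  exists g', [/\ run body_cmd (lay g) = lay g', represents (mstep n l a P E c) g' &
    mem_lt M g'].
Proof.
move=> rep ok ok' gM lM sM wM.
rewrite -[ev _ guard_expr]/(ev (lay g) (ereg 2) + (ev (lay g) eN - ev (lay g) (eF 18))).
rewrite ev_reg// ev_N ev_eF//.
have nM : 2 ^ n < M by apply: leq_ltn_trans sM; rewrite leq_pmull.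
have nM' : n < M by apply: leq_ltn_trans nM; exact/ltnW/ltn_expl.
case: c rep ok ok' => [|f fs] rep ok ok'; first by case/and4P: ok.
have okf : frame_ok n i f by case/and4P: ok => _ _ /= /andP[].
have sz : size fs <= l by case/and4P: ok.
have [/= g2 g3 g4 g5 [[h1 h2 h3 h4 [h5 h6]] hs]] := rep.
have F16 : fget 16 g = fr_vertex f by rewrite /fget g2.
have F17 : fget 17 g = fr_removed f by rewrite /fget g2.
have F18 : fget 18 g = fr_next f by rewrite /fget g2.
have F19 : fget 19 g = 2 ^ fr_next f by rewrite /fget g2.
have F20 : fget 20 g = fr_num f by rewrite /fget g2.
have F21 : fget 21 g = fr_den f by rewrite /fget g2.
have push := ev_push rep okf.
rewrite -[run body_cmd (lay g)]/(if (ev (lay g) (eF 18) < ev (lay g) eN) != 0 :> nat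
   then (if ev (lay g) push_expr != 0 then run push_cmd (lay g)
         else run advance_cmd (lay g)) else run pop_cmd (lay g)).
rewrite ev_eF// ev_N F18.
case: f {rep ok h1 h2 h3 h4 h5 h6} ok' okf F16 F17 F18 F19 F20 F21 push => v s x p q /=.
move=> ok' okf F16 F17 F18 F19 F20 F21 push.
have [p0 q0 xn _ /andP[_ sn]] := and5P okf; rewrite /= in p0 q0 xn sn.
move: ok'; case: (ltnP x n) => xn' /=; last first.
  rewrite (_ : n - x = 0) ?addn0 ?g2; last by lia.
  case: fs sz g2 hs {push} => [|[v' s' x' p' q'] fs] //= sz g2 [[k1 k2 k3 k4 [k5 k6]] hs] ok' _.
  rewrite /= in k1 k2 k3 k4 k5 k6.
  rewrite /pop_cmd !run_cons run_fr// run_fr// run_reg//.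
  rewrite -[ev _ (EMul (eF 12) _)]/(ev (lay g) (eF 12) * ev (lay g) (eF 21)).
  rewrite !ev_eF// F21.
  set g1 := fput 12 _ g.
  rewrite -[ev _ (EMul (eF 13) _)]/(ev (lay g1) (eF 13) *
    (ev (lay g1) (eF 20) + ev (lay g1) (eF 21))).
  rewrite !ev_eF// /g1 !fget_put//= F20 F21 -/g1.
  have F12 : fget 12 g = p' by rewrite /fget g2 -k5; congr g; lia.
  have F13 : fget 13 g = q' by rewrite /fget g2 -k6; congr g; lia.
  set g3' := fput 13 _ g1.
  have w : p' * q + q' * (p + q) <= 2 * (a + P) ^ i.+1 := config_ok_weight ok'.
  have wp : p' * q < M by apply: leq_ltn_trans wM; lia.
  have wq : q' * (p + q) < M by apply: leq_ltn_trans wM; lia.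
  have g1M : mem_lt M g1 by apply: fput_lt => //; rewrite F12.
  have g3M : mem_lt M g3' by apply: fput_lt => //; rewrite F13.
  have g32 : g3' 2 = (size fs).+1 by rewrite /g3' /g1 !fput_reg.
  rewrite -[ev _ (ESub _ _)]/(ev (lay g3') (ereg 2) - 1) ev_reg// g32 subn1 /=.
  eexists; split; first reflexivity; last by apply: update_lt => //; lia.
  have oth o : o != 2 -> o != 20 + 8 * size fs -> o != 21 + 8 * size fs ->
      update g3' 2 (size fs) o = g o.
    move=> o2 o20 o21; rewrite /update (negbTE o2).
    rewrite /g3' fput_other; last by rewrite /g1 fput_reg// g2; apply/eqP; move/eqP: o21; lia.
    by rewrite /g1 fput_other// g2; apply/eqP; move/eqP: o20; lia.
  split; [by rewrite /update eqxx|by rewrite oth|by rewrite oth|by rewrite oth|].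
  split; last by apply: has_stack_ext hs => o ho; apply: oth; apply/eqP; lia.
  split; [rewrite oth//=; apply/eqP; lia|rewrite oth//=; apply/eqP; lia|
    rewrite oth//=; apply/eqP; lia|rewrite oth//=; apply/eqP; lia|].
  have e j k : 2 < j -> k = j + 8 -> update g3' 2 (size fs) (k + 8 * size fs) = fget j g3'.
    move=> j2 ->; rewrite /update (_ : (_ == 2) = false); last by apply/eqP; lia.
    by rewrite /fget g32; congr g3'; lia.
  by rewrite (e 12)// (e 13)// /g3' /g1 !fget_put//= F12 F13.
have x1 : 2 * 2 ^ x = 2 ^ x.+1 by rewrite expnS.
have x1M : 2 ^ x.+1 < M by apply: leq_ltn_trans nM; rewrite leq_exp2l.
rewrite (push xn'); case: ifPn => pu ok' _; last first.
  rewrite /advance_cmd !run_cons run_fr// run_fr//.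
  rewrite -[ev _ (EMul _ _)]/(2 * ev (lay g) (eF 19)) ev_eF// F19 x1.
  set g1 := fput 19 _ g.
  rewrite -[ev _ (EAdd _ _)]/(ev (lay g1) (eF 18) + 1) ev_eF// /g1 fget_put//= F18 addn1 -/g1.
  have g12 : g1 2 = size fs by rewrite /g1 fput_reg.
  eexists; split; first reflexivity; last first.
    by do 2?apply: fput_lt => //; lia.
  have oth o : o != 18 + 8 * size fs -> o != 19 + 8 * size fs -> fput 18 x.+1 g1 o = g o.
    by move=> o18 o19; rewrite fput_other ?g12// /g1 fput_other ?g2.
  have e j : fput 18 x.+1 g1 (j + 8 * size fs) = fget j (fput 18 x.+1 g1).
    have q2 : fput 18 x.+1 g1 2 = size fs by rewrite fput_reg.
    by rewrite /fget q2.
  split; [by rewrite fput_reg|by rewrite oth|by rewrite oth|by rewrite oth|].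
  split; last by apply: has_stack_ext hs => o ho; apply: oth; apply/eqP; lia.
  by split; rewrite /= !e /g1 !fget_put//=.
have nsM : s + 2 ^ x < M.
  apply: leq_ltn_trans sM; rewrite mulSn addnC leq_add// leq_exp2l//; exact: ltnW.
have aM : a < M.
  apply: leq_ltn_trans wM; rewrite expnS; move: (expn_gt0 (a + P) i).
  rewrite addn_gt0 a_gt0 /=; move: (_ ^ i); clear; nia.
have PM : P < M.
  apply: leq_ltn_trans wM; rewrite expnS; move: (expn_gt0 (a + P) i).
  rewrite addn_gt0 a_gt0 /=; move: (_ ^ i); clear; nia.
rewrite /push_cmd !run_cons.
rewrite run_fr// ev_eF// F18; set m1 := fput 24 _ _.
rewrite run_fr// -[ev _ (EAdd _ _)]/(ev (lay m1) (eF 17) + ev (lay m1) (eF 19)).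
rewrite !ev_eF// /m1 !fget_put//= F17 F19 -/m1; set m2 := fput 25 _ _.
rewrite run_fr// -[ev _ (EConst 0)]/0; set m3 := fput 26 _ _.
rewrite run_fr// -[ev _ (EConst 1)]/1; set m4 := fput 27 _ _.
rewrite run_fr// ev_reg// {1}/m4 /m3 /m2 /m1 !fput_reg// g4 -/m1 -/m2 -/m3 -/m4.
set m5 := fput 28 _ _.
rewrite run_fr// ev_reg// {1}/m5 /m4 /m3 /m2 /m1 !fput_reg// g5 -/m1 -/m2 -/m3 -/m4 -/m5.
set m6 := fput 29 _ _.
rewrite run_fr// -[ev _ (EAdd _ _)]/(ev (lay m6) (eF 17) + ev (lay m6) (eF 19)).
have m6F j : j < 24 -> fget j m6 = fget j g.
  move=> j24; rewrite /m6 /m5 /m4 /m3 /m2 /m1 !fget_put//.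
  by do 6!(rewrite (_ : (j == _) = false); last by apply/eqP; lia).
rewrite !ev_eF// !m6F// F17 F19; set m7 := fput 17 _ _.
rewrite run_fr// -[ev _ (EMul _ _)]/(2 * ev (lay m7) (eF 19)) ev_eF//.
rewrite /m7 fget_put//= m6F// F19 x1 -/m7; set m8 := fput 19 _ _.
rewrite run_fr// -[ev _ (EAdd _ _)]/(ev (lay m8) (eF 18) + 1) ev_eF//.
rewrite /m8 /m7 !fget_put//= ?m6F// F18 addn1 -/m7 -/m8; set m9 := fput 18 _ _.
have m62 : m6 2 = size fs by rewrite /m6 /m5 /m4 /m3 /m2 /m1 !fput_reg.
have m92 : m9 2 = size fs by rewrite /m9 /m8 /m7 !fput_reg.
rewrite run_reg// -[ev _ (EAdd _ _)]/(ev (lay m9) (ereg 2) + 1) ev_reg// m92 addn1.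
eexists; split; first reflexivity; last first.
  by apply: update_lt; [do 9?apply: fput_lt => //; lia|lia].
have low o : o < 16 + 8 * size fs -> m9 o = g o.
  move=> ho.
  rewrite /m9 fput_other; last by rewrite /m8 /m7 !fput_reg// m62; apply/eqP; lia.
  rewrite /m8 fput_other; last by rewrite /m7 !fput_reg// m62; apply/eqP; lia.
  rewrite /m7 fput_other; last by rewrite m62; apply/eqP; lia.
  rewrite /m6 fput_other; last by rewrite /m5 /m4 /m3 /m2 /m1 !fput_reg// g2; apply/eqP; lia.
  rewrite /m5 fput_other; last by rewrite /m4 /m3 /m2 /m1 !fput_reg// g2; apply/eqP; lia.
  rewrite /m4 fput_other; last by rewrite /m3 /m2 /m1 !fput_reg// g2; apply/eqP; lia.
  rewrite /m3 fput_other; last by rewrite /m2 /m1 !fput_reg// g2; apply/eqP; lia.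
  rewrite /m2 fput_other; last by rewrite /m1 !fput_reg// g2; apply/eqP; lia.
  by rewrite /m1 fput_other// g2; apply/eqP; lia.
have up o : o != 2 -> update m9 2 (size fs).+1 o = m9 o.
  by rewrite /update => /negbTE ->.
have cell j : 2 < j -> update m9 2 (size fs).+1 (j + 8 * size fs) = fget j m9.
  by move=> j2; rewrite up ?/fget ?m92//; apply/eqP; lia.
have cell' j : 2 < j ->
    update m9 2 (size fs).+1 (j + 8 * (size fs).+1) = fget (j + 8) m9.
  by move=> j2; rewrite -cell ?addn_gt0//; [congr (update _ _ _ _)|]; lia.
split; [by rewrite /update eqxx|by rewrite up ?low|by rewrite up ?low|by rewrite up ?low|].
split; last split; last by apply: has_stack_ext hs => o ho; rewrite up ?low//; [|apply/eqP]; lia.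
- by split; rewrite /= !cell'// /m9 /m8 /m7 /m6 /m5 /m4 /m3 /m2 /m1 !fget_put.
- by split; rewrite /= !cell// /m9 /m8 /m7 !fget_put//= ?m6F.
Qed.
End Simulation.
End Layout.

Lemma lay_lt M n inp g :
  (forall b, b <= n * n -> inp b < M) -> mem_lt M g -> mem_lt M (lay n inp g).
Proof. by move=> iM gM b; rewrite /lay; case: ifP => // /iM. Qed.

Lemma mstep_halted n l a P E f : n <= fr_next f ->
  mstep n l a P E [:: f] = [:: f].
Proof. by case: f => v s x p q /= xn; rewrite ltnNge xn. Qed.

Lemma represents_guard act acc n inp l a P g f fs :
  inp 0 = n -> represents l a P (f :: fs) g ->
  Defs.eval act acc (lay n inp g) guard_expr = size fs + (n - fr_next f).
Proof.
move=> i0 [/= g2 _ _ _ [[_ _ h3 _ _] _]].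
rewrite -[LHS]/(Defs.eval act acc (lay n inp g) (ereg 2) +
  (Defs.eval act acc (lay n inp g) eN - Defs.eval act acc (lay n inp g) (eF 18))).
by rewrite ev_reg// ev_N// ev_eF// /fget g2 h3.
Qed.

Lemma main_loop_exec : exists T, forall act acc n (inp : memory) l a P
    (E : nat -> nat -> bool) g K s' p' q' B,
  inp 0 = n -> 0 < a -> 0 < P ->
  (forall v x, v < n -> x < n -> inp (1 + v * n + x) = E v x) ->
  (forall b, b <= n * n -> inp b < 2 ^ B) -> mem_lt (2 ^ B) g ->
  represents l a P [:: Frame 0 0 0 1 1] g ->
  iter K (mstep n l a P E) [:: Frame 0 0 0 1 1] = [:: Frame 0 s' n p' q'] ->
  l.+2 < 2 ^ B -> K.+1 * 2 ^ n < 2 ^ B -> 2 * (a + P) ^ K.+1 < 2 ^ B ->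
  exists g' t, [/\ exec act acc (CWhile guard_expr body_cmd) (lay n inp g) (lay n inp g') t,
    t <= K.+1 * (T * B), g' 20 = p', g' 21 = q' & mem_lt (2 ^ B) g'].
Proof.
have [Kg Kg0 hg] := eval_bound (isT : oracle_free guard_expr).
have [Kb Kb0 hb] := exec_straight (isT : straight body_cmd).
exists (1 + Kg + Kb) => act acc n inp l a P E g K s' p' q' B i0 a0 P0 iE iB gB rep itK lB sB wB.
have B0 : 0 < B by case: B lB {iB gB sB wB} => //; rewrite expn0; lia.
pose step := mstep n l a P E; pose c0 := [:: Frame 0 0 0 1 1].
(* K may exceed the first halting time k, at which the loop exits; halted configurations are fixed
   by [mstep], so the result is the same. *)
pose halted c := if c is [:: f] then n <= fr_next f else false.
have exh : exists k, halted (iter k step c0) by exists K; rewrite itK /= leqnn.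
pose k := ex_minn exh; have hk : halted (iter k step c0) by rewrite /k; case: ex_minnP.
have kK : k <= K.
  by rewrite /k; case: ex_minnP => j _; apply; rewrite itK /= leqnn.
have nh i : i < k -> ~~ halted (iter i step c0).
  rewrite /k; case: ex_minnP => j _ hj ij; apply/negP => /hj; lia.
have itk : iter k step c0 = [:: Frame 0 s' n p' q'].
  rewrite -itK -(subnK kK) iterD; move: hk; case: (iter k step c0) => [//|f [|//]] nf.
  by elim: (K - k) => [//|j IH]; rewrite iterS -IH mstep_halted.
have ok i : config_ok n l a P i (iter i step c0).
  elim: i => [|i IH]; last by rewrite iterS; exact: config_ok_step.
  rewrite /config_ok /= /frame_ok /= mul0n leqnn /weight big_cons big_nil /= expn0.
  by rewrite andbT implybb.
pose I i m := exists2 g1, m = lay n inp g1 &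
  represents l a P (iter i step c0) g1 /\ mem_lt (2 ^ B) g1.
have [| | |m' [t [ex tT [g1 me [rep1 g1B]]]]] :=
  @exec_while act acc I k ((1 + Kg + Kb) * B) guard_expr body_cmd (lay n inp g).
- move=> i m ik [g1 -> [rep1 g1B]].
  have lB1 : mem_lt (2 ^ B) (lay n inp g1) by exact: lay_lt.
  have ne : Defs.eval act acc (lay n inp g1) guard_expr != 0.
    have := nh i ik; have := ok i; move: rep1; case: (iter i step c0) => [|f fs] rep1 //.
    rewrite (represents_guard act acc i0 rep1) => _; case: fs rep1 => [|f' fs] rep1 //=.
  split=> //.
  have iK : i < K by exact: leq_trans ik kK.
  have [||//|g2 [e2 rep2 g2B]] := @body_step act acc n inp i0 l a P E a0 P0 iE i _ g1 (2 ^ B)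
    rep1 (ok i) (ok i.+1) g1B lB _ _.
  - by apply: leq_ltn_trans sB; rewrite leq_mul2r ltnW ?orbT.
  - apply: leq_ltn_trans wB; rewrite leq_mul2l /= leq_pexp2l ?addn_gt0 ?a0//.
    by rewrite ltnS ltnW.
  have [_ [tb tbB exb]] := hb act acc (lay n inp g1) B B0 lB1.
  exists (lay n inp g2), tb; rewrite -e2; split=> //; last by exists g2; rewrite ?e2.
  by have [_ c1] := hg act acc _ B B0 lB1; rewrite !mulnDl mul1n; lia.
- move=> m [g1 -> [rep1 g1B]]; rewrite itk in rep1.
  rewrite (represents_guard act acc i0 rep1) /= subnn; split=> //.
  have [_ c1] := hg act acc _ B B0 (lay_lt iB g1B); rewrite !mulnDl mul1n; lia.
- by exists g.
rewrite {}me in ex; rewrite itk in rep1; case: rep1 => _ _ _ _ [/= [_ _ _ _ [h20 h21]] _].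
exists g1, t; split=> //; apply: leq_trans tT _.
by rewrite leq_mul2r ltnS kK orbT.
Qed.

Definition regs1 (i : nat) : memory :=
  fun o => if o == 6 then i else if o == 7 then 2 ^ i else 0.
Definition regs2 (k y i : nat) : memory :=
  fun o => if o == 3 then i else if o == 5 then 2 ^ i else if o == 8 then y else regs1 k o.

Lemma ev_epow act acc m e k :
  Defs.eval act acc m (epow e k) = (Defs.eval act acc m e) ^ k.
Proof.
elim: k => [//|k IH]; rewrite expnS -IH.
by [].
Qed.

Lemma oracle_free_epow e k : oracle_free e -> oracle_free (epow e k).
Proof. by move=> h; elim: k => [//|k IH] /=; rewrite h. Qed.

(** The guard queries an oracle, so [eval_bound] does not cover it. Its cost is estimated directly:
    answers are below 2 before the last one, and a query costs at most k. *)
Lemma accuracy_loop_exec : exists T, forall act acc n (inp : memory) k B,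
  inp 0 = n -> (forall b, b <= n * n -> inp b < 2 ^ B) ->
  (forall i, i < k -> acc i < 2) -> 2 <= acc k -> acc k < 2 ^ B -> k < B ->
  exists2 t, t <= k.+1 * (T * B) &
    exec act acc accuracy_loop (lay n inp (regs1 0)) (lay n inp (regs1 k)) t.
Proof.
pose bd := cseq [:: CStore (eadr 6) (EAdd (ereg 6) (EConst 1));
              CStore (eadr 7) (EMul (EConst 2) (ereg 7))].
have [Kg Kg0 hg] := eval_bound (isT : oracle_free (ereg 6)).
have [Kb Kb0 hb] := exec_straight (isT : straight bd).
exists (8 + Kg + Kb) => act acc n inp k B i0 iB lo hi accB kB.
have B0 : 0 < B by lia.
have B2 : 2 <= 2 ^ B by rewrite -{1}[2]expn1 leq_exp2l.
have regB i : i <= k -> mem_lt (2 ^ B) (regs1 i).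
  move=> ik o; rewrite /regs1; case: ifP => _; last case: ifP => _; last by rewrite expn_gt0.
    by apply: leq_ltn_trans (ltn_expl B (isT : 1 < 2)); lia.
  by rewrite ltn_exp2l//; lia.
pose gd := ELt (EAccuracy (ereg 6)) (EConst 2).
have gdE i : Defs.eval act acc (lay n inp (regs1 i)) gd = (acc i < 2).
  by rewrite -[LHS]/(nat_of_bool (acc (Defs.eval act acc (lay n inp (regs1 i)) (ereg 6)) < 2)) ev_reg.
have gdC i : i <= k -> 1 + eval_cost act acc (lay n inp (regs1 i)) gd <= (8 + Kg) * B.
  move=> ik; have [_ c1] := hg act acc _ B B0 (lay_lt iB (regB i ik)).
  set m := lay n inp (regs1 i) in c1 *.
  rewrite -[eval_cost _ _ _ gd]/(bitlen (Defs.eval act acc m gd) +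
    ((bitlen (acc (Defs.eval act acc m (ereg 6))) +
      (eval_cost act acc m (ereg 6) + Defs.eval act acc m (ereg 6))) + (bitlen 2 + 0))).
  rewrite gdE ev_reg// (_ : regs1 i 6 = i)// addn0.
  have b1 : bitlen (acc i < 2) <= B by apply: bitlen_le => //; case: (_ < 2) => /=; lia.
  have b2 : bitlen (acc i) <= B.
    apply: bitlen_le => //; move: ik; rewrite leq_eqVlt => /predU1P[->//|/lo]; lia.
  have b3 : bitlen 2 <= 2 by exact: bitlen_le.
  rewrite mulnDl; lia.
have [| | |m' [t [ex tT e]]] := @exec_while act acc (fun i m => m = lay n inp (regs1 i) /\ i <= k)
    k ((8 + Kg + Kb) * B) gd bd (lay n inp (regs1 0)).
- move=> i m ik [-> _]; rewrite gdE lo//; split=> //.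
  have [_ [t tB ex]] := hb act acc _ B B0 (lay_lt iB (regB i (ltnW ik))).
  exists (lay n inp (regs1 i.+1)), t; split=> //; last first.
    by have := gdC i (ltnW ik); rewrite [(_ + Kb) * B]mulnDl; lia.
  move: ex; rewrite /bd run_cons run_reg//.
  rewrite -[Defs.eval _ _ _ (EAdd _ _)]/(Defs.eval act acc (lay n inp (regs1 i)) (ereg 6) + 1).
  rewrite ev_reg//; set g1 := update _ _ _; rewrite run_cons run_reg// run_nil.
  rewrite -[Defs.eval _ _ _ (EMul _ _)]/(2 * Defs.eval act acc (lay n inp g1) (ereg 7)).
  rewrite ev_reg//; congr (exec _ _ _ _ (lay _ _ _) _).
  apply/funext => o; rewrite /update /g1 /update /regs1 /= expnS.
  by case: (o =P 7) => [->|_] //=; case: (o =P 6) => [_|_] //=; rewrite ?addn1.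
- move=> m [-> _]; rewrite gdE ltnNge hi; split=> //.
  by have := gdC k (leqnn k); rewrite [(_ + Kb) * B]mulnDl; lia.
- by [].
by case: e => <- _; exists t.
Qed.

Lemma level_loop_exec : exists T, forall act acc n (inp : memory) k y l B,
  inp 0 = n -> (forall b, b <= n * n -> inp b < 2 ^ B) ->
  (forall i, i < l -> 2 ^ i < y) -> y <= 2 ^ l -> y < 2 ^ B -> l < B -> k < B ->
  exists2 t, t <= l.+1 * (T * B) &
    exec act acc level_loop (lay n inp (regs2 k y 0)) (lay n inp (regs2 k y l)) t.
Proof.
pose bd := cseq [:: CStore (eadr 5) (EMul (EConst 2) (ereg 5));
              CStore (eadr 3) (EAdd (ereg 3) (EConst 1))].
pose gd := ELt (ereg 5) (ereg 8).
have [Kg Kg0 hg] := eval_bound (isT : oracle_free gd).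
have [Kb Kb0 hb] := exec_straight (isT : straight bd).
exists (1 + Kg + Kb) => act acc n inp k y l B i0 iB lo hi yB lB kB.
have B0 : 0 < B by lia.
have regB i : i <= l -> mem_lt (2 ^ B) (regs2 k y i).
  have hB j : j < B -> j < 2 ^ B.
    by move=> jB; apply: leq_ltn_trans (ltn_expl B (isT : 1 < 2)); lia.
  move=> il o; rewrite /regs2; case: ifP => _; first by apply: hB; lia.
  case: ifP => _; first by rewrite ltn_exp2l//; lia.
  case: ifP => _ //; rewrite /regs1; case: ifP => _; first exact: hB.
  by case: ifP => _; rewrite ?expn_gt0// ltn_exp2l.
have gdE i : Defs.eval act acc (lay n inp (regs2 k y i)) gd = (2 ^ i < y).
  rewrite -[LHS]/(nat_of_bool (Defs.eval act acc (lay n inp (regs2 k y i)) (ereg 5) <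
     Defs.eval act acc (lay n inp (regs2 k y i)) (ereg 8))).
  by rewrite !ev_reg.
have [| | |m' [t [ex tT e]]] := @exec_while act acc (fun i m => m = lay n inp (regs2 k y i))
    l ((1 + Kg + Kb) * B) gd bd (lay n inp (regs2 k y 0)).
- move=> i m il ->; rewrite gdE lo//; split=> //.
  have mB := lay_lt iB (regB i (ltnW il)).
  have [_ [t tB ex]] := hb act acc _ B B0 mB.
  exists (lay n inp (regs2 k y i.+1)), t; split=> //; last first.
    by have [_ c1] := hg act acc _ B B0 mB; rewrite !mulnDl mul1n; lia.
  move: ex; rewrite /bd run_cons run_reg//.
  rewrite -[Defs.eval _ _ _ (EMul _ _)]/(2 * Defs.eval act acc (lay n inp (regs2 k y i)) (ereg 5)).
  rewrite ev_reg//; set g1 := update _ _ _; rewrite run_cons run_reg// run_nil.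
  rewrite -[Defs.eval _ _ _ (EAdd _ _)]/(Defs.eval act acc (lay n inp g1) (ereg 3) + 1).
  rewrite ev_reg//; congr (exec _ _ _ _ (lay _ _ _) _).
  apply/funext => o; rewrite /update /g1 /update /regs2 /= expnS.
  by case: (o =P 3) => [_|_] //=; rewrite ?addn1//; case: (o =P 5).
- move=> m ->; rewrite gdE ltnNge hi; split=> //.
  by have [_ c1] := hg act acc _ B B0 (lay_lt iB (regB l (leqnn l))); rewrite !mulnDl mul1n; lia.
- by [].
by subst m'; exists t.
Qed.

Lemma program_exec (A0 A : nat) : exists T,
  forall act acc n (inp : memory) (E : nat -> nat -> bool) k l K s' p' q' B,
  let y := (A0 * ((n + 1) * 2 ^ k)) ^ A in
  let a := act l in
  inp 0 = n -> (forall v x, v < n -> x < n -> inp (1 + v * n + x) = E v x) ->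
  (forall b, n * n < b -> inp b = 0) -> (forall b, b <= n * n -> inp b < 2 ^ B) ->
  (forall i, i < k -> acc i < 2) -> 2 <= acc k -> acc k < 2 ^ B -> k < B ->
  (forall i, i < l -> 2 ^ i < y) -> y <= 2 ^ l -> y < 2 ^ B -> l < B ->
  0 < a -> a < 2 ^ B ->
  iter K (mstep n l a (2 ^ l) E) [:: Frame 0 0 0 1 1] = [:: Frame 0 s' n p' q'] ->
  l.+2 < 2 ^ B -> K.+1 * 2 ^ n < 2 ^ B -> 2 * (a + 2 ^ l) ^ K.+1 < 2 ^ B ->
  exists m t, [/\ exec act acc (fptas_program A0 A) inp m t,
    t <= T * ((k + l + K + 1) * B), m 0 = q' & m 1 = p'].
Proof.
have [T1 h1] := accuracy_loop_exec; have [T2 h2] := level_loop_exec.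
have [T3 h3] := main_loop_exec.
pose s1 := CStore (eadr 7) (EConst 1).
pose s2 := cseq [:: CStore (eadr 8) (epow (scale_expr A0) A); CStore (eadr 5) (EConst 1)].
pose s3 := cseq [:: CStore (eadr 19) (EConst 1); CStore (eadr 20) (EConst 1);
               CStore (eadr 21) (EConst 1)].
pose s4 := cseq [:: CStore (EConst 1) (ereg 20); CStore (EConst 0) (ereg 21)].
have [K1 K10 e1] := exec_straight (isT : straight s1).
have [K2 K20 e2] : exists2 K, 0 < K & forall act acc m B, 0 < B ->
    mem_lt (2 ^ B) m -> mem_lt (2 ^ (K * B)) (crun act acc s2 m) /\
    exists2 t, t <= K * B & exec act acc s2 m (crun act acc s2 m) t.
  by apply: exec_straight; rewrite /s2 /= oracle_free_epow.
have [K3 K30 e3] := exec_straight (isT : straight s3).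
have [K4 K40 e4] := exec_straight (isT : straight s4).
have [K5 K50 e5] := eval_bound (isT : oracle_free (eadr 4)).
have [K6 K60 e6] := eval_bound (isT : oracle_free (ereg 3)).
exists (T1 + T2 + T3 + K1 + K2 + K3 + K4 + K5 + K6 + 10).
move=> act acc n inp E k l K s' p' q' B y a i0 iE iz iB alo ahi aB kB llo lhi yB lB a0 aB' itK l2B sB wB.
have B0 : 0 < B by lia.
have B2 : 1 < 2 ^ B by rewrite -{1}(expn0 2) ltn_exp2l.
(* The untouched input is already a layout, with zero working memory. *)
have ie : inp = lay n inp (fun=> 0).
  by apply/funext => b; rewrite /lay; case: leqP => // /iz.
have zB : mem_lt (2 ^ B) (fun=> 0) by move=> b; rewrite expn_gt0.
have [_ [t1 t1B x1]] := e1 act acc (lay n inp (fun=> 0)) B B0 (lay_lt iB zB).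
have r1 : crun act acc s1 (lay n inp (fun=> 0)) = lay n inp (regs1 0).
  rewrite run_reg//; congr lay; apply/funext => o; rewrite /update /regs1.
  by case: (o =P 7) => [->|_] //=; case: ifP.
rewrite r1 in x1.
have [t2 t2B x2] := h1 act acc n inp k B i0 iB alo ahi aB kB.
have hB j : j < B -> j < 2 ^ B.
  by move=> jB; apply: leq_ltn_trans (ltn_expl B (isT : 1 < 2)); lia.
have reg1B : mem_lt (2 ^ B) (regs1 k).
  move=> o; rewrite /regs1; case: ifP => _; first exact: hB.
  by case: ifP => _; rewrite ?expn_gt0// ltn_exp2l.
have [_ [t3 t3B x3]] := e2 act acc _ B B0 (lay_lt iB reg1B).
have r2 : crun act acc s2 (lay n inp (regs1 k)) = lay n inp (regs2 k y 0).
  rewrite /s2 run_cons run_reg// ev_epow.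
  rewrite -[Defs.eval _ _ _ (scale_expr A0)]/(A0 * ((Defs.eval act acc (lay n inp (regs1 k)) eN + 1)
     * Defs.eval act acc (lay n inp (regs1 k)) (ereg 7))).
  rewrite ev_N// ev_reg// run_cons run_reg// run_nil -[Defs.eval _ _ _ (EConst 1)]/1.
  congr lay; apply/funext => o; rewrite /update /regs2 /regs1.
  case: (o =P 5) => [->|_] //; case: (o =P 8) => [->|_] //.
  by case: (o =P 3) => [->|_].
rewrite r2 in x3.
have [t4 t4B x4] := h2 act acc n inp k y l B i0 iB llo lhi yB lB kB.
have reg2B : mem_lt (2 ^ B) (regs2 k y l).
  move=> o; rewrite /regs2; case: ifP => _; first exact: hB.
  case: ifP => _; first by rewrite ltn_exp2l.
  by case: ifP.
pose g3 := update (regs2 k y l) 4 a.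
pose m4 := lay n inp (regs2 k y l).
have x5 : exec act acc (CStore (eadr 4) (EActivity (ereg 3))) m4 (lay n inp g3)
    (1 + eval_cost act acc m4 (eadr 4) + eval_cost act acc m4 (EActivity (ereg 3))).
  have -> : lay n inp g3 = update m4 (Defs.eval act acc m4 (eadr 4))
      (Defs.eval act acc m4 (EActivity (ereg 3))).
    rewrite -[Defs.eval _ _ _ (EActivity _)]/(act (Defs.eval act acc m4 (ereg 3))).
    by rewrite ev_reg// ev_adr// lay_store.
  exact: ExecStore.
set t5 := (1 + _ + _) in x5.
have t5B : t5 <= (K5 + K6 + 3) * B.
  have [_ c5] := e5 act acc m4 B B0 (lay_lt iB reg2B).
  have [_ c6] := e6 act acc m4 B B0 (lay_lt iB reg2B).
  rewrite /t5 -[eval_cost _ _ _ (EActivity _)]/(bitlen (act (Defs.eval act acc m4 (ereg 3))) +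
     (eval_cost act acc m4 (ereg 3) + Defs.eval act acc m4 (ereg 3))).
  rewrite ev_reg// (_ : regs2 k y l 3 = l)//.
  have : bitlen (act l) <= B by exact: bitlen_le.
  rewrite !mulnDl; lia.
have g3B : mem_lt (2 ^ B) g3 by exact: update_lt.
have [_ [t6 t6B x6]] := e3 act acc _ B B0 (lay_lt iB g3B).
pose g4 := update (update (update g3 19 1) 20 1) 21 1.
have r3 : crun act acc s3 (lay n inp g3) = lay n inp g4.
  by rewrite /s3 !run_cons !run_reg.
rewrite r3 in x6.
have g4B : mem_lt (2 ^ B) g4 by do 3?apply: update_lt.
have rep : represents l a (2 ^ l) [:: Frame 0 0 0 1 1] g4 by [].
have P0 : 0 < 2 ^ l by rewrite expn_gt0.
have [g5 [t7 [x7 t7B g520 g521 g5B]]] :=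
  h3 act acc n inp l a (2 ^ l) E g4 K s' p' q' B i0 a0 P0 iE iB g4B rep itK l2B sB wB.
have [_ [t8 t8B x8]] := e4 act acc _ B B0 (lay_lt iB g5B).
have [r40 r41] : crun act acc s4 (lay n inp g5) 0 = q' /\ crun act acc s4 (lay n inp g5) 1 = p'.
  rewrite /s4 run_cons.
  rewrite -[crun _ _ (CStore (EConst 1) _) _]/(update (lay n inp g5) 1
     (Defs.eval act acc (lay n inp g5) (ereg 20))) ev_reg// g520.
  rewrite run_cons run_nil; set m5 := update _ 1 _.
  rewrite -[crun _ _ _ _]/(update m5 0 (Defs.eval act acc m5 (ereg 21))).
  rewrite -[Defs.eval _ _ _ _]/(m5 (m5 0 * m5 0 + 21)).
  have -> : m5 0 = n by rewrite /m5 /update /= /lay i0.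
  rewrite {1 2}/update /=; split; last by rewrite /m5 /update.
  rewrite /m5 /update (_ : (_ == 1) = false); last by apply/eqP; lia.
  by rewrite lay_off.
exists (crun act acc s4 (lay n inp g5)), (t1 + (t2 + (t3 + (t4 + (t5 + (t6 + (t7 + (t8 + 1)))))))).
split=> //; last first.
  have : (k + l + K + 1) * B = k.+1 * B + l * B + K * B by lia.
  move=> ->; move: t2B t4B t7B t5B; rewrite !mulSn.
  have : 0 < k.+1 * B by rewrite muln_gt0.
  move: t1B t3B t6B t8B; clear; move=> *.
  nia.
rewrite {1}ie; apply: ExecSeq x1 _; apply: ExecSeq x2 _; apply: ExecSeq x3 _.
apply: ExecSeq x4 _; apply: ExecSeq x5 _; apply: ExecSeq x6 _; apply: ExecSeq x7 _.
by apply: ExecSeq x8 _; constructor.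
Qed.
End Program.

(** * The adjacency matrix as input *)

Section GraphInput.
Local Open Scope nat_scope.

Lemma nth_allpairs (S T U : Type) (x0 : U) (h : S -> T -> U) s t i j a b :
  i < size s -> j < size t ->
  nth x0 [seq h x y | x <- s, y <- t] (i * size t + j) = h (nth a s i) (nth b t j).
Proof.
elim: s i => [//|x s IH] [|i] /= si tj; rewrite nth_cat size_map.
  by rewrite mul0n add0n tj (nth_map b).
by rewrite mulSn -addnA ltnNge leq_addr /= addKn IH.
Qed.

Variables (G : graph) (n : nat) (f : 'I_n -> G) (g : G -> 'I_n).
Hypotheses (fK : cancel f g) (gK : cancel g f) (finG : finite_graph G).

Let inp := graph_input (fun i j => adj (f i) (f j)).

Lemma graph_input_adj v x : v < n -> x < n -> inp (1 + v * n + x) = label_adj f v x.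
Proof.
move=> vn xn; rewrite /inp /graph_input -addnA /=.
have := @nth_allpairs _ _ _ 0 (fun i j : 'I_n => nat_of_bool (adj (f i) (f j)))
  (enum 'I_n) (enum 'I_n) v x (Ordinal vn) (Ordinal vn).
rewrite size_enum_ord => ->//; rewrite -(label_adjE f).
by rewrite !nth_enum_ord.
Qed.

Lemma graph_input_far b : n * n < b -> inp b = 0.
Proof.
by move=> nb; rewrite /inp /graph_input nth_default//= size_allpairs size_enum_ord.
Qed.

Lemma graph_input_le b : inp b <= n.+1.
Proof.
rewrite /inp /graph_input; case: b => [|b] /=; first exact: leqnSn.
have [bs|bs] := ltnP b (size [seq nat_of_bool (adj (f i) (f j)) | i <- enum 'I_n, j <- enum 'I_n]).
  have /allpairsP[[i j] [_ _ ->]] := mem_nth 0 bs.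
  by case: (adj _ _).
by rewrite nth_default.
Qed.

Lemma perm_vertices : perm_eq (vertices G) [seq f i | i <- enum 'I_n].
Proof.
apply: uniq_perm; first exact: fset_uniq.
  by rewrite map_inj_uniq ?enum_uniq//; exact: can_inj fK.
move=> u; rewrite in_fset_set// in_setT; apply/esym/mapP.
by exists (g u); rewrite ?mem_enum ?gK.
Qed.

Lemma graph_order_label : graph_order G = n.
Proof. by rewrite /graph_order (perm_size perm_vertices) size_map size_enum_ord. Qed.
End GraphInput.

(** * Choice of precision and size bounds *)

Section Scales.
Variable R : realType.

Lemma ln2_le1 : ln 2 <= 1 :> R.
Proof. by have := @ln_le_subr1 R 2; lra. Qed.

Lemma exprn_1D_ge (h : R) (n : nat) : 0 <= h -> 1 + n%:R * h <= (1 + h) ^+ n.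
Proof.
move=> h0; elim: n => [|n IH]; first by rewrite mul0r addr0 expr0.
have e : n.+1%:R = n%:R + 1 :> R by rewrite -natr1.
rewrite exprSr e; have n0 : 0 <= n%:R :> R by [].
apply: (@le_trans _ _ ((1 + n%:R * h) * (1 + h))); first by nra.
by rewrite ler_wpM2r// addr_ge0.
Qed.

Lemma geometric_le_half (th : R) : 0 < th < 1 -> exists2 A : nat, (0 < A)%N &
  forall B, (A <= B)%N -> th ^+ B <= 2^-1.
Proof.
move=> /andP[t0 t1]; pose h := th^-1 - 1.
have h0 : 0 < h by rewrite subr_gt0 invf_gt1.
exists (Num.bound h^-1).+1 => // B AB.
have : th ^+ B <= th ^+ (Num.bound h^-1).+1 by rewrite ler_wiXn2l// ltW.
move=> /le_trans; apply; set A := (Num.bound _).+1.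
rewrite -[th]invrK -{1}[th^-1](subrK 1) -/h addrC exprVn lef_pV2 ?posrE ?exprn_gt0//.
  apply: le_trans (exprn_1D_ge _ (ltW h0)).
  have : h^-1 <= A%:R.
    apply: le_trans (_ : (Num.bound h^-1)%:R <= _); last by rewrite ler_nat.
    by apply/ltW/archi_boundP; rewrite invr_ge0 ltW.
  rewrite -[h^-1]mul1r ler_pdivrMr//; lra.
by rewrite addr_gt0.
Qed.

Lemma natr_le_expn2 (x : R) : exists b : nat, x <= (2 ^ b)%:R.
Proof.
exists (Num.bound `|x|); apply: le_trans (ler_norm _) _.
apply: le_trans (ltW (archi_boundP (normr_ge0 _))) _.
by rewrite ler_nat ltnW// ltn_expl.
Qed.

(** Taking k least gives both bounds: acc k >= 2 forces eps 2^k >= 1, and acc (k - 1) <= 1 forces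
    eps 2^(k - 1) <= 2. *)
Lemma accuracy_scale (eps : R) (acc : nat -> nat) : 0 < eps <= 1 -> approximates eps acc ->
  exists k, [/\ forall i, (i < k)%N -> (acc i < 2)%N, (2 <= acc k)%N,
    eps^-1 <= (2 ^ k)%:R, (2 ^ k)%:R <= 4 / eps & (acc k < 2 ^ k.+2)%N].
Proof.
move=> /andP[e0 e1] ap.
have ex : exists k, (2 <= acc k)%N.
  have [b hb] := natr_le_expn2 (3 / eps); exists b.
  have /ler_normlP[h _] := ap b.
  have : 3 <= eps * 2 ^+ b.
    by move: hb; rewrite ler_pdivrMr// mulrC natrX.
  move=> h3; rewrite -(ler_nat R); lra.
exists (ex_minn ex); case: ex_minnP => k hk mink.
have /ler_normlP[h1 h2] := ap k.
have p0 : 0 < 2 ^+ k :> R by rewrite exprn_gt0.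
have p1 : 1 <= 2 ^+ k :> R by rewrite exprn_ege1 ?ler1n.
have hk' : 2 <= (acc k)%:R :> R by rewrite (ler_nat R 2).
split=> //.
- by move=> i ik; rewrite ltnNge; apply/negP => /mink; rewrite leqNgt ik.
- rewrite natrX -[leLHS]mul1r ler_pdivrMr// mulrC; lra.
- rewrite natrX ler_pdivlMr//; case: k hk mink {h1 h2 hk' p0 p1} => [|k] hk mink.
    by rewrite expr0 mul1r; lra.
  have lt : (acc k < 2)%N by rewrite ltnNge; apply/negP => /mink; rewrite ltnn.
  have /ler_normlP[h _] := ap k.
  have : (acc k)%:R <= 1 :> R by rewrite (ler_nat R _ 1) -ltnS.
  rewrite exprS mulrC; lra.
- rewrite -(ltr_nat R) natrX !exprS; nra.
Qed.

Lemma activity_numerator_bound (lam : R) (act : nat -> nat) (b l : nat) :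
  approximates lam act -> lam <= (2 ^ b)%:R ->
  (act l + 2 ^ l <= 2 ^ (b + 1 + l + 1))%N.
Proof.
move=> ap lb; rewrite -(ler_nat R) natrD !expnD expn1 !natrM !natrX.
have /ler_normlP[_ h] := ap l.
have h2 : lam * 2 ^+ l <= 2 ^+ b * 2 ^+ l by rewrite ler_wpM2r ?exprn_ge0 -?natrX.
have q1 : 1 <= 2 ^+ l :> R by rewrite exprn_ege1 ?ler1n.
have q2 : 2 ^+ l <= 2 ^+ b * 2 ^+ l :> R.
  by rewrite ler_peMl ?exprn_ge0// exprn_ege1 ?ler1n.
have -> : 2 ^+ b * 2 * 2 ^+ l * 2 = 4 * (2 ^+ b * 2 ^+ l) :> R by ring.
lra.
Qed.

Lemma scale_bound (eps : R) (A0 n k : nat) : 0 < eps <= 1 -> (2 ^ k)%:R <= 4 / eps ->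
  (A0 * ((n + 1) * 2 ^ k))%:R <= (8 * A0)%:R * (n%:R + eps^-1) ^+ 2.
Proof.
move=> /andP[e0 e1] hk; have ei : 1 <= eps^-1 by rewrite invf_ge1.
have n0 := ler0n R n; set x := n%:R + eps^-1.
have h1 : (n + 1)%:R <= 2 * x by rewrite natrD /x; lra.
have h2 : (2 ^ k)%:R <= 4 * x by apply: le_trans hk _; rewrite /x; lra.
rewrite !natrM; apply: (@le_trans _ _ (A0%:R * (2 * x * (4 * x)))).
  by rewrite ler_wpM2l// ler_pM.
by rewrite le_eqVlt; apply/orP; left; apply/eqP; ring.
Qed.

Lemma polynomial_time_bound (X T bl A e k l n K : nat) :
  (2 <= X)%N -> (k <= l)%N -> (l <= X ^ A.+1)%N -> (n <= X)%N -> (K <= X ^ e)%N ->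
  (T * ((k + l + K + 1) * ((bl + l + n + 4) * (K + 2))) <=
   X ^ (11 * (T + bl + A + e + 2)))%N.
Proof.
move=> X2 kl lX nX KX; set d := (T + bl + A + e + 2)%N.
have X0 : (0 < X)%N by exact: leq_trans X2.
have mono i : (i <= d)%N -> (X ^ i <= X ^ d)%N by move=> id; rewrite leq_pexp2l.
have cst i : (i <= X ^ i)%N by exact/ltnW/ltn_expl.
pose Z := (X ^ d)%N.
have TZ : (T <= Z)%N by rewrite (leq_trans (cst T))// mono// /d; lia.
have bZ : (bl <= Z)%N by rewrite (leq_trans (cst bl))// mono// /d; lia.
have lZ : (l <= Z)%N by rewrite (leq_trans lX)// mono// /d; lia.
have KZ : (K <= Z)%N by rewrite (leq_trans KX)// mono// /d; lia.
have nZ : (n <= Z)%N by rewrite (leq_trans nX)// -{1}[X]expn1 mono// /d; lia.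
have Z2 : (2 <= Z)%N by rewrite (leq_trans X2)// -{1}[X]expn1 mono// /d; lia.
rewrite (mulnC 11%N) expnM -/Z.
have : (T * ((k + l + K + 1) * ((bl + l + n + 4) * (K + 2))) <=
  Z * ((4 * Z) * ((7 * Z) * (3 * Z))))%N.
  by apply: leq_mul => //; apply: leq_mul; [lia|apply: leq_mul; lia].
move=> /leq_trans; apply.
(* The constant 84 is below 2^7, hence absorbed by Z^7. *)
have -> : (Z * ((4 * Z) * ((7 * Z) * (3 * Z))) = 84 * Z ^ 4)%N by ring.
rewrite -[11%N]/(7 + 4)%N expnD leq_mul2r; apply/orP; right.
by apply: (@leq_trans (2 ^ 7)) => //; rewrite leq_exp2r.
Qed.

(** The last bound dictates B: by the potential of the machine, numerators and denominators gain at
    most bl + l + 1 bits per step. *)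
Lemma precision_bounds (bl k l n K a : nat) :
  (k <= l)%N -> (a + 2 ^ l <= 2 ^ (bl + l + 1))%N ->
  let B := ((bl + l + n + 4) * (K + 2))%N in
  [/\ [/\ (k.+2 <= B)%N, (l < B)%N, (n.+1 <= B)%N & (2 ^ l < 2 ^ B)%N],
      (a < 2 ^ B)%N, (l.+2 < 2 ^ B)%N, (K.+1 * 2 ^ n < 2 ^ B)%N &
      (2 * (a + 2 ^ l) ^ K.+1 < 2 ^ B)%N].
Proof.
move=> kl aP B.
have lB : (l < B)%N by rewrite /B; nia.
have bB : (bl + l + 1 < B)%N by rewrite /B; nia.
split.
- by split; rewrite ?ltn_exp2l// /B; nia.
- apply: leq_ltn_trans (_ : 2 ^ (bl + l + 1) < _)%N; last by rewrite ltn_exp2l.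
  by apply: leq_trans aP; exact: leq_addr.
- apply: leq_trans (ltn_expl l.+2 (isT : (1 < 2)%N)) _.
  by rewrite leq_exp2l// /B; nia.
- apply: (@leq_trans (2 ^ K.+1 * 2 ^ n)%N).
    by rewrite ltn_mul2r expn_gt0 ltn_expl.
  by rewrite -expnD leq_exp2l// /B; nia.
- apply: (@leq_ltn_trans (2 * (2 ^ (bl + l + 1)) ^ K.+1)%N).
    by rewrite leq_mul2l leq_exp2r ?aP ?orbT.
  by rewrite -expnM -expnS ltn_exp2l// /B; nia.
Qed.
End Scales.

(** * Assembly of the approximation scheme *)

Section FPTAS.
Variables (R : realType) (Delta lambda : R) (F : graph_family).
Hypotheses (Delta_gt1 : 1 < Delta) (lambda_gt0 : 0 < lambda).
Hypothesis lambda_lt : lambda < lambda_c Delta.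
Hypothesis F_finite : forall G : graph, F G -> finite_graph G.
Hypothesis F_cc : family_connective_constant_le F Delta.


Lemma has_fptas_of_cc : has_fptas lambda F.
Proof.
have [ac [c0 Fcc]] := F_cc.
(* Room above lambda for the dyadic activity used by the program. *)
have [lam' [ll' l'c]] : exists lam', lambda < lam' /\ 0 < lam' < lambda_c Delta.
  move: lambda_gt0 lambda_lt; move: (lambda_c Delta) => L h1 h2.
  by exists ((lambda + L) / 2); split; [|apply/andP; split]; lra.
have [D' [th [Kd [q [DD' th01 Kd0 dec]]]]] := trunc_ratio_decay Delta_gt1 l'c.
have [th0 th1] := andP th01.
have D0 : 0 < Delta by rewrite (lt_trans _ Delta_gt1).
pose K1 := Kd * `|c0| `^ q.
have K10 : 0 <= K1 by rewrite mulr_ge0 ?powR_ge0.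
have [A1 A10 hA1] := geometric_le_half th01.
(* Two demands on a level with 2^l >= X^A: th^l <= 1 / X, through th^A <= 1/2, and ac ln n <= l,
   through ac <= A. *)
have [bA hbA] := natr_le_expn2 ac; pose A := (A1 + 2 ^ bA)%N.
have A0gt : (0 < A)%N by rewrite /A addn_gt0 A10.
have thA : th ^+ A <= 2^-1 by rewrite hA1// leq_addr.
have acA : ac <= A%:R.
  by apply: le_trans hbA _; rewrite ler_nat leq_addl.
have [b1 hb1] := natr_le_expn2 (8 * K1).
have [b2 hb2] := natr_le_expn2 (8 / lambda).
have [b3 hb3] := natr_le_expn2 (lam' - lambda)^-1.
(* The summands make 1 / X small enough, in order, for the truncation error, for the relative error
   of the activity, and for keeping the rounded activity below lam'. *)
pose A0 := (2 ^ b1 + 2 ^ b2 + 2 ^ b3)%N.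
have A01 : 8 * K1 <= A0%:R by apply: le_trans hb1 _; rewrite ler_nat /A0 -addnA leq_addr.
have A02 : 8 / lambda <= A0%:R by apply: le_trans hb2 _; rewrite ler_nat /A0 addnAC leq_addl.
have A03 : (lam' - lambda)^-1 <= A0%:R by apply: le_trans hb3 _; rewrite ler_nat leq_addl.
have A0_2 : (2 <= A0)%N.
  by rewrite /A0 -addnA; apply: (@leq_add 1 1); rewrite ?addn_gt0 expn_gt0.
have [bD hbD] := natr_le_expn2 Delta.
have [bc hbc] := natr_le_expn2 `|c0|.
have [bl hbl] := natr_le_expn2 lambda.
have [T hT] := program_exec A0 A.
(* Exponent of X in the number of machine steps: [bc] for c0, [A.+1 * bD] for Delta^l as 2^l <= X^(A
   + 1), 1 for the root level, and 2 for two factors n + 1. *)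
pose e := (bc + A.+1 * bD + 1 + 2)%N; pose dd := (11 * (T + (bl + 1) + A + e + 2))%N.
exists (fptas_program A0 A), ((8 * A0) ^ dd)%N, (2 * dd)%N.
move=> G FG n f [g fK gK] eps eps01 act acc actP accP.
have [e0 e1] := andP eps01; have finG := F_finite FG.
have [k [klo khi keps keps' kacc]] := accuracy_scale eps01 accP.
pose X := (A0 * ((n + 1) * 2 ^ k))%N.
have k2 : (0 < 2 ^ k)%N by rewrite expn_gt0.
have A0X : (A0 <= X)%N by rewrite leq_pmulr// muln_gt0 k2 addn1.
have X2 : (2 <= X)%N by exact: leq_trans A0X.
have nX : (n + 1 <= X)%N.
  by rewrite /X mulnCA leq_pmulr// muln_gt0 k2 andbT; exact: leq_trans A0_2.
have kX : (2 ^ k <= X)%N by rewrite /X mulnA leq_pmull// muln_gt0 addn1 (leq_trans _ A0_2).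
have Xy : (X <= X ^ A)%N by rewrite -{1}[X]expn1 leq_pexp2l// (leq_trans _ X2).
have exl : exists l, (X ^ A <= 2 ^ l)%N by exists (X ^ A)%N; rewrite ltnW// ltn_expl.
pose l := ex_minn exl.
have [lhi llo] : (X ^ A <= 2 ^ l)%N /\ forall i, (i < l)%N -> (2 ^ i < X ^ A)%N.
  rewrite /l; case: ex_minnP => j hj minj; split=> // i ij.
  by rewrite ltnNge; apply/negP => /minj; rewrite leqNgt ij.
have l0 : (0 < l)%N.
  case: (posnP l) lhi => // ->; rewrite expn0 => h.
  by have := leq_trans X2 (leq_trans Xy h).
have kl : (k <= l)%N.
  by rewrite -(@leq_exp2l 2)// (leq_trans kX)// (leq_trans Xy).
have l2y : (2 ^ l <= X ^ A.+1)%N.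
  rewrite -(prednK l0) expnS expnS leq_mul//; apply/ltnW/llo.
  by rewrite prednK.
have lX : (l <= X ^ A.+1)%N by rewrite (leq_trans _ l2y)// ltnW// ltn_expl.
pose a := act l; pose lam := a%:R / (2 ^ l)%:R : R.
have X0 : 0 < X%:R :> R by rewrite ltr0n (leq_trans _ X2).
have P0 : (0 < 2 ^ l)%N by rewrite expn_gt0.
have P0' : 0 < (2 ^ l)%:R :> R by rewrite ltr0n.
have lamd : `|lam - lambda| <= X%:R^-1.
  have -> : lam - lambda = (a%:R - lambda * 2 ^+ l) / (2 ^ l)%:R.
    by rewrite /lam natrX mulrBl mulfK// gt_eqF// exprn_gt0.
  rewrite normrM normfV (ger0_norm (ltW P0')) ler_pdivrMr//.
  apply: le_trans (actP l) _; rewrite mulrC ler_pdivlMr// mul1r ler_nat.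
  exact: leq_trans lhi.
have X8 : X%:R^-1 <= lambda * (eps / (8 * n.+1%:R)).
  rewrite -div1r ler_pdivrMr//.
  have -> : lambda * (eps / (8 * n.+1%:R)) * X%:R =
    (A0%:R / (8 / lambda)) * (eps * (2 ^ k)%:R).
    rewrite /X !natrM addn1; field.
    by rewrite gt_eqF//= -[1]/(1%:R) -natrD pnatr_eq0.
  have p1 : 1 <= A0%:R / (8 / lambda) by rewrite ler_pdivlMr ?divr_gt0// mul1r.
  have p2 : 1 <= eps * (2 ^ k)%:R.
    by move: keps; rewrite -[eps^-1]mul1r ler_pdivrMr// mulrC.
  by rewrite -[leLHS]mulr1 ler_pM.
pose d := eps / (8 * n.+1%:R).
have n1 : 1 <= n.+1%:R :> R by rewrite ler1n.
have d0 : 0 <= d by rewrite divr_ge0 ?mulr_ge0// ltW.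
have d1 : d <= 1 by rewrite /d ler_pdivrMr ?mulr_gt0 ?ltr0n//; lra.
have de : 8 * n.+1%:R * d <= eps.
  by rewrite /d mulrC divfK// mulf_neq0// ?pnatr_eq0.
have [ld1 ld2] : lambda * (1 - d) <= lam /\ lam <= lambda * (1 + d).
  move: lamd => /le_trans/(_ X8)/ler_normlP[]; rewrite -/d mulrBr mulrDr mulr1; lra.
have lam0 : 0 < lam.
  apply: lt_le_trans ld1; rewrite mulr_gt0// subr_gt0.
  rewrite /d ltr_pdivrMr ?mulr_gt0 ?ltr0n//; lra.
have a0 : (0 < a)%N.
  by move: lam0; rewrite /lam pmulr_lgt0 ?invr_gt0// ltr0n.
have lamle : lam <= lam'.
  have : lam <= lambda + X%:R^-1 by move: lamd => /ler_normlP[]; lra.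
  move=> /le_trans; apply.
  have : X%:R^-1 <= (A0%:R : R)^-1.
    by rewrite lef_pV2 ?posrE// ?ltr0n ?(leq_trans _ A0_2)// ler_nat.
  have : (A0%:R : R)^-1 <= lam' - lambda.
    by rewrite -[leRHS]invrK lef_pV2 ?posrE ?invr_gt0 ?subr_gt0// ltr0n (leq_trans _ A0_2).
  lra.
have lam0' : 0 < lam <= lam' by rewrite lam0.
pose E := label_adj f.
have sz0 : (@size frame [::] + l = l)%N by [].
have [//|//|//|//|K [s' [p' [q' [itK p'0 q'0 val bK]]]]] :=
  @depth_first R G n f g fK gK finG l a (2 ^ l)%N a0 P0 l 0%N 0%N 0%N 1%N 1%N
    [::] predT sz0.
have vsE : later_vertices f predT 0 = [seq f i | i <- enum 'I_n].
  by rewrite /later_vertices drop0 filter_predT.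
have remE : remaining g 0 = vertices G.
  by apply/fsetP => u; rewrite mem_remaining// /nat_bit div0n in_fset_set// in_setT.
have on : graph_order G = n by exact: graph_order_label fK gK finG.
pose cs := kids [seq f i | i <- enum 'I_n] (vertices G).
rewrite vsE remE -/cs in val bK.
have cs_n : (size cs <= n)%N.
  by rewrite (leq_trans (size_kids _ _))// size_map size_enum_ord.
have nbP := mem_label_nbs gK.
have lfin (v : G) i : finite_set (saws v i).
  by apply: locally_finite_saws => u; apply: sub_finite_set finG.
have long (v : G) : ac * ln (graph_order G)%:R <= l%:R.
  have n0 : (0 < n)%N by exact: leq_ltn_trans (leq0n _) (ltn_ord (g v)).
  have n0' : 0 < n%:R :> R by rewrite ltr0n.
  rewrite on; apply: (@le_trans _ _ (A%:R * ln n%:R)).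
    by rewrite ler_wpM2r// ln_ge0// ler1n.
  rewrite mulr_natl -lnXn//.
  apply: (@le_trans _ _ (ln (2 ^+ l))).
    rewrite ler_ln ?posrE ?exprn_gt0// -!natrX ler_nat (leq_trans _ lhi)//.
    by rewrite leq_exp2r// (leq_trans _ nX)// leq_addr.
  by rewrite lnXn// -[ln 2 *+ l]mulr_natr -[leRHS]mul1r ler_wpM2r// ln2_le1.
have sums (v : G) : (\sum_(1 <= i < l.+1) nb_saws v i)%N%:R <= `|c0| * Delta ^+ l.
  apply: le_trans (Fcc G FG v l (long v)) _.
  by rewrite ler_wpM2r ?ler_norm// exprn_ge0// ltW.
(* Compare A-th powers: (th^A)^l <= 2^(-l) <= X^(-A). *)
have thX : th ^+ l <= X%:R^-1.
  rewrite -(@ler_pXn2r _ A)// ?nnegrE ?exprn_ge0 ?invr_ge0 ?(ltW th0) ?(ltW X0)//.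
  rewrite -exprM mulnC exprM exprVn.
  apply: (@le_trans _ _ (2^-1 ^+ l)).
    by rewrite lerXn2r// nnegrE ?exprn_ge0 ?(ltW th0)// invr_ge0.
  rewrite exprVn lef_pV2 ?posrE ?exprn_gt0// -!natrX ler_nat.
  exact: lhi.
have ratio_err c : c \in cs ->
    0 <= hc_ratio lam c.1 c.2 /\
    `|hc_ratio lam c.1 c.2 - trunc_ratio lam (label_nbs f) l c.1 c.2| <= d.
  move=> _; split; first exact: hc_ratio_ge0.
  apply: (@le_trans _ _ (Kd * `|c0| `^ q * th ^+ l)).
    apply: dec => //; apply: (@le_trans _ _ (nb_saws c.1 l)%:R).
      by rewrite ler_nat; exact: size_saw_tree_level_le.
    apply: (@le_trans _ _ (`|c0| * Delta ^+ l)).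
      apply: le_trans (sums c.1); rewrite ler_nat big_nat_recr//= leq_addl//.
    by rewrite ler_wpM2l// lerXn2r ?nnegrE ?(ltW D0) ?(ltW (lt_trans D0 DD')) ?(ltW DD').
  apply: (@le_trans _ _ (K1 * X%:R^-1)); first by rewrite ler_wpM2l.
  rewrite ler_pdivrMr//.
  have -> : d * X%:R = (A0%:R / 8) * (eps * (2 ^ k)%:R).
    rewrite /d /X !natrM addn1; field.
    by rewrite -[1]/(1%:R) -natrD pnatr_eq0.
  have p2 : 1 <= eps * (2 ^ k)%:R.
    by move: keps; rewrite -[eps^-1]mul1r ler_pdivrMr// mulrC.
  rewrite -[leLHS]mulr1 ler_pM// ler_pdivlMr// mulrC; exact: A01.
have treeW c : c \in cs -> (saw_tree_size (label_nbs f) l c.1 c.2 <= X ^ (bc + A.+1 * bD + 1))%N.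
  move=> _; rewrite saw_tree_sizeE.
  (* The extra 1 counts the empty walk, which the sum in the connective constant omits. *)
  have : (\sum_(i < l) size (saw_tree_level (label_nbs f) i c.1 c.2) <=
      1 + \sum_(1 <= i < l.+1) nb_saws c.1 i)%N.
    apply: (@leq_trans (\sum_(0 <= i < l) nb_saws c.1 i)%N).
      by rewrite big_mkord; apply: leq_sum => i _; exact: size_saw_tree_level_le.
    rewrite big_ltn// big_nat_recr//=; apply: leq_add; last exact: leq_addr.
    rewrite /nb_saws; have -> : saws c.1 0 = [set [::]].
      by apply/seteqP; split=> [p [/size0nil -> //]|p -> /=]; split.
    by rewrite fset_set1 cardfs1.
  move=> /leq_trans; apply.
  have W0 : (0 < X ^ (bc + A.+1 * bD))%N by rewrite expn_gt0 (leq_trans _ X2).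
  have : (\sum_(1 <= i < l.+1) nb_saws c.1 i <= X ^ (bc + A.+1 * bD))%N.
    rewrite -(ler_nat R); apply: le_trans (sums c.1) _.
    rewrite expnD natrM ler_pM ?exprn_ge0 ?(ltW D0)//.
      apply: le_trans hbc _; rewrite ler_nat; case: (bc) => // m.
      by rewrite leq_exp2r.
    apply: (@le_trans _ _ ((2 ^ bD)%:R ^+ l)).
      by rewrite lerXn2r ?nnegrE ?(ltW D0).
    rewrite -natrX ler_nat -expnM mulnC expnM [X in (_ <= X)%N]expnM.
    by case: (bD) => // m; rewrite leq_exp2r.
  rewrite addn1 expnS; move: W0 X2; move: (X ^ _)%N (\sum_(_ <= _ < _) _)%N; clear.
  by move=> w s; nia.
have KX : (K <= X ^ e)%N.
  apply: leq_trans bK _; rewrite subn0 /e expnD.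
  set W := (X ^ (bc + A.+1 * bD + 1))%N.
  have W0 : (0 < W)%N by rewrite expn_gt0 (leq_trans _ X2).
  have : (\sum_(c <- cs) saw_tree_size (label_nbs f) l c.1 c.2 <= n * W)%N.
    apply: (@leq_trans (\sum_(c <- cs) W)%N).
      by rewrite big_seq [X in (_ <= X)%N]big_seq; apply: leq_sum.
    by rewrite big_const_seq count_predT iter_addn_0 mulnC leq_mul2r cs_n orbT.
  move: (\sum_(c <- cs) _)%N => S hS.
  apply: (@leq_trans (n + n.+1 * (n * W))%N); first by rewrite leq_add2l leq_mul2l hS orbT.
  rewrite expnS expn1; move: nX W0; move: (X) W {hS}; clear.
  move=> X W nX W0; apply: (@leq_trans (W * ((n + 1) * (n + 1))))%N; first nia.
  by rewrite leq_mul2l leq_mul ?orbT.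
have aP : (a + 2 ^ l <= 2 ^ (bl + 1 + l + 1))%N.
  exact: activity_numerator_bound actP hbl.
have [[kB lB nB il] aB l2B sB wB] := @precision_bounds (bl + 1) k l n K a kl aP.
set B := (_ * (K + 2))%N in kB lB nB il aB l2B sB wB.
have [m [t [ex tT m0 m1]]] := hT act acc n
  (graph_input (fun i j => adj (f i) (f j))) E k l K s' p' q' B erefl
  (graph_input_adj f) (graph_input_far f)
  (fun b _ => leq_ltn_trans (graph_input_le f b)
     (leq_trans (ltn_expl n.+1 (isT : (1 < 2)%N)) (leq_pexp2l (isT : (0 < 2)%N) nB)))
  klo khi (leq_trans kacc (leq_pexp2l (isT : (0 < 2)%N) kB)) (ltnW kB)
  llo lhi (leq_ltn_trans lhi il) lB a0 aB itK l2B sB wB.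
have yE : p'%:R / q'%:R = \prod_(c <- cs) (1 + trunc_ratio lam (label_nbs f) l c.1 c.2)^-1 :> R.
  by rewrite val divr1 mul1r.
exists m, t; split=> //.
- have tX : (t <= X ^ dd)%N.
    by apply: leq_trans tT _; apply: polynomial_time_bound => //; rewrite (leq_trans _ nX)// leq_addr.
  apply: (@le_trans _ _ (X%:R ^+ dd)); first by rewrite -natrX ler_nat.
  rewrite natrX exprM -exprMn lerXn2r ?nnegrE ?mulr_ge0 ?exprn_ge0 ?addr_ge0 ?invr_ge0 ?(ltW e0)//.
  exact: scale_bound.
- by rewrite m1.
- have z2E : (m 0)%:R / (m 1)%:R =
      \prod_(c <- cs) (1 + trunc_ratio lam (label_nbs f) l c.1 c.2) :> R.
    by rewrite m0 m1 -[LHS]invrK invf_div yE prodfV invrK.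
  have subv : {subset vertices G <= [seq f i | i <- enum 'I_n]}.
    by move=> u; rewrite (perm_mem (perm_vertices fK gK finG)).
  have dd1 : 0 <= d <= 1 by rewrite d0.
  have lds : lambda * (1 - d) <= lam <= lambda * (1 + d) by rewrite ld1.
  have vn : (#|` vertices G| <= n)%N by rewrite -/(graph_order G) on.
  have act1 := hc_sum_activity lambda_gt0 dd1 lds vn.
  have := prodr_ratio_bounds dd1 ratio_err.
  rewrite -(hc_sum_prod_kids lam0 subv) => tr1.
  rewrite z2E; apply: two_step_approximation eps01 d0 de cs_n _ act1 tr1.
  exact: ltW (hc_sum_gt0 lambda_gt0 _).
Qed.
End FPTAS.

Theorem theorem1p1 (R : realType) (Delta lambda : R) (F : graph_family)
    (Delta_gt1 : 1 < Delta)
    (lambda_gt0 : 0 < lambda)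
    (lambda_lt : lambda < lambda_c Delta)
    (F_finite : forall G : graph, F G -> finite_graph G)
    (F_cc : family_connective_constant_le F Delta) :
  has_fptas lambda F /\
  (forall F_inf : graph_family,
     (forall G : graph, F_inf G ->
        [/\ ~ finite_graph G, locally_finite G &
            (connective_constant R G <= Delta%:E)%E]) ->
     strong_spatial_mixing lambda (fun G => F G \/ F_inf G)).
Proof.
split; first exact: (has_fptas_of_cc Delta_gt1 lambda_gt0).
move=> F_inf F_infP; exact: (strong_spatial_mixing_of_cc Delta_gt1).
Qed.
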